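(* There are nondecreasing functions $S(t)$ and $I(t)$ with nonnegative integer values, defined for integers $t\ge 2$, such that for every $t$ the following holds. The diagram of a finite conjugacy class $D$ of $3$-transpositions has minimum eigenvalue $\rho_{\min}\ge -t$ if and only if the corresponding $3$-transposition group $(G,D)$, $G=\langle D\rangle$, belongs to one of the following classes of central types: (a) the infinitely many groups $3^u{:}2$ of Moufang type (the case $\rho_{\min}=-1$); (b) for each $m\ge 4$, $S(t)$ distinct groups of the form $N{:}\operatorname{Sym}(m)$; (c) $I(t)$ individual examples.
   Context: A $3$-transposition group $(G,D)$ is a group $G$ generated by a conjugacy class $D$ of elements of order $2$ such that $|de|\in\{1,2,3\}$ for all $d,e\in D$; here all groups are finite. Its diagram is the graph with vertex set $D$ in which $d$ and $e$ are adjacent iff $|de|=3$; eigenvalues of the diagram are eigenvalues of its $(0,1)$-adjacency matrix. Two $3$-transposition groups $(G_1,D_1)$, $(G_2,D_2)$ have the same central type if $G_1/Z(G_1)$ and $G_2/Z(G_2)$ are isomorphic as $3$-transposition groups (by an isomorphism carrying the image of $D_1$ to the image of $D_2$); this holds precisely when they have isomorphic diagrams attached to the same central quotient, and groups are counted here up to central type. A $3$-transposition group has Moufang type if its diagram is a complete graph; such a (finite) group is a split extension $N{:}\langle d\rangle$ of a normal $3$-subgroup $N$ by a group of order $2$ generated by $d\in D$. $N{:}\operatorname{Sym}(m)$ denotes a split extension of a normal subgroup $N$ by the symmetric group $\operatorname{Sym}(m)$, with $D$ mapping onto the class of transpositions of $\operatorname{Sym}(m)$ (up to automorphism). In (b)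 the $S(t)$ groups come as $S(t)$ families, each having a member for every $m\ge 4$. *)

(* Defs.v *)
From HB Require Import structures.
From mathcomp Require Import all_boot all_order all_fingroup all_algebra.
From mathcomp Require Import all_solvable all_field.

Set Implicit Arguments.
Unset Strict Implicit.
Unset Printing Implicit Defensive.

Import Order.TTheory GRing.Theory Num.Theory GroupScope.

Definition is_3transposition_group (gT : finGroupType)
    (G : {group gT}) (D : {set gT}) : Prop :=
  [/\ <<D>> = G, D \in classes G, forall d, d \in D -> #[d] = 2
    & forall d e, d \in D -> e \in D -> #[d * e] \in [:: 1; 2; 3]%N].

Record tgroup : Type := TGroup {
  tg_sort : finGroupType;
  tg_group : {group tg_sort};
  tg_class : {set tg_sort};
  tg_axiom : is_3transposition_group tg_group tg_class
}.

Definition diagram (X : tgroup) : rel (tg_sort X) :=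
  [rel d e | #[d * e] == 3].
Arguments diagram : clear implicits.

(* The eigenvalues of an integral matrix are algebraic numbers, and those of  *)
(* a symmetric one are real, so algC contains the whole real spectrum. For    *)
(* a, b : algC, [a <= b] means that b - a is a nonnegative real.              *)
Definition diagram_mx (X : tgroup) : 'M[algC]_#|tg_class X| :=
  \matrix_(i, j) (diagram X (enum_val i) (enum_val j))%:R%R.

Definition is_rho_min (X : tgroup) (r : algC) : Prop :=
  eigenvalue (diagram_mx X) r
  /\ forall a, eigenvalue (diagram_mx X) a -> (r <= a)%R.

Definition same_central_type (X Y : tgroup) : Prop :=
  exists f : {morphism tg_group X / 'Z(tg_group X)
                       >-> coset_of 'Z(tg_group Y)},
    isom (tg_group X / 'Z(tg_group X)) (tg_group Y / 'Z(tg_group Y)) f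
    /\ f @* (tg_class X / 'Z(tg_group X)) = tg_class Y / 'Z(tg_group Y).

Definition in_central_types (C : tgroup -> Prop) (X : tgroup) : Prop :=
  exists2 Y, C Y & same_central_type X Y.

Definition infinitely_many_central_types (C : tgroup -> Prop) : Prop :=
  exists Y : nat -> tgroup, (forall k, C (Y k))
    /\ forall k l, k != l -> ~ same_central_type (Y k) (Y l).

Definition moufang_type (X : tgroup) : Prop :=
  forall d e, d \in tg_class X -> e \in tg_class X -> d != e -> diagram X d e.

(* In 3^u:2 the normal subgroup N is any group of order 3^u: it need not be   *)
(* elementary abelian. The group of order 2 is the case u = 0, in which the   *)
(* diagram is a single vertex.                                                *)
Definition moufang_3u2 (X : tgroup) : Prop :=
  moufang_type X
  /\ exists (u : nat) (N : {group tg_sort X}) (d : tg_sort X),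
       [/\ #|N| = (3 ^ u)%N, d \in tg_class X & N ><| <[d]> = tg_group X].

Definition transpositions (m : nat) : {set 'S_m} :=
  [set s | [exists i, exists j, (i != j) && (s == tperm i j)]].

(* The choice of the morphism f onto Sym(m) absorbs the automorphisms of      *)
(* Sym(m).                                                                    *)
Definition split_by_Sym (m : nat) (X : tgroup) : Prop :=
  exists (N H : {group tg_sort X}) (f : {morphism tg_group X >-> 'S_m}),
    [/\ N ><| H = tg_group X, 'ker f = N, f @* tg_group X = [set: 'S_m]
      & f @* tg_class X = transpositions m].

(* Main.v *)
(* The condition rho_min >= -t says that the Hermitian form v (A + t) v^*, with A
   the adjacency matrix of the diagram, is positive semidefinite; every induced
   subgraph carrying a vector of negative value is then excluded, in particular
   large claws. Suppose that the diagram is not complete. If it has no large star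
   (a clique behaving like the transpositions moving a given point), Ramsey's
   theorem and the excluded subgraphs bound the number of vertices commuting with
   a given one, and then the number of vertices, so that only finitely many
   central types arise. A large star spans a frame d_ij of elements multiplying
   like transpositions; the excluded subgraphs force each vertex to meet the frame
   as some transposition (i j) does, the vertices belonging to (i j) are labelled
   by a finite group A, and D consists of the transpositions w_ij(a) of the wreath
   product of A by Sym(m). For m >= 4 its form is positive semidefinite if and
   only if a form on A alone is, which bounds the order of A. Hence S(t) counts
   isomorphism classes of groups A, and A is recovered from the diagram.

   If the diagram is complete, the Baer-Suzuki theorem places the products d e in
   O_3(G) once this is known in subgroups generated by four vertices, and there it
   follows from the fact that certain commutators become central. *)

Require Import Defs.
From HB Require Import structures.
From mathcomp Require Import all_boot all_order all_fingroup all_algebra.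
From mathcomp Require Import all_solvable all_field.
From mathcomp Require Import zify ring lra.
From Stdlib Require Import Classical ClassicalEpsilon.

Set Implicit Arguments.
Unset Strict Implicit.
Unset Printing Implicit Defensive.

Import Order.TTheory GRing.Theory Num.Theory GroupScope.

(** * Sets of 3-transpositions *)

(** Everything takes place in the set [D] with the operation [x ^ y]. The centre acts trivially on
    [D], and [D] embeds in the central quotient, so a central type is an isomorphism class of such
    operations ([same_centralP]); a bound on the number of vertices leaves finitely many of them.
    Without large stars, the test vectors bound the points commuting with a vertex [d], but not the
    vertices adjacent to it. That bound comes from holonomy: an affine plane through [d] acts on the
    points commuting with [d]. Pairs of vertices are coloured by these actions, and in a
    monochromatic triangle some holonomy acts as a cube, hence trivially, on a point which it has to
    move. The individual examples are the groups without coordinates over any [A], whether or not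
    [A] passes the test for [t]; this makes the classes grow with [t], so that [I] is nondecreasing.
    Distinctness of the families is delicate because an isomorphism of diagrams need not carry
    fibres to fibres: the fibres are recognised by counting, which succeeds when [A] is generated by
    its elements of order 3, and the remaining groups are determined by their order. *)

Section Adjacency.

Variable gT : finGroupType.
Implicit Types x y z f : gT.

Definition adj x y := x ^ y != x.

Lemma adjxx x : adj x x = false.
Proof. by apply/negP=> /negP; apply/negP/negPn/eqP/conjg_fixP; rewrite commgg. Qed.

Lemma adjC x y : adj x y = adj y x.
Proof. by rewrite /adj !conjg_fix commg1_sym. Qed.

Lemma adjJ x y z : adj (x ^ z) (y ^ z) = adj x y.
Proof. by rewrite /adj -conjJg (inj_eq (@conjg_inj _ z)). Qed.

Lemma nadjJ x y : ~~ adj x y -> x ^ y = x.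
Proof. by move/negPn/eqP. Qed.

Lemma adj_neq x y : adj x y -> x != y.
Proof. by apply: contraTneq => ->; rewrite adjxx. Qed.

Lemma adj_fixr f x y : ~~ adj f y -> adj f (x ^ y) = adj f x.
Proof. by move/nadjJ => {1}<-; rewrite adjJ. Qed.

Lemma adj_fixl f x y : ~~ adj f y -> adj (x ^ y) f = adj x f.
Proof. by move=> fy; rewrite adjC adj_fixr // adjC. Qed.

Lemma adj_conjl x y : adj (x ^ y) y = adj x y.
Proof. by rewrite -{2}(nadjJ (negbT (adjxx y))) adjJ. Qed.

Lemma nadj_commute x y : ~~ adj x y -> commute x y.
Proof. by move/nadjJ/conjg_fixP/commgP. Qed.

(* For involutions x and y, x ^ y = y ^ x says that (x * y) ^+ 3 = 1: a set of
   3-transpositions is studied through its conjugation operation only. *)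
Definition tset (D : {set gT}) :=
  [/\ {in D, forall x, x * x = 1}, {in D &, forall x y, x ^ y \in D}
    & {in D &, forall x y, adj x y -> x ^ y = y ^ x}].

End Adjacency.

Section Tset.

Variables (gT : finGroupType) (D : {set gT}).
Hypothesis tD : tset D.
Implicit Types x y z f : gT.

Lemma tset_inv x : x \in D -> x^-1 = x.
Proof. by case: tD => h _ _ /h e; apply/eqP; rewrite eq_invg_mul e. Qed.

Lemma tset_mulgg x : x \in D -> x * x = 1.
Proof. by case: tD => h _ _ /h. Qed.

Lemma tset_mulK x y : y \in D -> x * y * y = x.
Proof. by move=> yD; rewrite -mulgA tset_mulgg ?mulg1. Qed.

Lemma tset_mulKV x y : y \in D -> y * (y * x) = x.
Proof. by move=> yD; rewrite mulgA tset_mulgg ?mul1g. Qed.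

Lemma tsetJ x y : x \in D -> y \in D -> x ^ y \in D.
Proof. by case: tD => _ h _; exact: h. Qed.

Lemma tset_conjE x y : y \in D -> x ^ y = y * x * y.
Proof. by move=> yD; rewrite conjgE tset_inv // mulgA. Qed.

Lemma tset_conjK x y : y \in D -> (x ^ y) ^ y = x.
Proof. by move=> yD; rewrite -conjgM tset_mulgg // conjg1. Qed.

Lemma tset_braid x y : x \in D -> y \in D -> adj x y -> x ^ y = y ^ x.
Proof. by case: tD => _ _; exact. Qed.

(** Adjacent [x] and [y] generate a copy of Sym(3), and [x ^ y] is its third involution: the third
    point of the line through [x] and [y]. *)
Lemma tset_third x y : x \in D -> y \in D -> adj x y -> x ^ (x ^ y) = y.
Proof.
move=> xD yD xy; have e := tset_braid xD yD xy.
rewrite {1}e -{1}(nadjJ (negbT (adjxx x))) -conjJg.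
by rewrite e tset_conjK.
Qed.

Lemma adj_third x y : x \in D -> y \in D -> adj x y -> adj (x ^ y) x.
Proof. by move=> xD yD xy; rewrite tset_braid // adj_conjl adjC. Qed.

Lemma tset_order3 x y : x \in D -> y \in D -> adj x y ->
  x * y * x * y * x * y = 1.
Proof.
move=> xD yD xy; have := tset_braid xD yD xy.
by rewrite !tset_conjE // => e; rewrite -e !tset_mulK // tset_mulgg.
Qed.

End Tset.

(** * Ramsey's theorem and test vectors *)

Lemma pairwise_in (T : eqType) (r : rel T) (s : seq T) :
  symmetric r -> pairwise r s ->
  {in s &, forall x y, x != y -> r x y}.
Proof.
move=> sr; elim: s => [|a s IH] //= /andP[/allP ra /IH{}IH] x y.
rewrite !inE => /predU1P[->|xs] /predU1P[->|ys]; rewrite ?eqxx //.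
- by move=> _; apply: ra.
- by move=> _; rewrite sr; apply: ra.
by apply: IH.
Qed.

Lemma pairwise_of_in (T : eqType) (r : rel T) (s : seq T) : uniq s ->
  {in s &, forall x y, x != y -> r x y} -> pairwise r s.
Proof.
elim: s => //= a s IH /andP[ans us] h; apply/andP; split.
  apply/allP => y ys; apply: h; rewrite ?inE ?eqxx ?ys ?orbT //.
  by apply: contraNneq ans => ->.
by apply: IH => // x y xs ys; apply: h; rewrite inE ?xs ?ys orbT.
Qed.

(* The order of the list matters: the relation need not be symmetric. *)
Lemma ramsey a b : exists N, forall (T : eqType) (r : rel T) (s : seq T),
  N <= size s -> exists2 s', subseq s' s &
    (size s' = a /\ pairwise r s') \/
    (size s' = b /\ pairwise (fun x y => ~~ r x y) s').
Proof.
elim: a b => [|a IHa] b; first by exists 0 => T r s _; exists [::]; [exact: sub0seq|left].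
elim: b => [|b [N2 IHb]]; first by exists 0 => T r s _; exists [::]; [exact: sub0seq|right].
have [N1 {}IHa] := IHa b.+1.
exists (N1 + N2).+1 => T r [|x s] //=; rewrite ltnS => sz.
have cnt := count_predC (r x) s.
case: (leqP N1 (count (r x) s)) => h.
  have [|s' ss' [[h1 h2]|[h1 h2]]] := IHa T r (filter (r x) s); first by rewrite size_filter.
    exists (x :: s'); first by rewrite /= eqxx (subseq_trans ss') // filter_subseq.
    left; split=> /=; first by rewrite h1.
    rewrite h2 andbT; apply/allP => y /(mem_subseq ss').
    by rewrite mem_filter => /andP[].
  exists s'; last by right.
  by apply: subseq_trans (subseq_cons _ _); rewrite (subseq_trans ss') // filter_subseq.
have [|s' ss' [[h1 h2]|[h1 h2]]] := IHb T r (filter (predC (r x)) s).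
- rewrite size_filter; move: cnt sz h; set A := count _ _; set B := count _ _; lia.
- exists s'; last by left.
  by apply: subseq_trans (subseq_cons _ _); rewrite (subseq_trans ss') // filter_subseq.
exists (x :: s'); first by rewrite /= eqxx (subseq_trans ss') // filter_subseq.
right; split=> /=; first by rewrite h1.
rewrite h2 andbT; apply/allP => y /(mem_subseq ss').
by rewrite mem_filter => /andP[].
Qed.

(** Induction on the number of colours: one colour is played against all the others by [ramsey], and
    a large set avoiding it falls under the induction hypothesis. *)
Lemma ramsey_triangle k : exists N, forall (T K : eqType) (col : T -> T -> K)
    (cs : seq K) (s : seq T), size cs <= k -> N <= size s ->
  pairwise (fun x y => col x y \in cs) s ->
  exists x y z, [/\ subseq [:: x; y; z] s, col y z = col x y & col x z = col x y].
Proof.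
elim: k => [|k [N IH]].
  by exists 2 => T K col cs [|x [|y s]] //; rewrite leqn0 => /nilP ->.
have [M RM] := ramsey 3 (maxn N 2).
exists (maxn M 2) => T K col cs s; rewrite geq_max; case: cs => [|c cs] szc /andP[szs s2].
  by case: s s2 {szs} => [|x [|y s]].
move=> colP.
have [s' ss' [[s3 p3]|[sN pN]]] := RM _ (fun x y => col x y == c) s szs.
  case: s' s3 p3 ss' => [|x [|y [|z []]]] //= _.
  rewrite !andbT => /andP[/andP[/eqP e1 /eqP e2] /eqP e3] ss'.
  by exists x, y, z; split; rewrite ?e1 ?e2 ?e3.
have [||x [y [z [h1 h2 h3]]]] := IH T K col cs s' szc _.
- by rewrite sN leq_maxl.
- have: pairwise [rel x y | (col x y != c) && (col x y \in c :: cs)] s'.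
    by rewrite pairwise_relI pN (subseq_pairwise ss').
  apply: sub_pairwise => x y /= /andP[/negPf ne].
  by rewrite inE ne.
by exists x, y, z; split=> //; apply: subseq_trans ss'.
Qed.

Section TestVectors.

Variables (gT : finGroupType) (D : {set gT}) (t : nat).
Local Open Scope ring_scope.

(** Positivity of [A + t] is tested on integer vectors only: they suffice for every excluded
    subgraph below. *)
Definition psd := forall v : gT -> int,
  0 <= \sum_(x in D) \sum_(y in D) v x * v y * (adj x y)%:R
       + t%:R * \sum_(x in D) v x ^+ 2.

Hypothesis psdD : psd.

Lemma psd_seq (l : seq (gT * int)) : uniq (unzip1 l) ->
  {subset unzip1 l <= D} ->
  0 <= \sum_(p <- l) \sum_(q <- l) p.2 * q.2 * (adj p.1 q.1)%:R
       + t%:R * \sum_(p <- l) p.2 ^+ 2.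
Proof.
move=> ul lD; pose v x := \sum_(p <- l | p.1 == x) p.2.
have sumv (G : gT -> int) : \sum_(x in D) v x * G x = \sum_(p <- l) p.2 * G p.1.
  transitivity (\sum_(x in D) \sum_(p <- l) (if p.1 == x then p.2 * G p.1 else 0)).
    apply: eq_bigr => x _; rewrite /v mulr_suml -big_mkcond.
    by apply: eq_bigr => p /eqP ->.
  rewrite exchange_big /=; apply: eq_big_seq => p pl.
  rewrite (bigD1 p.1) /=; last by apply: lD; apply: map_f.
  rewrite eqxx big1 ?addr0 // => x /andP[_ /negPf]; by rewrite eq_sym => ->.
have vE p : p \in l -> v p.1 = p.2.
  move=> pl; rewrite /v; elim: (l) ul pl => //= q l' IH /andP[ql' /IH{}IH].
  rewrite big_cons inE => /predU1P[->|pl'].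
    rewrite eqxx big_seq_cond big1 ?addr0 // => r /andP[rl' /eqP e].
    by move: ql'; rewrite -e map_f.
  by rewrite ifN ?IH //; apply: contraNneq ql' => ->; apply: map_f.
have := psdD v; set A := \sum_(x in D) _; set B := \sum_(x in D) _.
have -> : A = \sum_(p <- l) \sum_(q <- l) p.2 * q.2 * (adj p.1 q.1)%:R.
  transitivity (\sum_(x in D) v x * \sum_(y in D) v y * (adj x y)%:R).
    by apply: eq_bigr => x _; rewrite mulr_sumr; apply: eq_bigr => y _; rewrite mulrA.
  rewrite sumv; apply: eq_bigr => p _; rewrite sumv mulr_sumr.
  by apply: eq_bigr => q _; rewrite mulrA.
suff -> : B = \sum_(p <- l) p.2 ^+ 2 by [].
rewrite /B (eq_bigr (fun x => v x * v x)) ?sumv; last by move=> x _; rewrite expr2.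
by apply: eq_big_seq => p pl; rewrite vE // expr2.
Qed.


Definition edges (s s' : seq gT) : int :=
  \sum_(x <- s) \sum_(y <- s') (adj x y)%:R.

(** The test vectors on large subgraphs are constant on disjoint lists of vertices, so that only
    edge counts between the lists enter their values. *)
Lemma psd_blocks (l : seq (int * seq gT)) : uniq (flatten (map snd l)) ->
  {subset flatten (map snd l) <= D} ->
  0 <= \sum_(b <- l) \sum_(c <- l) b.1 * c.1 * edges b.2 c.2
       + t%:R * \sum_(b <- l) b.1 ^+ 2 * (size b.2)%:R.
Proof.
pose f := [seq [seq (x, b.1) | x <- b.2] | b <- l].
have fE : unzip1 (flatten f) = flatten (map snd l).
  rewrite /unzip1 map_flatten -map_comp; congr flatten; apply: eq_map => b /=.
  by rewrite -map_comp map_id.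
rewrite -fE => u /(psd_seq u); congr (_ <= _ + _ * _).
  rewrite big_flatten big_map; apply: eq_bigr => b _; rewrite big_map.
  transitivity (\sum_(x <- b.2) \sum_(c <- l) \sum_(y <- c.2)
                 b.1 * c.1 * (adj x y)%:R).
    by apply: eq_bigr => x _; rewrite big_flatten big_map; apply: eq_bigr => c _; rewrite big_map.
  rewrite exchange_big /=; apply: eq_bigr => c _; rewrite mulr_sumr.
  by apply: eq_bigr => x _; rewrite mulr_sumr.
rewrite big_flatten big_map; apply: eq_bigr => b _; rewrite big_map.
by rewrite /= big_const_seq count_predT iter_addr_0 mulr_natr.
Qed.

Lemma edges_const (e : bool) (s s' : seq gT) :
  {in s & s', forall x y, adj x y = e} ->
  edges s s' = (size s)%:R * (size s')%:R * e%:R.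
Proof.
move=> h; rewrite /edges (eq_big_seq (fun _ => e%:R * (size s')%:R)).
  by rewrite /= big_const_seq count_predT iter_addr_0 -mulr_natr; ring.
move=> x xs; rewrite (eq_big_seq (fun _ => e%:R)) => [|y ys]; last by rewrite h.
by rewrite /= big_const_seq count_predT iter_addr_0 mulr_natr.
Qed.

Lemma edgesC s s' : edges s s' = edges s' s.
Proof.
rewrite /edges exchange_big /=; apply: eq_bigr => y _.
by apply: eq_bigr => x _; rewrite adjC.
Qed.

Lemma edges_clique (s : seq gT) : pairwise (@adj gT) s ->
  edges s s = (size s)%:R * ((size s)%:R - 1).
Proof.
elim: s => [|x s IH] /=; first by rewrite /edges big_nil mul0r.
case/andP=> /allP xs /IH{}IH.
have -> : edges (x :: s) (x :: s) = edges [:: x] s + edges s [:: x] + edges s s.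
  rewrite /edges !big_cons !big_nil adjxx add0r addr0 -addrA; congr (_ + _).
  rewrite -big_split /=; apply: eq_bigr => y _.
  by rewrite !big_cons big_nil addr0.
rewrite (edgesC s) (edges_const (e := true)) ?IH => [|y z]; last first.
  by rewrite inE => /eqP -> /xs.
by rewrite /= -natr1; ring.
Qed.

Lemma no_claw c s : c \in D -> {subset s <= D} -> uniq s -> {in s, forall x, adj c x} ->
  {in s &, forall x y, adj x y = false} -> (t.+1 ^ 2 <= size s)%N -> False.
Proof.
move=> cD sD us cs ss szs; wlog e : s sD us cs ss szs / size s = (t.+1 ^ 2)%N.
  move=> h; apply: (h (take (t.+1 ^ 2)%N s)).
  - by move=> x /mem_take; apply: sD.
  - exact: take_uniq.
  - by move=> x /mem_take; apply: cs.
  - by move=> x y /mem_take xs /mem_take; apply: ss.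
  - by rewrite size_takel.
  - by rewrite size_takel.
have cns : c \notin s by apply/negP => /cs; rewrite adjxx.
(* With [n = (t + 1) ^ 2] leaves the value is [- 2 (t + 1) n + t n + t (t + 1) ^ 2 = - 2 n]. *)
have := @psd_blocks [:: (- t.+1%:R, [:: c]); (1, s)].
rewrite /= cats0 us cns !big_cons !big_nil /= (edgesC s).
rewrite (edges_const (s := [:: c]) (s' := [:: c]) (e := false)); last first.
  by move=> x y; rewrite !inE => /eqP -> /eqP ->; exact: adjxx.
rewrite (edges_const (s := [:: c]) (s' := s) (e := true)); last first.
  by move=> x y; rewrite !inE => /eqP ->; apply: cs.
rewrite (edges_const (e := false)) // e => /(_ isT).
have sD' : {subset c :: s <= D} by move=> x; rewrite inE => /predU1P[->|/sD].
move=> /(_ sD').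
suff : t.+1%:R > 0 :> int by rewrite natrX -natr1 /=; nra.
by rewrite ltr0n.
Qed.

Lemma no_clique_path s1 s2 s3 : (0 < t)%N -> {subset s1 ++ s2 ++ s3 <= D} ->
  uniq (s1 ++ s2 ++ s3) ->
  pairwise (@adj gT) s1 -> pairwise (@adj gT) s2 -> pairwise (@adj gT) s3 ->
  {in s1 & s2, forall x y, adj x y} -> {in s2 & s3, forall x y, adj x y} ->
  {in s1 & s3, forall x y, adj x y = false} ->
  size s1 = (3 * t)%N -> size s2 = (3 * t)%N -> size s3 = (3 * t)%N -> False.
Proof.
move=> t0 sD us k1 k2 k3 k12 k23 k13 z1 z2 z3.
(* With blocks of size [n = 3 t] the value is [n (17 t - 17 - 7 n)], where [17 = 4 + 9 + 4] comes
   from the blocks and [- 24] of [- 7 = 17 - 24] from the two joins; it is negative. *)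
have := @psd_blocks [:: (2, s1); (- 3, s2); (2, s3)].
rewrite /= cats0 us !big_cons !big_nil /= (edgesC s2 s1) (edgesC s3 s1) (edgesC s3 s2).
rewrite (edges_const (s := s1) (s' := s2) (e := true)) //.
rewrite (edges_const (s := s2) (s' := s3) (e := true)) //.
rewrite (edges_const (s := s1) (s' := s3) (e := false)) //.
rewrite !edges_clique // z1 z2 z3 => /(_ isT sD).
suff : t%:R > 0 :> int by rewrite natrM /=; nra.
by rewrite ltr0n.
Qed.

Lemma no_two_claws y1 y2 s1 s2 : (0 < t)%N -> {subset [:: y1, y2 & s1 ++ s2] <= D} ->
  y1 != y2 -> adj y1 y2 = false -> uniq (s1 ++ s2) -> pairwise (@adj gT) (s1 ++ s2) ->
  {in s1, forall x, adj y1 x} -> {in s1, forall x, adj y2 x = false} ->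
  {in s2, forall x, adj y2 x} -> {in s2, forall x, adj y1 x = false} ->
  size s1 = (t ^ 2)%N -> size s2 = (t ^ 2)%N -> False.
Proof.
move=> t0 sD y12 ny12 us k h11 h21 h22 h12 z1 z2.
(* With [n = t ^ 2] the quadratic terms of the clique cancel, and the value is [- 4 t n - 2 n + 2 t
   ^ 3 + 2 t n = - 2 t ^ 2]. *)
have := @psd_blocks [:: (t%:R, [:: y1]); (- t%:R, [:: y2]); (- 1, s1); (1, s2)].
have y1s2 : y1 \notin s2.
  apply/negP => ys; have: adj y2 y1 by exact: h22.
  by rewrite adjC ny12.
have y2s1 : y2 \notin s1.
  by apply/negP => /h11; rewrite ny12.
have y1s1 : y1 \notin s1 by apply/negP => /h11; rewrite adjxx.
have y2s2 : y2 \notin s2 by apply/negP => /h22; rewrite adjxx.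
move: (k); rewrite pairwise_cat => /and3P[/allrelP k12 k1 k2].
rewrite /= cats0 us inE (negPf y12) !mem_cat (negPf y1s1) (negPf y1s2) (negPf y2s1) (negPf y2s2).
rewrite !big_cons !big_nil /=.
rewrite (edgesC s1 [:: _]) (edgesC s1 [:: _]) (edgesC s2 [:: _]) (edgesC s2 [:: _]).
rewrite (edgesC [:: y2] [:: y1]) (edgesC s2 s1).
rewrite !(edges_clique (s := [:: _])) //.
rewrite (edges_const (s := s1) (s' := s2) (e := true)) //.
rewrite (edges_const (s := [:: y1]) (s' := [:: y2]) (e := false)); last first.
  by move=> x y; rewrite !inE => /eqP -> /eqP ->.
rewrite (edges_const (s := [:: y1]) (s' := s1) (e := true)); last first.
  by move=> x y; rewrite inE => /eqP -> /h11.
rewrite (edges_const (s := [:: y1]) (s' := s2) (e := false)); last first.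
  by move=> x y; rewrite inE => /eqP -> /h12.
rewrite (edges_const (s := [:: y2]) (s' := s1) (e := false)); last first.
  by move=> x y; rewrite inE => /eqP -> /h21.
rewrite (edges_const (s := [:: y2]) (s' := s2) (e := true)); last first.
  by move=> x y; rewrite inE => /eqP -> /h22.
rewrite !edges_clique // z1 z2 => /(_ isT sD).
suff : t%:R > 0 :> int by rewrite natrX /=; nra.
by rewrite ltr0n.
Qed.

End TestVectors.

(** * Affine planes and groups of Moufang type *)

Section Burnside23.

Variable gT : finGroupType.
Implicit Types a b d x y p q r s : gT.

(** These are defining relations of the Burnside group of exponent 3 on two generators, of order 27.
    What matters is that they make the commutator of [a] and [b] central of order dividing 3. *)
Definition b23 a b :=
  [/\ a ^+ 3 = 1, b ^+ 3 = 1, (a * b) ^+ 3 = 1 & (a^-1 * b) ^+ 3 = 1].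

Lemma b23C a b : b23 a b -> b23 b a.
Proof.
case=> ha hb hab hAb; split=> //.
  have -> : b * a = (a * b) ^ a by rewrite conjgE -mulgA mulKg.
  by rewrite -conjXg hab conj1g.
apply/eqP; rewrite -invg_eq1 -expgVn invMg invgK; apply/eqP; exact: hAb.
Qed.

Lemma cube_swap a b : (a * b) ^+ 3 = 1 -> a * b * a = b^-1 * a^-1 * b^-1.
Proof.
move=> h; have /eqP : (a * b * a) * (b * a * b) = 1.
  by rewrite -h !expgS expg0 mulg1 !mulgA.
by rewrite mulg_eq1 => /eqP ->; rewrite !invMg !mulgA.
Qed.

Lemma b23_commuteJ a b : b23 a b -> commute a (a ^ b).
Proof.
case=> ha hb hab hAb.
have bb : b * b = b^-1.
  by apply/esym/mulg1_eq; rewrite -hb !expgS expg0 mulg1.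
have e1 := cube_swap hab.
have e2 : a * b^-1 * a = b * a^-1 * b.
  rewrite (@cube_swap a b^-1) ?invgK //; apply/eqP; rewrite -invg_eq1 -expgVn.
  by rewrite invMg invgK -(conjg_eq1 _ b) conjXg conjgE -mulgA mulKg hAb.
rewrite /commute conjgE !mulgA e2 -!mulgA bb [a * (b * a)]mulgA e1.
by rewrite !mulgA -[_^-1 * _^-1 in RHS]invMg bb invgK.
Qed.

Lemma b23_comm a b : b23 a b -> commute a [~ a, b] /\ commute b [~ a, b].
Proof.
move=> h; split; first by rewrite commgEl; apply: commuteM; [exact: commuteV | exact: b23_commuteJ].
rewrite commgEr; apply: commuteM => //; rewrite conjVg; apply: commuteV.
by apply/b23_commuteJ/b23C.
Qed.

Lemma b23_comm3 a b : b23 a b -> [~ a, b] ^+ 3 = 1.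
Proof.
move=> h; have [ca _] := b23_comm h; case: h => ha _ _ _.
apply: (mulgI (a ^+ 3)); rewrite -expgMn // commgEl mulKVg.
by rewrite -conjXg ha conj1g mulg1.
Qed.

End Burnside23.

Section Planes.

Variables (gT : finGroupType) (D : {set gT}).
Hypothesis tD : tset D.
Implicit Types d x y p q r s f : gT.

(* The commutator zz d x y of d * x and d * y is the holonomy of the plane
   spanned by d, x and y: it is central there, and trivial when the plane has 9
   points. *)
Definition plane d x y :=
  [/\ (d * x) ^+ 3 = 1, (d * y) ^+ 3 = 1, (x * y) ^+ 3 = 1 & (d ^ x * y) ^+ 3 = 1].

Definition zz d x y := [~ d * x, d * y].

Lemma cub_swap x y : x \in D -> y \in D -> (x * y) ^+ 3 = 1 -> x * y * x = y * x * y.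
Proof. by move=> xD yD /cube_swap ->; rewrite !(tset_inv tD). Qed.

Lemma cub_braid x y : x \in D -> y \in D -> (x * y) ^+ 3 = 1 -> x ^ y = y ^ x.
Proof. by move=> xD yD h; rewrite !(tset_conjE tD) // (cub_swap xD). Qed.

Lemma cubC x y : x \in D -> y \in D -> (x * y) ^+ 3 = 1 -> (y * x) ^+ 3 = 1.
Proof.
move=> xD yD h; apply/eqP; rewrite -invg_eq1 -expgVn invMg.
by rewrite !(tset_inv tD) // h.
Qed.

Lemma adj_cub x y : x \in D -> y \in D -> adj x y -> (x * y) ^+ 3 = 1.
Proof.
by move=> xD yD /(tset_order3 tD xD yD) <-; rewrite !expgS expg0 mulg1 !mulgA.
Qed.

Lemma plane_b23 d x y : d \in D -> x \in D -> y \in D ->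
  plane d x y -> b23 (d * x) (d * y).
Proof.
move=> dD xD yD [h1 h2 h3 h4]; split=> //.
  rewrite mulgA (cub_swap dD xD h1); move: h4.
  by rewrite (tset_conjE tD).
by rewrite invMg !(tset_inv tD) // -mulgA (tset_mulKV tD).
Qed.

Lemma commVl (a b : gT) : commute a [~ a, b] -> [~ a^-1, b] = [~ a, b]^-1.
Proof.
move=> h; rewrite {1}commgEl invgK conjVg.
have -> : a ^ b = a * [~ a, b] by rewrite commgEl mulKVg.
by rewrite h invMg mulKVg.
Qed.

Lemma commVr (a b : gT) : commute b [~ a, b] -> [~ a, b^-1] = [~ a, b]^-1.
Proof.
move=> h; rewrite -invg_comm commVl ?invg_comm //.
by rewrite -invg_comm; apply: commuteV.
Qed.

Section Fixed.

Variables d x y : gT.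
Hypotheses (dD : d \in D) (xD : x \in D) (yD : y \in D) (P : plane d x y).

Let B := plane_b23 dD xD yD P.

(** [d] inverts [d * x] and [d * y]. Since their commutator commutes with both, inverting one
    argument inverts it, and inverting both leaves it unchanged; so it commutes with [d], and then
    with [x] and [y]. *)
Lemma zz_fix : [/\ d ^ zz d x y = d, x ^ zz d x y = x & y ^ zz d x y = y].
Proof.
have [ca cb] := b23_comm B; rewrite -/(zz d x y) in ca cb.
have inv_d u : u \in D -> (d * u) ^ d = (d * u)^-1.
  move=> uD; rewrite conjgE -!mulgA (mulgA d^-1) mulVg mul1g.
  by rewrite invMg !(tset_inv tD).
have cd : commute d (zz d x y).
  apply/commute_sym/commgP/conjg_fixP; rewrite /zz conjRg !inv_d //.
  have eA : [~ (d * x)^-1, d * y] = [~ d * x, d * y]^-1 by exact: commVl ca.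
  by rewrite commVr eA ?invgK //; exact: (commuteV cb).
have cx : commute x (zz d x y).
  have := commuteM (commute_sym cd) (commute_sym ca).
  by rewrite (tset_mulKV tD) // => /commute_sym.
have cy : commute y (zz d x y).
  have := commuteM (commute_sym cd) (commute_sym cb).
  by rewrite (tset_mulKV tD) // => /commute_sym.
by split; apply/conjg_fixP/commgP.
Qed.

Lemma zz3 : zz d x y ^+ 3 = 1.
Proof. exact: b23_comm3. Qed.

Lemma zz_line : zz d x (x ^ y) = (zz d x y)^-1.
Proof.
have [ca cb] := b23_comm B; rewrite -/(zz d x y) in ca cb.
have e : d * x ^ y = (d * y) * (d * x)^-1 * (d * y).
  rewrite invMg !(tset_inv tD) // (tset_conjE tD) // -!mulgA.
  by rewrite !(tset_mulKV tD).
have hy : (d * x) ^ (d * y) = d * x * zz d x y by rewrite /zz commgEl mulKVg.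
have zJ a : commute a (zz d x y) -> zz d x y ^ a = zz d x y.
  by move=> h; apply/conjg_fixP/commgP/commute_sym.
have xz : (d * x) ^ (d * x)^-1 = d * x by rewrite conjgE mulgV mulg1 invgK.
have e2 : (d * x) ^ (d * x ^ y) = d * x * zz d x y * zz d x y.
  rewrite e (conjgM _ (_ * _^-1)) (conjgM _ _ _^-1) hy.
  have -> : (d * x * zz d x y) ^ (d * x)^-1 = d * x * zz d x y.
    by rewrite conjMg xz (zJ _ (commute_sym (commuteV (commute_sym ca)))).
  by rewrite conjMg hy zJ.
rewrite {1}/zz commgEl e2 -(mulgA (d * x)) mulKg.
apply/eqP; rewrite -mulg_eq1; apply/eqP.
by rewrite -[RHS]zz3 !expgS expg0 mulg1 !mulgA.
Qed.

End Fixed.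

Lemma cub_third x y : x \in D -> y \in D -> (x * y) ^+ 3 = 1 -> x ^ (x ^ y) = y.
Proof.
move=> xD yD /(cub_braid xD yD) e.
by rewrite {1}e -{1}(nadjJ (negbT (adjxx x))) -conjJg e (tset_conjK tD).
Qed.

Lemma zzC d x y : zz d y x = (zz d x y)^-1.
Proof. by rewrite /zz invg_comm. Qed.

(** In a plane the factors [d ^ x], [x ^ y], [d ^ y] are the third points of the sides of the
    triangle [d], [x], [y]. In this form the holonomies of consecutive triangles around a polygon
    can be multiplied. *)
Lemma zzE d x y : d \in D -> x \in D -> y \in D -> (d * x) ^+ 3 = 1 ->
  zz d x y = d * (d ^ x * x ^ y * d ^ y).
Proof.
move=> dD xD yD h; have e := cub_swap dD xD h.
rewrite /zz commgEl conjgE !invMg !(tset_inv tD) // !(tset_conjE tD) //.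
by rewrite !mulgA !(tset_mulK tD) // [in RHS]e (tset_mulK tD).
Qed.

(** The four parentheses are the sides of the trapezoid of [zz_trapezoid], written as in [zzE], with
    [m = p ^ q]. The outer factors cancel between consecutive sides, and then the inner ones do. *)
Lemma telescope (a b c e m r : gT) : a * a = 1 -> b * b = 1 -> c * c = 1 ->
  e * e = 1 -> m * m = 1 -> r * r = 1 ->
  (a * m * b) * (b * r * c) * (c * (r * m * r) * e) * (e * r * a) = 1.
Proof.
move=> ha hb hc he hm hr; have K (u : gT) : u * u = 1 -> forall v, v * u * u = v.
  by move=> hu v; rewrite -mulgA hu mulg1.
by rewrite !mulgA (K b) // (K c) // (K e) // (K r) // (K r) // (K m).
Qed.

(* The trapezoid p, q, q ^ r, p ^ r has trivial holonomy. *)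
Lemma zz_trapezoid d p q r : d \in D -> p \in D -> q \in D -> r \in D ->
  plane d p q -> plane d q r -> plane d p r -> plane d (q ^ r) (p ^ r) ->
  zz d (q ^ r) (p ^ r) = zz d q r * (zz d p q)^-1 * (zz d p r)^-1.
Proof.
move=> dD pD qD rD Ppq Pqr Ppr Pst.
have sD : q ^ r \in D by exact: tsetJ.
have tD' : p ^ r \in D by exact: tsetJ.
have cz x y : x \in D -> y \in D -> plane d x y -> commute (zz d x y) d.
  by move=> xD yD P; apply/commute_sym/commgP/conjg_fixP; case: (zz_fix dD xD yD P).
pose g x y := d ^ x * x ^ y * d ^ y.
have gE x y : x \in D -> y \in D -> (d * x) ^+ 3 = 1 -> zz d x y = d * g x y.
  exact: zzE.
have [cpq cqr] : (p * q) ^+ 3 = 1 /\ (q * r) ^+ 3 = 1 by case: Ppq; case: Pqr.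
have cpr : (p * r) ^+ 3 = 1 by case: Ppr.
have cds : (d * q ^ r) ^+ 3 = 1 by case: Pst.
have cdt : (d * p ^ r) ^+ 3 = 1 by case: Pst.
have [cdp cdq] : (d * p) ^+ 3 = 1 /\ (d * q) ^+ 3 = 1 by case: Ppq.
have gg : g p q * g q (q ^ r) * g (q ^ r) (p ^ r) * g (p ^ r) p = 1.
  have eqs : q ^ (q ^ r) = r by exact: cub_third.
  have est : (q ^ r) ^ (p ^ r) = r * p ^ q * r.
    by rewrite -conjJg (cub_braid qD pD) ?(tset_conjE tD) // (cubC pD).
  have etp : (p ^ r) ^ p = r by rewrite (cub_braid pD rD) // (tset_conjK tD).
  by rewrite /g eqs est etp telescope // (tset_mulgg tD) ?tsetJ.
move: gg; rewrite -[g p q](tset_mulKV tD _ dD) -gE //.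
rewrite -[g q _](tset_mulKV tD _ dD) -gE // -[g _ (p ^ r)](tset_mulKV tD _ dD) -gE //.
rewrite -[g _ p](tset_mulKV tD _ dD) -gE //.
rewrite (zz_line dD qD rD Pqr) (zzC d p) (zz_line dD pD rD Ppr) invgK.
have := cz _ _ pD qD Ppq; have := cz _ _ qD rD Pqr.
have := cz _ _ sD tD' Pst; have := cz _ _ pD rD Ppr.
set a := zz d p q; set b := zz d q r; set c := zz d p r; set e := zz d _ _.
move=> cc ce cb ca; clearbody a b c e.
have K x : commute x d -> d * x * d = x.
  by move=> h; rewrite -h (tset_mulK tD).
have -> : d * a * (d * b^-1) * (d * e) * (d * c) = a * b^-1 * e * c.
  rewrite !mulgA (K a ca) -[a * b^-1 * d * e * d]mulgA -[a * b^-1 * d * (e * d)]mulgA.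
  by rewrite (mulgA d) (K e ce).
move/eqP; rewrite mulg_eq1 => /eqP h.
by rewrite -h !mulgA mulgKV mulgV mul1g.
Qed.

End Planes.

(** The subgroup generated by [x] and the core is a p-group, and the last hypothesis makes every
    generator of [K] normalise it; so it is a normal p-subgroup of [K]. *)
Lemma pcore_of_gens (gT : finGroupType) (p : nat) (K : {group gT}) (S : {set gT}) x :
  prime p -> K :=: <<S>> -> x \in K -> x ^+ p = 1 ->
  {in S, forall g, x ^ g \in <<x |: 'O_p(K)>>} -> x \in 'O_p(K).
Proof.
move=> pr KS xK xp hS; pose T := <<x |: 'O_p(K)>>.
have QK : 'O_p(K) <| K := pcore_normal p K.
have TE : T = <[x]> <*> 'O_p(K).
  by rewrite /T -joingE joing_idl.
have xN : <[x]> \subset 'N('O_p(K)).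
  by rewrite cycle_subG (subsetP (normal_norm QK)).
have TK : T \subset K.
  by rewrite gen_subG subUset sub1set xK normal_sub.
have pT : p.-group T.
  rewrite TE norm_joinEl // pgroupM pcore_pgroup andbT /pgroup -orderE.
  have od : #[x] %| p by rewrite order_dvdn xp.
  exact: (pnat_dvd od (pnat_id pr)).
have TN : K \subset 'N(T).
  rewrite KS gen_subG; apply/subsetP => g gS; rewrite inE /T -genJ gen_subG.
  have gK : g \in K by rewrite KS mem_gen.
  apply/subsetP => y /imsetP[u uT ->]; move: uT; rewrite !inE => /predU1P[->|uQ].
    exact: hS.
  apply: mem_gen; rewrite inE; apply/orP; right.
  by rewrite memJ_norm // (subsetP (normal_norm QK)).
have : T \subset 'O_p(K) by apply: pcore_max => //; rewrite /normal TK.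
by move/subsetP; apply; apply: mem_gen; rewrite !inE eqxx.
Qed.

(** * Holonomy of four points in a complete diagram *)

Section Moufang.

Variables (gT : finGroupType) (D : {set gT}).
Hypothesis tD : tset D.
Hypothesis cubD : {in D &, forall x y, (x * y) ^+ 3 = 1}.
Variable o : gT.
Hypothesis oD : o \in D.
Implicit Types p q r s x y : gT.

Local Notation z := (zz o).

Let planeD x y : x \in D -> y \in D -> plane o x y.
Proof. by move=> xD yD; split; apply: cubD => //; apply: tsetJ. Qed.

Let J x y : x \in D -> y \in D -> x ^ y \in D.
Proof. exact: tsetJ. Qed.

Let br x y : x \in D -> y \in D -> x ^ y = y ^ x.
Proof. by move=> xD yD; apply: (cub_braid tD) => //; apply: cubD. Qed.

Let third x y : x \in D -> y \in D -> x ^ (x ^ y) = y.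
Proof. by move=> xD yD; apply: (cub_third tD) => //; apply: cubD. Qed.

Let zo x y : x \in D -> y \in D -> o ^ z x y = o.
Proof. by move=> xD yD; case: (zz_fix tD oD xD yD (planeD xD yD)). Qed.

Let zl x y : x \in D -> y \in D -> x ^ z x y = x.
Proof. by move=> xD yD; case: (zz_fix tD oD xD yD (planeD xD yD)). Qed.

Let zr x y : x \in D -> y \in D -> y ^ z x y = y.
Proof. by move=> xD yD; case: (zz_fix tD oD xD yD (planeD xD yD)). Qed.

Let z3 x y : x \in D -> y \in D -> z x y ^+ 3 = 1.
Proof. by move=> xD yD; apply: (zz3 tD oD xD yD (planeD xD yD)). Qed.

Let zline x y : x \in D -> y \in D -> z x (x ^ y) = (z x y)^-1.
Proof. by move=> xD yD; apply: (zz_line tD oD xD yD (planeD xD yD)). Qed.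

Let zoppl x y : x \in D -> y \in D -> z (x ^ o) y = (z x y)^-1.
Proof.
move=> xD yD; have [ca _] := b23_comm (plane_b23 tD oD xD yD (planeD xD yD)).
rewrite -(commVl ca) /zz; congr [~ _, _].
by rewrite invMg !(tset_inv tD) // (tset_conjE tD) // mulgA (tset_mulKV tD).
Qed.

Let zoppr x y : x \in D -> y \in D -> z x (y ^ o) = (z x y)^-1.
Proof. by move=> xD yD; rewrite zzC zoppl // (zzC o x y) invgK. Qed.

Let zD p q x : p \in D -> q \in D -> x \in D -> x ^ z p q \in D.
Proof.
move=> pD qD xD; rewrite (zzE tD) // ?cubD //.
by rewrite (conjgM x o) (conjgM _ _ (o ^ q)) (conjgM _ _ (p ^ q)) !J.
Qed.

Let fixM x g h : x ^ (g * h) = x -> x ^ h = x -> x ^ g = x.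
Proof.
move=> e1 e2; apply: (@conjg_inj _ h); by rewrite -conjgM e1 e2.
Qed.

Let fixV x g : x ^ g = x -> x ^ g^-1 = x.
Proof. by move=> e; rewrite -{1}e conjgK. Qed.

(** The trapezoid relation writes the holonomy of [q ^ r] and [p ^ r] as [z q r * z q p * z r p].
    This product and its factor [z q r] both fix [q ^ r], hence so does the rest. *)
Lemma moufang_fix_third p q r : p \in D -> q \in D -> r \in D ->
  (q ^ r) ^ (z q p * z r p) = q ^ r.
Proof.
move=> pD qD rD.
have := zz_trapezoid tD oD pD qD rD (planeD pD qD) (planeD qD rD) (planeD pD rD)
  (planeD (J qD rD) (J pD rD)).
rewrite -(zzC o p q) -(zzC o p r) => e.
have := zl (J qD rD) (J pD rD); rewrite e -mulgA conjgM.
by rewrite (conjJg q r) zl // zr.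
Qed.

(** The element [z q s * s] equals [q ^ o * o * r ^ o] with [r = s ^ q]. Its factors carry
    [s ^ z q p] first to [u ^ z q p], where [u = q ^ (r ^ o)], and then on to the target, because by
    [moufang_fix_third] the elements [z q p] and [z r p] act as inverses on [s] and alike on [u]. *)
Lemma moufang_twisted_line p q s : p \in D -> q \in D -> s \in D ->
  (s ^ z q p) ^ (z q s * s) = s ^ (z q p)^-1.
Proof.
move=> pD qD sD; have [r er] : exists r, r = s ^ q by exists (s ^ q).
pose u := q ^ (r ^ o).
have rD : r \in D by rewrite er J.
have roD : r ^ o \in D by exact: J.
have uD : u \in D by exact: J.
have es : s = q ^ r by rewrite er (br sD qD) third.
have fAB : s ^ (z q p * z r p) = s by rewrite es; apply: moufang_fix_third.
have fBA : s ^ (z r p * z q p) = s by rewrite es (br qD rD); apply: moufang_fix_third.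
have eU : u ^ z q p = u ^ z r p.
  apply: (@conjg_inj _ (z r p)^-1); rewrite conjgK -conjgM.
  have := moufang_fix_third pD qD roD; by rewrite zoppl.
have eS : s ^ z r p = s ^ (z q p)^-1.
  by apply: (@conjg_inj _ (z q p)); rewrite conjgKV -conjgM.
have su : s ^ u = q ^ o.
  by rewrite es (br qD rD) /u (br qD roD) -conjJg third // br.
have suo : s ^ (u ^ o) = r ^ o.
  rewrite es /u (conjJg q (r ^ o)) (tset_conjK tD) // -conjJg third ?J //.
  by rewrite br.
have e1 : (s ^ z q p) ^ (q ^ o) = u ^ z q p.
  have -> : q ^ o = (s ^ z q p) ^ (u ^ z q p).
    by rewrite -conjJg su conjJg zl // zo.
  by rewrite -!conjJg third.
have e2 : (u ^ z q p) ^ o = (s ^ (z q p)^-1) ^ (r ^ o).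
  have roB : (r ^ o) ^ z r p = r ^ o by rewrite conjJg zl // zo.
  have -> : (u ^ z q p) ^ o = (u ^ o) ^ z r p by rewrite eU (conjJg u o) zo.
  by rewrite -eS -{1}roB -conjJg -suo third ?J.
have w : q ^ o * o * r ^ o = z q s * s.
  have -> : z q s = (z q r)^-1 by rewrite er (br sD qD) zline ?invgK.
  have [ca _] := b23_comm (plane_b23 tD oD qD rD (planeD qD rD)).
  rewrite -[(z q r)^-1](commVl ca) es commgEl invgK !conjgE !invMg.
  rewrite !(tset_inv tD) // !mulgA !(tset_mulK tD) //.
  rewrite -!mulgA; congr (_ * (_ * _)).
  by rewrite !mulgA (cub_swap tD oD rD) // cubD.
rewrite -w (conjgM _ _ (r ^ o)) (conjgM _ (q ^ o) o) e1 e2 (tset_conjK tD) //; exact: J.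

Qed.

(** Replacing [p] and [q] by [p ^ o] and [q ^ o] preserves [z q p] and inverts [z q s]. By the
    twisted relation, [z q s] and its inverse then send [s ^ z q p] to the same point; as the cube
    of [z q s] is 1, this point is fixed. So [s] and its images under [z q p] and its inverse lie on
    a line. *)
Lemma moufang_line p q s : p \in D -> q \in D -> s \in D ->
  (s ^ z q p) ^ z q s = s ^ z q p /\ (s ^ z q p) ^ s = s ^ (z q p)^-1.
Proof.
move=> pD qD sD; have h1 := moufang_twisted_line pD qD sD.
have := moufang_twisted_line (J pD oD) (J qD oD) sD.
rewrite zoppl ?J // zoppr // invgK zoppl // => h2.
have e : (s ^ z q p) ^ z q s = (s ^ z q p) ^ (z q s)^-1.
  by apply: (@conjg_inj _ s); rewrite -[LHS]conjgM -[RHS]conjgM h1 h2.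
have f : (s ^ z q p) ^ z q s = s ^ z q p.
  have e2 : ((s ^ z q p) ^ z q s) ^ z q s = s ^ z q p by rewrite e conjgKV.
  have e3 : (((s ^ z q p) ^ z q s) ^ z q s) ^ z q s = s ^ z q p.
    move: (z3 qD sD) (s ^ z q p) => h S.
    by rewrite -!conjgM -[RHS]conjg1 -h !expgS expg0 mulg1 mulgA.
  by rewrite e2 in e3.
by split=> //; rewrite -{1}f -conjgM.
Qed.

Section FourPoints.

Variables a b c : gT.
Hypotheses (aD : a \in D) (bD : b \in D) (cD : c \in D).

Let th := z a b.
Let c' := c ^ th.
Let w := c' ^ (c ^ o).

Let c'D : c' \in D. Proof. exact: zD. Qed.
Let coD : c ^ o \in D. Proof. exact: J. Qed.
Let wD : w \in D. Proof. exact: J. Qed.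

Let fix_c' : c' ^ z a c = c'.
Proof. by case: (moufang_line bD aD cD). Qed.

Let fix_w : w ^ th = w.
Proof.
have [_ e] := moufang_line bD aD cD.
have c'' : c' ^ th = c ^ c'.
  rewrite (br cD c'D) /c' /th e -conjgM; congr (_ ^ _).
  apply/eqP; rewrite eq_sym eq_invg_mul; apply/eqP.
  by rewrite -[RHS](z3 aD bD) !expgS expg0 mulg1 mulgA.
rewrite /w conjJg (conjJg c o) zo // c'' -/c' conjJg third // (conjJg c _ o).
by rewrite (tset_conjK tD) // br.
Qed.

Lemma moufang_tau : a ^ z c' c = a.
Proof.
have h : (c' ^ a) ^ z c' c = c' ^ a.
  apply: (fixM (moufang_fix_third cD c'D aD)).
  by rewrite conjJg fix_c' zl.
by rewrite -{1}(third c'D aD) conjJg h zl // third.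
Qed.

Lemma moufang_omega :
  [/\ o ^ z w a = o, a ^ z w a = a, b ^ z w a = b & c ^ z w a = c].
Proof.
have f1 : c' ^ z w a = c'.
  have := moufang_fix_third aD wD coD.
  rewrite {1 4}/w (tset_conjK tD) // => /fixM; apply.
  by rewrite zoppl // -zzC fix_c'.
have f2 : c ^ z w a = c.
  have e : (c ^ o) ^ z w a = c ^ o.
    by rewrite -{1}(third c'D coD) conjJg f1 -/w zl // third.
  by rewrite -{1}(tset_conjK tD c oD) conjJg e zo // (tset_conjK tD).
split=> //; rewrite ?zo ?zr //.
have f3 : (w ^ b) ^ z w a = w ^ b.
  apply: (fixM (moufang_fix_third aD wD bD)).
  by rewrite (zzC o a b) conjJg !fixV ?zr.
by rewrite -{1}(third wD bD) conjJg f3 zl // third.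
Qed.

End FourPoints.

Section FourGenerators.

Variables (K : {group gT}) (S : {set gT}).
Hypothesis KS : K :=: <<S>>.

Local Notation Q := 'O_3(K).

Let in_pcore x : x \in K -> x ^+ 3 = 1 ->
  {in S, forall g, x ^ g \in <<x |: Q>>} -> x \in Q.
Proof. exact: pcore_of_gens. Qed.

Let conj_o x : x \in D -> (o * x) ^ o = (o * x)^-1.
Proof. by move=> xD; rewrite conjgE -!mulgA mulKg invMg !(tset_inv tD). Qed.

Let conj_w x y : x \in D -> y \in D -> x * y = (o * x ^ (y ^ o)) ^ (o * y)^-1.
Proof.
move=> xD yD; have e := cub_swap tD oD yD (cubD oD yD).
have -> : x ^ (y ^ o) = (o * y * o) * x * (o * y * o).
  by rewrite -(tset_conjE tD _ oD) (tset_conjE tD) // J.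
rewrite conjgE invgK invMg !(tset_inv tD) // !mulgA !(tset_mulK tD) //.
rewrite (tset_mulgg tD) // mul1g -!mulgA; congr (_ * _).
by rewrite !mulgA e !(tset_mulK tD).
Qed.

Let conj_sigma x g : x \in D -> g \in D -> o \in K -> x \in K -> g \in K ->
  z x g \in Q -> (o * x) ^ g \in <<(o * x) |: Q>>.
Proof.
move=> xD gD oK xK gK zQ.
have xT : o * x \in <<(o * x) |: Q>> by rewrite mem_gen // !inE eqxx.
have zT : z x g \in <<(o * x) |: Q>> by rewrite mem_gen // inE zQ orbT.
have -> : (o * x) ^ g = (o * x * z x g)^-1; last by rewrite groupV groupM.
have -> : o * x * z x g = (o * x) ^ (o * g) by rewrite /zz commgEl mulKVg.
rewrite -{1}(tset_mulKV tD g oD) conjgM -conjVg; congr (_ ^ _).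
exact: conj_o.
Qed.

(** Here [o], [a], [b] centralise [z a b], while [c] conjugates it to [z a b * (c' * c)]; so it is
    enough to put [c' * c] in the core. That product is conjugate to [o * w] with
    [w = c' ^ (c ^ o)], and [w] is placed so that [z w a], [z w b] and [z c' c] are central in [K],
    while [z w c] is the inverse of the last. *)
Lemma moufang_comm_pcore a b c : {in S, forall g, g \in [:: o; a; b; c]} ->
  o \in K -> a \in K -> b \in K -> c \in K -> a \in D -> b \in D -> c \in D ->
  z a b \in Q.
Proof.
move=> SE oK aK bK cK aD bD cD.
have zK x y : x \in K -> y \in K -> z x y \in K.
  by move=> xK yK; apply: groupR; apply: groupM.
have central x y : x \in D -> y \in D -> x \in K -> y \in K ->
    o ^ z x y = o -> a ^ z x y = a -> b ^ z x y = b -> c ^ z x y = c -> z x y \in Q.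
  move=> xD yD xK yK eo ea eb ec; apply: in_pcore; rewrite ?zK ?z3 // => g /SE.
  have F u : u ^ z x y = u -> z x y ^ u \in <<z x y |: Q>>.
    move=> /conjg_fixP/commgP/commute_sym/commgP/conjg_fixP ->.
    by rewrite mem_gen // !inE eqxx.
  by rewrite !inE => /or4P[] /eqP ->; apply: F.
pose th := z a b; pose c' := c ^ th; pose w := c' ^ (c ^ o).
have thE : z b (a ^ o) = th by rewrite zoppr // -zzC.
have c'D : c' \in D by apply: zD.
have c'K : c' \in K by rewrite groupJ ?zK.
have wD : w \in D by exact: J c'D (J cD oD).
have wK : w \in K by exact: groupJ c'K (groupJ cK oK).
have aoD := J aD oD.
have Qwa : z w a \in Q.
  have [eo ea eb ec] := moufang_omega aD bD cD.
  exact: central.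
have Qwb : z w b \in Q.
  have := moufang_omega bD aoD cD; rewrite thE -/c' -/w => -[eo eb ea ec].
  apply: central => //.
  by rewrite -(tset_conjK tD a oD) conjJg ea eo.
have Qcc : z c' c \in Q.
  apply: central => //; rewrite ?zo ?zr //; first exact: (moufang_tau aD bD cD).
  by have := moufang_tau bD aoD cD; rewrite thE.
have Qwc : z w c \in Q.
  have coD := J cD oD.
  have -> : z w c = (z w (c ^ o))^-1 by rewrite zoppr ?invgK.
  have -> : z w (c ^ o) = (z (c ^ o) w)^-1 by rewrite -zzC.
  have -> : z (c ^ o) w = (z (c ^ o) c')^-1 by rewrite /w (br c'D coD) zline.
  by rewrite zoppl // zzC invgK !groupV Qcc.
have QK : K \subset 'N(Q) by apply: normal_norm; exact: pcore_normal.
have Qw : o * w \in Q.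
  apply: in_pcore; [exact: groupM | exact: cubD | move=> g /SE].
  rewrite !inE => /or4P[] /eqP ->; [|exact: conj_sigma..].
  by rewrite conj_o // groupV mem_gen // !inE eqxx.
have Qcc' : c' * c \in Q.
  have -> : c' * c = (o * w) ^ (o * c)^-1; last by rewrite memJ_norm // (subsetP QK) ?groupV ?groupM.
  exact: conj_w.
apply: in_pcore; rewrite ?zK ?z3 // => g /SE.
have F u : u ^ z a b = u -> z a b ^ u \in <<z a b |: Q>>.
  move=> /conjg_fixP/commgP/commute_sym/commgP/conjg_fixP ->.
  by rewrite mem_gen // !inE eqxx.
rewrite !inE => /or4P[] /eqP ->; try (by apply: F; rewrite ?zo ?zl ?zr).
have -> : z a b ^ c = z a b * (c' * c).
  rewrite (tset_conjE tD) // /c' /th conjgE.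
  by rewrite !mulgA mulgV mul1g.
by apply: groupM; rewrite mem_gen // !inE ?eqxx ?Qcc' ?orbT.
Qed.

(** A generator [g] conjugates [o * a] to the inverse of [o * a * z a g], and the holonomies [z a g]
    are already in the core: modulo the core every generator inverts [o * a]. *)
Lemma moufang_sigma_pcore a b c : {in S, forall g, g \in [:: o; a; b; c]} ->
  o \in K -> a \in K -> b \in K -> c \in K -> a \in D -> b \in D -> c \in D ->
  o * a \in Q.
Proof.
move=> SE oK aK bK cK aD bD cD.
have Qab := moufang_comm_pcore SE oK aK bK cK aD bD cD.
have Qac : z a c \in Q.
  apply: (@moufang_comm_pcore a c b) => // g /SE.
  by rewrite !inE => /or4P[] /eqP ->; rewrite eqxx ?orbT.
apply: in_pcore; [exact: groupM | exact: cubD | move=> g /SE].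
rewrite !inE => /or4P[] /eqP ->; [| |exact: conj_sigma..].
- by rewrite conj_o // groupV mem_gen // !inE eqxx.
- by apply: conj_sigma => //; rewrite /zz commgg group1.
Qed.

End FourGenerators.

End Moufang.

Lemma moufang_pcore (gT : finGroupType) (D : {set gT}) (G : {group gT}) d e :
  tset D -> {in D &, forall x y, (x * y) ^+ 3 = 1} -> D \subset G ->
  {in D & G, forall x g, x ^ g \in D} -> d \in D -> e \in D -> d * e \in 'O_3(G).
Proof.
move=> tD cD DG DJ dD eD; have DGs := subsetP DG.
apply: Baer_Suzuki => [|g gG]; first by rewrite groupM ?DGs.
have dgD := DJ _ _ dD gG; have egD := DJ _ _ eD gG.
(* The subgroup required to be a 3-group is generated by [d * e] and its conjugate by [g]. Both lie
   in the core of [K], the conjugate as [(d * d ^ g)^-1 * (d * e ^ g)]. *)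
pose S := [set d; e; d ^ g; e ^ g]; pose K := <<S>>%G.
have SE : {in S, forall x, x \in [:: d; e; d ^ g; e ^ g]}.
  by move=> x; rewrite !inE -!orbA.
have inK x : x \in S -> x \in K by exact: mem_gen.
have [dK eK] : d \in K /\ e \in K by split; apply: inK; rewrite !inE eqxx ?orbT.
have [dgK egK] : d ^ g \in K /\ e ^ g \in K by split; apply: inK; rewrite !inE eqxx ?orbT.
have KS : K :=: <<S>> by [].
have main a b c : {subset [:: d; e; d ^ g; e ^ g] <= [:: d; a; b; c]} ->
    a \in K -> b \in K -> c \in K -> a \in D -> b \in D -> c \in D -> d * a \in 'O_3(K).
  move=> sub aK bK cK aD bD cD'.
  apply: (moufang_sigma_pcore tD cD dD KS (b := b) (c := c)) => // x /SE.
  exact: sub.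
have h1 : d * e \in 'O_3(K) by apply: (main _ (d ^ g) (e ^ g)).
have h2 : d * d ^ g \in 'O_3(K).
  apply: (main _ e (e ^ g)) => // x; rewrite !inE.
  by case/or4P => /eqP ->; rewrite eqxx ?orbT.
have h3 : d * e ^ g \in 'O_3(K).
  apply: (main _ e (d ^ g)) => // x; rewrite !inE.
  by case/or4P => /eqP ->; rewrite eqxx ?orbT.
apply: (pgroupS _ (pcore_pgroup 3 K)); rewrite gen_subG.
apply/subsetP => x; rewrite !inE => /orP[] /eqP -> //.
have -> : (d * e) ^ g = (d * d ^ g)^-1 * (d * e ^ g).
  by rewrite invMg mulgA mulgKV conjMg (tset_inv tD dgD).
by rewrite groupM ?groupV.
Qed.

(** * Diagrams without large stars *)

Lemma pairwise_in2 (T : eqType) (r : rel T) (s : seq T) :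
  {in s &, symmetric r} -> pairwise r s -> {in s &, forall x y, x != y -> r x y}.
Proof.
move=> sr; elim: s sr => [|a s IH] //= sr /andP[/allP ra /IH{}IH] x y.
have as_ : a \in a :: s by rewrite inE eqxx.
rewrite !inE => /predU1P[->|xs] /predU1P[->|ys]; rewrite ?eqxx //.
- by move=> _; apply: ra.
- by move=> _; rewrite sr ?inE ?xs ?eqxx ?orbT //; apply: ra.
by apply: IH => // u v us vs; apply: sr; rewrite inE ?us ?vs orbT.
Qed.

Section Cliques.

Variables (gT : finGroupType) (D : {set gT}).
Hypothesis tD : tset D.
Implicit Types (d f g x y z a b : gT) (s : seq gT).

Definition clique s := pairwise (@adj gT) s.

Lemma clique_in s : clique s -> {in s &, forall x y, x != y -> adj x y}.
Proof. by apply: pairwise_in; exact: adjC. Qed.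

Lemma clique_uniq s : clique s -> uniq s.
Proof.
elim: s => //= x s IH /andP[/allP h /IH ->]; rewrite andbT.
by apply/negP => /h; rewrite adjxx.
Qed.

Lemma subseq_clique s s' : subseq s' s -> clique s -> clique s'.
Proof. exact: subseq_pairwise. Qed.

(* Three mutually adjacent points x, y, z generate a group of central type
   Sym(4) when x ^ y and z commute, and one of Moufang type when they do not.
   A star behaves like the transpositions moving a given point. *)
Definition star s := [/\ {subset s <= D}, clique s
  & forall x y z, x \in s -> y \in s -> z \in s ->
      x != y -> y != z -> x != z -> adj (x ^ y) z = false].

Definition aff x y z := [&& adj x y, adj y z, adj x z & adj (x ^ y) z].

Lemma affP x y z : reflect [/\ adj x y, adj y z, adj x z & adj (x ^ y) z] (aff x y z).
Proof. exact: and4P. Qed.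

Lemma aff12 x y z : x \in D -> y \in D -> aff x y z -> aff y x z.
Proof.
move=> xD yD /affP[h1 h2 h3 h4]; apply/affP; split=> //; first by rewrite adjC.
by rewrite -(tset_braid tD).
Qed.

Lemma aff23 x y z : x \in D -> y \in D -> z \in D -> aff x y z -> aff x z y.
Proof.
move=> xD yD zD /affP[h1 h2 h3 h4]; apply/affP; split=> //; first by rewrite adjC.
rewrite -(adjJ _ _ z) (tset_conjK tD) // (tset_braid tD) //.
by rewrite -(adjJ _ _ y) (tset_conjK tD).
Qed.

Lemma aff_plane x y z : x \in D -> y \in D -> z \in D -> aff x y z -> plane x y z.
Proof.
move=> xD yD zD /affP[h1 h2 h3 h4]; split; apply: (adj_cub tD) => //.
exact: tsetJ.
Qed.

(** If three points [x], [y], [z] of [s] were affine, then [u = y ^ z] and [u ^ x] would both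
    commute with [g], and hence so would [x], the third point of their line. *)
Lemma star_of_vertex g s : g \in D -> {subset s <= D} -> clique s ->
  {in s, forall x, adj g x} -> pairwise (fun x y => ~~ adj (x ^ y) g) s -> star s.
Proof.
move=> gD sD cs gs ps; have cin := clique_in cs.
have symp : {in s &, forall x y, x != y -> adj (x ^ y) g = false}.
  move=> x y xs ys xy; apply/negbTE; move: x y xs ys xy.
  apply: pairwise_in2 ps => x y xs ys; case: (eqVneq x y) => [-> //|xy].
  by rewrite (tset_braid tD) ?sD // cin.
split=> // x y z xs ys zs xy yz xz; case h: (adj (x ^ y) z) => //.
have [xD yD zD] : [/\ x \in D, y \in D & z \in D] by split; exact: sD.
have A : aff x y z by apply/affP; split=> //; apply: cin.
pose u := y ^ z; have uD : u \in D by exact: tsetJ.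
have ux : adj u x by have /affP[] := aff23 yD xD zD (aff12 xD yD A).
have yx : y != x by rewrite eq_sym.
have zx : z != x by rewrite eq_sym.
have e : adj g (u ^ x) = false.
  by rewrite /u conjJg adj_fixr adjC; [exact: symp | rewrite symp].
have : adj g x by exact: gs.
have -> : x = (u ^ x) ^ u by rewrite (tset_braid tD uD xD ux) (tset_conjK tD).
by rewrite adj_fixr ?e // adjC symp.
Qed.

(** * Cliques commuting with a vertex *)

Section NoCommutingClique.

Variables (f g a0 : gT).
Hypotheses (fD : f \in D) (gD : g \in D) (a0D : a0 \in D).
Hypotheses (fg : adj f g) (fa0 : adj f a0 = false) (ga0 : adj g a0).

(** For [a] commuting with [f] and affine with [g] and [a0], this vertex is adjacent to [f] and [g]
    and commutes with [a0]. A clique commuting with [f] and its shifts together carry the test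
    vectors. *)
Definition shift a := (f ^ (a ^ g)) ^ (a0 ^ g).

Section One.
Variable a : gT.
Hypotheses (aD : a \in D) (fa : adj f a = false) (A : aff g a0 a).

Let bD : a ^ g \in D. Proof. exact: tsetJ. Qed.
Let b0D : a0 ^ g \in D. Proof. exact: tsetJ. Qed.
Let ga : adj g a. Proof. by case/affP: A. Qed.
Let a0a : adj a0 a. Proof. by case/affP: A. Qed.

Lemma shiftD : shift a \in D.
Proof. by rewrite /shift !(tsetJ tD). Qed.

Lemma fb : adj f (a ^ g).
Proof. by rewrite -(tset_braid tD gD aD ga) adj_fixr ?fa. Qed.

Let fb0 : adj f (a0 ^ g).
Proof. by rewrite -(tset_braid tD gD a0D ga0) adj_fixr ?fa0. Qed.

Lemma shift_g : adj (shift a) g.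
Proof.
rewrite /shift -(adjJ _ _ (a0 ^ g)) (tset_conjK tD) //.
have -> : g ^ (a0 ^ g) = a0 by rewrite -(tset_braid tD gD a0D ga0) (tset_third tD).
rewrite -(adjJ _ _ (a ^ g)) (tset_conjK tD) //.
have a0b : adj a0 (a ^ g).
  rewrite -(adjJ _ _ g) (tset_conjK tD) // -(tset_braid tD gD a0D ga0).
  by case/affP: A.
by rewrite (tset_braid tD a0D bD a0b) adj_fixr ?fa0 // fb.
Qed.

Lemma shift_a0 : adj (shift a) a0 = false.
Proof.
rewrite /shift -(adjJ _ _ (a0 ^ g)) (tset_conjK tD) // -(adjJ _ _ (a ^ g)) (tset_conjK tD) //.
have -> : a0 ^ (a0 ^ g) = g by rewrite (tset_third tD) // adjC.
by rewrite -(tset_braid tD gD aD ga) (tset_third tD).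
Qed.

Lemma shift_f : adj (shift a) f.
Proof.
rewrite /shift -(adjJ _ _ (a0 ^ g)) (tset_conjK tD) //.
rewrite (tset_braid tD fD bD fb) (tset_braid tD fD b0D fb0) !adjJ adjC //.
Qed.

End One.

Lemma shift_b a b : a \in D -> b \in D -> adj f a = false -> aff g a0 a -> adj g b ->
  adj (shift a) b = false -> adj (shift a) (b ^ g).
Proof.
move=> aD bD fa A gb h.
by rewrite -(tset_braid tD gD bD gb) adj_fixr ?h // shift_g.
Qed.

Lemma shift_inj a b : a \in D -> b \in D -> adj f a = false -> adj f b = false ->
  aff g a0 a -> aff g a0 b -> shift a = shift b -> a = b.
Proof.
move=> aD bD fa fb' A B /conjg_inj.
by rewrite (tset_braid tD) ?fb ?tsetJ // (tset_braid tD fD) ?fb ?tsetJ // => /conjg_inj/conjg_inj.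
Qed.

End NoCommutingClique.

End Cliques.

Definition joined (gT : finGroupType) (D : {set gT}) :=
  {in D &, forall x y, x != y -> adj x y = false ->
     exists f, [/\ f \in D, adj f x & adj f y]}.

Definition starless (gT : finGroupType) (D : {set gT}) n :=
  forall s, star D s -> size s < n.

(** The list is cut into [K] and [L]. The cliques [L], [L ^ g] and the shifts of [K] form a path:
    consecutive ones are completely joined, and the two ends commute. *)
Lemma no_shift_path (gT : finGroupType) (D : {set gT}) t f g a0 (s : seq gT) :
  tset D -> psd D t -> 0 < t -> f \in D -> g \in D -> a0 \in D -> adj f g ->
  adj f a0 = false -> adj g a0 -> {subset s <= D} -> clique s ->
  {in s, forall x, adj f x = false} -> {in s, forall x, aff g a0 x} ->
  {in s &, forall x y, x != y -> aff g x y} ->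
  pairwise (fun x y => adj (shift f g a0 x) (shift f g a0 y)) s ->
  pairwise (fun x y => ~~ adj (shift f g a0 x) y) s ->
  size s = (6 * t)%N -> False.
Proof.
move=> tD pD t0 fD gD a0D fg fa0 ga0 sD cs fs As AAs p1 p2 sz.
pose K := take (3 * t)%N s; pose L := drop (3 * t)%N s; pose F := shift f g a0.
have sE : s = K ++ L by rewrite cat_take_drop.
have Ks : {subset K <= s} by move=> x /mem_take.
have Ls : {subset L <= s} by move=> x /mem_drop.
have FL : {in K & L, forall x y, adj (F x) y = false}.
  by move: p2; rewrite sE pairwise_cat => /andP[/allrelP h _] x y xK yL; apply/negbTE/h.
have gx x : x \in s -> adj g x by move/As/affP => [].
have Fg x : x \in s -> adj (F x) g by move=> xs; apply: (shift_g tD) => //; auto.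
have FD x : x \in s -> F x \in D by move=> xs; apply: (shiftD tD) => //; auto.
have usF : clique (map F K).
  by move: p1; rewrite sE pairwise_cat /clique pairwise_map => /and3P[_ h _].
have cL : clique L by apply: subseq_clique cs; apply: drop_subseq.
have LD x : x \in L -> x \in D by move/Ls/sD.
have gL x : x \in L -> adj g x by move/Ls/gx.
have LB : {in L & [seq y ^ g | y <- L], forall x y, adj x y}.
  move=> x _ xL /mapP[y yL ->]; case: (eqVneq x y) => [<-|xy].
    by rewrite adjC; apply: (adj_third tD) => //; [exact: LD | rewrite adjC gL].
  rewrite -(adjJ _ _ g) (tset_conjK tD) // -(tset_braid tD gD (LD _ xL) (gL _ xL)).
  by have /affP[] := AAs x y (Ls _ xL) (Ls _ yL) xy.
have BF : {in [seq y ^ g | y <- L] & map F K, forall x y, adj x y}.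
  move=> _ _ /mapP[y yL ->] /mapP[x xK ->]; rewrite adjC.
  by apply: (shift_b tD) => //; rewrite ?FL //; auto.
have LF : {in L & map F K, forall x y, adj x y = false}.
  by move=> y _ yL /mapP[x xK ->]; rewrite adjC FL.
have cB : clique [seq y ^ g | y <- L].
  rewrite /clique pairwise_map; apply: sub_pairwise cL => x y /=.
  by rewrite adjJ.
have szK : size K = (3 * t)%N by rewrite size_takel // sz leq_pmul2r.
have szL : size L = (3 * t)%N by rewrite size_drop sz -mulnBl.
apply: (@no_clique_path _ D t pD L [seq y ^ g | y <- L] (map F K)) => //;
  rewrite ?size_map ?szK ?szL //.
  move=> x; rewrite !mem_cat => /or3P[/Ls/sD //|/mapP[y /Ls/sD yD ->]|/mapP[y /Ks/FD yD ->] //].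
  exact: tsetJ.
rewrite !cat_uniq !clique_uniq // !andbT /=; apply/andP; split; apply/hasPn => x.
  rewrite mem_cat => /orP[xB|/mapP[y yK ->]]; apply/negP => xL.
    by have := LB _ _ xL xB; rewrite adjxx.
  have := fs _ (Ls _ xL); rewrite adjC (shift_f tD) //; auto.
by move=> xF; apply/negP => xB; have := BF _ _ xB xF; rewrite adjxx.
Qed.

(** With the list cut into [K] and [L], the elements of [L] and the shifts of [K] form one clique;
    [a0] is joined to the first half only and [f] to the second half only. *)
Lemma no_shift_claws (gT : finGroupType) (D : {set gT}) t f g a0 (s : seq gT) :
  tset D -> psd D t -> 0 < t -> f \in D -> g \in D -> a0 \in D -> adj f g ->
  adj f a0 = false -> adj g a0 -> {subset s <= D} -> clique s ->
  {in s, forall x, adj f x = false} -> {in s, forall x, aff g a0 x} ->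
  pairwise (fun x y => adj (shift f g a0 x) (shift f g a0 y)) s ->
  pairwise (fun x y => adj (shift f g a0 x) y) s ->
  size s = (t ^ 2 + t ^ 2)%N -> False.
Proof.
move=> tD pD t0 fD gD a0D fg fa0 ga0 sD cs fs As p1 p2 sz.
have nfa0 : f != a0.
  have /hasP[x xs _] : has predT s by rewrite has_predT sz addn_gt0 expn_gt0 t0.
  by apply/eqP => e; have := fs x xs; have /affP[] := As x xs; rewrite e => _ ->.
pose K := take (t ^ 2)%N s; pose L := drop (t ^ 2)%N s; pose F := shift f g a0.
have sE : s = K ++ L by rewrite cat_take_drop.
have Ks : {subset K <= s} by move=> x /mem_take.
have Ls : {subset L <= s} by move=> x /mem_drop.
have FL : {in K & L, forall x y, adj (F x) y}.
  by move: p2; rewrite sE pairwise_cat => /andP[/allrelP h _] x y xK yL; apply/h.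
have FD x : x \in s -> F x \in D by move=> xs; apply: (shiftD tD) => //; auto.
have usF : clique (map F K).
  by move: p1; rewrite sE pairwise_cat /clique pairwise_map => /and3P[_ h _].
have cL : clique L by apply: subseq_clique cs; apply: drop_subseq.
have szK : size K = (t ^ 2)%N by rewrite size_takel // sz leq_addr.
have szL : size L = (t ^ 2)%N by rewrite size_drop sz addKn.
have c12 : clique (L ++ map F K).
  rewrite /clique pairwise_cat -!/(clique _) usF cL !andbT; apply/allrelP => y _ yL /mapP[x xK ->].
  by rewrite adjC FL.
apply: (@no_two_claws _ D t pD a0 f L (map F K)) => //; rewrite ?size_map //.
- move=> x; rewrite !inE mem_cat => /or4P[/eqP -> //|/eqP -> //|/Ls/sD //|/mapP[y /Ks/FD yD ->] //].
- by rewrite eq_sym.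
- by rewrite adjC.
- exact: clique_uniq.
- by move=> x /Ls/As/affP[].
- by move=> x /Ls/fs.
- by move=> _ /mapP[x /Ks xs ->]; rewrite adjC (shift_f tD) //; auto.
- by move=> _ /mapP[x /Ks xs ->]; rewrite adjC (shift_a0 tD) //; auto.
Qed.

Lemma commuting_clique_bound t n0 : 0 < t -> exists n1, forall (gT : finGroupType) (D : {set gT}),
  tset D -> joined D -> psd D t -> starless D n0 ->
  forall f s, f \in D -> {subset s <= D} -> clique s ->
    {in s, forall x, adj f x = false} -> size s < n1.
Proof.
move=> t0.
have [M1 R1] := ramsey (t ^ 2 + t ^ 2)%N (6 * t)%N.
have [M2 R2] := ramsey M1 (t.+1 ^ 2)%N.
have [M3 R3] := ramsey M2.+1 n0.
(* Besides [a0] there remain at least [2 M3 + 1] elements. Either [M3] of them are adjacent to [g],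
   or [M3] are not; conjugation by [a0] makes the latter adjacent to [g], and they still commute
   with [f]. *)
exists (M3 + M3).+2 => gT D tD jD pD nst f s fD sD cs fs; rewrite ltnNge; apply/negP => sz.
case: s sD cs fs sz => [|a0 s] //= sD cs fs sz.
have a0D : a0 \in D by apply: sD; rewrite inE eqxx.
have fa0 : adj f a0 = false by apply: fs; rewrite inE eqxx.
have a0s x : x \in s -> adj a0 x by case/andP: cs => /allP h _ /h.
have nfa0 : f != a0.
  case: s sz {cs sD} a0s fs => [|a1 s] //= _ a0s fs.
  apply/eqP => e; have := fs a1; rewrite !inE eqxx orbT e a0s ?inE ?eqxx // => /(_ isT) //.
have [g [gD gf ga0]] := jD f a0 fD a0D nfa0 fa0.
have [s' [s'D cs' fs' gs' szs']] : exists s', [/\ {subset s' <= D}, clique s',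
    {in s', forall x, adj f x = false}, {in s', forall x, adj g x} & M3 <= size s'].
  have cnt := count_predC (adj g) s.
  case: (leqP M3 (count (adj g) s)) => h.
    exists (filter (adj g) s); split.
    - by move=> x; rewrite mem_filter => /andP[_ xs]; apply: sD; rewrite inE xs orbT.
    - by case/andP: cs => _; apply: subseq_clique; exact: filter_subseq.
    - by move=> x; rewrite mem_filter => /andP[_ xs]; apply: fs; rewrite inE xs orbT.
    - by move=> x; rewrite mem_filter => /andP[].
    - by rewrite size_filter.
  pose s1 := filter (predC (adj g)) s.
  have s1s x : x \in s1 -> x \in s by rewrite mem_filter => /andP[].
  have s1D x : x \in s1 -> x \in D by move=> /s1s xs; apply: sD; rewrite inE xs orbT.
  exists [seq x ^ a0 | x <- s1]; split.
  - by move=> _ /mapP[x /s1D xD ->]; apply: tsetJ.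
  - rewrite /clique pairwise_map; case/andP: cs => _.
    move/(subseq_clique (filter_subseq (predC (adj g)) s)).
    by apply: sub_pairwise => x y /=; rewrite adjJ.
  - move=> _ /mapP[x xs ->]; rewrite adj_fixr ?fa0 //.
    by apply: fs; rewrite inE s1s ?orbT.
  - move=> _ /mapP[x xs ->]; move: (xs); rewrite mem_filter => /andP[/= gx _].
    by rewrite -(tset_braid tD a0D (s1D _ xs)) ?a0s ?s1s // adj_fixr.
  - rewrite size_map size_filter; move: cnt sz h; set A := count _ _; set B := count _ _; lia.
(* The neighbours of [g] contain a star, which is excluded, or a clique whose pairs are all affine
   with [g]. *)
have [s1 ss1 [[z1 p1]|[z1 p1]]] := R3 _ (fun x y => adj (x ^ y) g) s' szs'; last first.
  have : star D s1.
    apply: (star_of_vertex tD gD _ _ _ p1).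
    - by move=> x /(mem_subseq ss1)/s'D.
    - exact: subseq_clique cs'.
    - by move=> x /(mem_subseq ss1)/gs'.
  by move/nst; rewrite z1 ltnn.
have cs1 : clique s1 by exact: subseq_clique cs'.
have s1D x : x \in s1 -> x \in D by move/(mem_subseq ss1)/s'D.
have s1f x : x \in s1 -> adj f x = false by move/(mem_subseq ss1)/fs'.
have s1g x : x \in s1 -> adj g x by move/(mem_subseq ss1)/gs'.
have AA : {in s1 &, forall x y, x != y -> aff g x y}.
  have h : {in s1 &, forall x y, x != y -> adj (x ^ y) g}.
    apply: pairwise_in2 p1 => x y xs ys; case: (eqVneq x y) => [-> //|xy].
    by rewrite (tset_braid tD) ?s1D // (clique_in cs1).
  move=> x y xs ys xy; apply: (aff12 tD) => //; rewrite ?s1D //.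
  apply: (aff23 tD) => //; rewrite ?s1D //.
  apply/affP; split; [exact: (clique_in cs1) | | | exact: h].
  - by rewrite adjC s1g.
  - by rewrite adjC s1g.
case: s1 {p1} ss1 z1 cs1 s1D s1f s1g AA => [|b0 r] //= ss1 [zr] cr rD rf rg AA.
have b0D : b0 \in D by apply: rD; rewrite inE eqxx.
have b0f : adj f b0 = false by apply: rf; rewrite inE eqxx.
have b0g : adj g b0 by apply: rg; rewrite inE eqxx.
have fg : adj f g by rewrite adjC.
case/andP: cr => b0r cr.
have nb0 : b0 \notin r by apply/negP => /(allP b0r); rewrite adjxx.
have Ar : {in r, forall x, aff g b0 x}.
  move=> x xr; apply: AA; rewrite ?inE ?eqxx ?xr ?orbT //.
  by apply: contraNneq nb0 => ->.
have {}AA : {in r &, forall x y, x != y -> aff g x y}.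
  by move=> x y xr yr; apply: AA; rewrite inE ?xr ?yr orbT.
have {}rD x : x \in r -> x \in D by move=> xr; apply: rD; rewrite inE xr orbT.
have {}rf x : x \in r -> adj f x = false by move=> xr; apply: rf; rewrite inE xr orbT.
pose F := shift f g b0.
(* Pairwise commuting shifts would be a claw at [g], so a large part of the shifts is a clique; the
   adjacencies between shifts and unshifted vertices are made uniform next. *)
have [r2 sr2 [[z2 p2]|[z2 p2]]] := R2 _ (fun x y => adj (F x) (F y)) r (eq_leq (esym zr)); last first.
  have r2r := mem_subseq sr2.
  apply: (@no_claw _ D t pD g (map F r2)) => //.
  - move=> _ /mapP[x /r2r xr ->]; apply: (shiftD tD) => //; auto.
  - rewrite map_inj_in_uniq; first by apply: subseq_uniq sr2 _; apply: clique_uniq.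
    move=> x y /r2r xr /r2r yr; apply: (shift_inj tD) => //; auto.
  - by move=> _ /mapP[x /r2r xr ->]; rewrite adjC; apply: (shift_g tD) => //; auto.
  - move=> _ _ /mapP[x xr ->] /mapP[y yr ->]; case: (eqVneq x y) => [->|xy]; first exact: adjxx.
    by apply/negbTE; apply: (pairwise_in2 _ p2) => // u v _ _; rewrite adjC.
  - by rewrite size_map z2.
have [r3 sr3 [[z3 p3]|[z3 p3]]] := R1 _ (fun x y => adj (F x) y) r2 (eq_leq (esym z2)).
- have r3r : {subset r3 <= r} by move=> x /(mem_subseq sr3)/(mem_subseq sr2).
  apply: (@no_shift_claws _ D t f g b0 r3) => //.
  + by move=> x /r3r/rD.
  + exact: subseq_clique (subseq_trans sr3 sr2) cr.
  + by move=> x /r3r/rf.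
  + by move=> x /r3r/Ar.
  + exact: subseq_pairwise sr3 p2.
- have r3r : {subset r3 <= r} by move=> x /(mem_subseq sr3)/(mem_subseq sr2).
  apply: (@no_shift_path _ D t f g b0 r3) => //.
  + by move=> x /r3r/rD.
  + exact: subseq_clique (subseq_trans sr3 sr2) cr.
  + by move=> x /r3r/rf.
  + by move=> x /r3r/Ar.
  + by move=> x y /r3r xr /r3r; apply: AA.
  + exact: subseq_pairwise sr3 p2.
Qed.

Section CommutingPoints.

Variables (gT : finGroupType) (D : {set gT}).
Hypothesis tD : tset D.
Implicit Types (d e f g h u v w x y : gT) (s : seq gT).

Definition commpts d := [set f in D | (f != d) && ~~ adj d f].
Definition nbrs d := [set x in D | adj d x].

(** Were [f] fixed, [zzE] would make [x ^ y] send [f ^ (d ^ x)] to [f ^ (d ^ y)], whence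
    [y ^ (d ^ x) = y ^ (f ^ x)]. A line through [y] is determined by its third point, so
    [d ^ x = f ^ x] and [d = f]. *)
Lemma no_fixed_commuting d x y f : d \in D -> x \in D -> y \in D -> f \in D ->
  aff d x y -> f != d -> adj f d = false -> adj f x -> adj f y ->
  adj f ((y ^ d) ^ x) -> f ^ zz d x y != f.
Proof.
move=> dD xD yD fD /affP[dx xy dy dxy] nfd fd fx fy fydx; apply/eqP => e.
have dxD : d ^ x \in D by exact: tsetJ.
have dyD : d ^ y \in D by exact: tsetJ.
pose X := f ^ (d ^ x); pose Y := f ^ (d ^ y).
have XD : X \in D by exact: tsetJ.
have fd' : f ^ d = f by apply: nadjJ; rewrite fd.
have XY : X ^ (x ^ y) = Y.
  apply: (@conjg_inj _ (d ^ y)); rewrite (tset_conjK tD) // -[RHS]e.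
  by rewrite (zzE tD) ?(adj_cub tD) // (conjgM f d) fd' (conjgM f _ (d ^ y)) (conjgM f (d ^ x)).
have third u : u \in D -> adj d u -> adj f u -> u ^ (d * f) = f ^ (d ^ u).
  move=> uD du fu; have duD : d ^ u \in D by exact: tsetJ.
  rewrite conjgM -(tset_braid tD dD uD du) (tset_braid tD duD fD) //.
  by rewrite adjC (tset_braid tD dD uD du) adj_fixr ?fd.
have xT := third x xD dx fx; have yT := third y yD dy fy.
have yxX : (y ^ x) ^ X = y ^ (d * f).
  rewrite (tset_braid tD _ XD) ?tsetJ //; first by rewrite -(tset_braid tD xD yD xy) XY yT.
  by rewrite adjC /X -(adjJ _ _ (d ^ x)) (tset_conjK tD) // -conjJg.
have yfix : y ^ (d ^ x * f ^ x) = y.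
  have : y ^ (x * (d * f)^-1 * x) = y.
    apply: (@conjg_inj _ (d * f)); rewrite -yxX /X -xT -conjgM [x ^ _]conjgE -conjgM.
    by rewrite !mulgA.
  have -> : x * (d * f)^-1 * x = ((d * f) ^ x)^-1.
    by rewrite -conjVg (tset_conjE tD).
  rewrite -conjMg => h; apply: (@conjg_inj _ ((d * f) ^ x)^-1).
  by rewrite conjgK h.
have e2 : y ^ (d ^ x) = y ^ (f ^ x).
  apply: (@conjg_inj _ (f ^ x)).
  by rewrite -(conjgM y) yfix (tset_conjK tD y) ?tsetJ.
have ydx : adj y (d ^ x) by rewrite adjC.
have yfx : adj y (f ^ x) by rewrite /adj -e2.
move: e2; rewrite !(tset_braid tD yD) ?tsetJ // => /conjg_inj/conjg_inj e2.
by rewrite e2 eqxx in nfd.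
Qed.

(** Each vertex of [fs] commutes with fewer than [n] elements of the clique; these are deleted for
    one vertex after the other. *)
Lemma clique_avoid n (fs A : seq gT) :
  (forall f s, f \in D -> {subset s <= D} -> clique s ->
    {in s, forall x, adj f x = false} -> size s < n) ->
  {subset fs <= D} -> {subset A <= D} -> clique A -> (size fs * n < size A)%N ->
  exists2 a, a \in A & {in fs, forall f, adj f a}.
Proof.
move=> H; elim: fs A => [|f fs IH] A fsD AD cA sz.
  by case: A {AD cA} sz => // a A _; exists a; rewrite ?inE ?eqxx.
have fD : f \in D by apply: fsD; rewrite inE eqxx.
have h0 := H f (filter (predC (adj f)) A) fD.
have {h0} h : size (filter (predC (adj f)) A) < n.
  apply: h0.
  - by move=> x; rewrite mem_filter => /andP[_ /AD].
  - exact: subseq_pairwise (filter_subseq _ _) cA.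
  - by move=> x; rewrite mem_filter => /andP[/= /negbTE].
case: (IH (filter (adj f) A)).
- by move=> x xs; apply: fsD; rewrite inE xs orbT.
- by move=> x; rewrite mem_filter => /andP[_ /AD].
- exact: subseq_pairwise (filter_subseq _ _) cA.
- move: (count_predC (adj f) A) h sz; rewrite !size_filter /= mulSn.
  by set a := count _ _; set b := count _ _; lia.
move=> a; rewrite mem_filter => /andP[fa aA] afs; exists a => // x.
by rewrite inE => /predU1P[->|/afs].
Qed.

End CommutingPoints.

(** Many commuting points contain a large coclique, since their cliques are bounded; many neighbours
    contain a large clique, since no large claw has centre [d]. A member of the clique adjacent to
    the whole coclique would be the centre of a claw. *)
Lemma commuting_points_bound t n0 : 0 < t -> exists k L,
  forall (gT : finGroupType) (D : {set gT}),
  tset D -> joined D -> psd D t -> starless D n0 ->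
  {in D, forall d, k <= #|nbrs D d| -> #|commpts D d| <= L}.
Proof.
move=> t0; have [n1 C] := commuting_clique_bound n0 t0.
have [M RM] := ramsey n1 (t.+1 ^ 2)%N.
have [k Rk] := ramsey (t.+1 ^ 2 * n1).+1 (t.+1 ^ 2)%N.
exists k, M => gT D tD jD pD nst d dD hk; rewrite leqNgt; apply/negP => hM.
have {}C := C gT D tD jD pD nst.
have sz1 : M <= size (enum (commpts D d)) by rewrite -cardE ltnW.
have sz2 : k <= size (enum (nbrs D d)) by rewrite -cardE.
have [fs sfs [[zf pf]|[zf pf]]] := RM _ (@adj gT) _ sz1.
  have := C d fs dD; rewrite zf ltnn => h; apply: notF; apply: h => //.
    by move=> x /(mem_subseq sfs); rewrite mem_enum inE => /and3P[].
  by move=> x /(mem_subseq sfs); rewrite mem_enum inE => /and3P[_ _ /negbTE].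
have [A sA [[zA pA]|[zA pA]]] := Rk _ (@adj gT) _ sz2; last first.
  apply: (@no_claw _ D t pD d A) => //.
  - by move=> x /(mem_subseq sA); rewrite mem_enum inE => /andP[].
  - by apply: subseq_uniq sA (enum_uniq _).
  - by move=> x /(mem_subseq sA); rewrite mem_enum inE => /andP[].
  - move=> x y xA yA; case: (eqVneq x y) => [->|xy]; first exact: adjxx.
    by apply/negbTE; apply: (pairwise_in _ pA) => // u v; rewrite /= adjC.
  - by rewrite zA.
have fsD : {subset fs <= D}.
  by move=> x /(mem_subseq sfs); rewrite mem_enum inE => /andP[].
have AD : {subset A <= D}.
  by move=> x /(mem_subseq sA); rewrite mem_enum inE => /andP[].
have [|a aA afs] := clique_avoid C fsD AD pA; first by rewrite zf zA.
apply: (@no_claw _ D t pD a fs) => //.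
- exact: AD.
- by apply: subseq_uniq sfs (enum_uniq _).
- by move=> x /afs; rewrite adjC.
- move=> x y xA yA; case: (eqVneq x y) => [->|xy]; first exact: adjxx.
  by apply/negbTE; apply: (pairwise_in _ pf) => // u v; rewrite /= adjC.
- by rewrite zf.
Qed.

(** * Colouring pairs of vertices by holonomy *)

Section BoundedCommuting.

Variables (gT : finGroupType) (D : {set gT}) (L : nat).
Hypothesis tD : tset D.
Hypothesis cL : {in D, forall d, #|commpts D d| <= L}.
Variables d f : gT.
Hypotheses (dD : d \in D) (fcd : f \in commpts D d).
Implicit Types (e h u v w x y : gT) (s : seq gT).

Let fD : f \in D. Proof. by move: fcd; rewrite inE => /andP[]. Qed.
Let fd : adj f d = false.
Proof. by move: fcd; rewrite inE adjC => /and3P[_ _ /negbTE]. Qed.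
Let nfd : f != d. Proof. by move: fcd; rewrite inE => /and3P[]. Qed.

(* Each pair (e, h) forbids the points u with u ^ h commuting with e. *)
Definition forbid s : seq (gT * gT) :=
  [:: (d, 1); (f, 1)] ++ flatten [seq [:: (v, 1); (v, d); (f, v)] | v <- s]
  ++ [seq (d ^ (w ^ v), v) | v <- s, w <- s]
  ++ [seq (f, v * d * (w ^ v)) | v <- s, w <- s].

(** The conditions make the triples and the trapezoid of [no_monochromatic] affine and supply the
    adjacencies asked by [no_fixed_commuting]. Each of them excludes at most [L + 1] vertices, so a
    large [D] has long generic sequences. *)
Fixpoint generic s := if s is u :: s' then
  [&& generic s', u \in D & all (fun c => adj c.1 (u ^ c.2)) (forbid s')] else true.

Lemma genericE u s : generic (u :: s) =
  [&& generic s, u \in D & all (fun c => adj c.1 (u ^ c.2)) (forbid s)].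
Proof. by []. Qed.

Lemma size_forbid s : size (forbid s) = (2 + 3 * size s + 2 * (size s * size s))%N.
Proof.
rewrite /forbid !size_cat !size_allpairs size_flatten /shape -map_comp.
have -> : sumn [seq (size \o (fun v => [:: (v, 1); (v, d); (f, v)])) i | i <- s] = (3 * size s)%N.
  by elim: s => //= v s ->; lia.
by rewrite /=; lia.
Qed.

Lemma card_forbid e h : e \in D -> {in D, forall u, u ^ h \in D} ->
  #|[set u in D | ~~ adj e (u ^ h)]| <= L.+1.
Proof.
move=> eD hD; rewrite -(card_imset _ (@conjg_inj _ h)).
apply: leq_trans (_ : #|e |: commpts D e| <= _).
  apply/subset_leq_card/subsetP => x /imsetP[u]; rewrite inE => /andP[uD eu] ->.
  by rewrite !inE hD // eu andbT orbN.
by rewrite cardsU1 -add1n leq_add ?leq_b1 ?cL.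
Qed.

Lemma generic_sub s : generic s -> {subset s <= D}.
Proof.
elim: s => //= u s IH /and3P[gs uD _] x; rewrite inE => /predU1P[->//|].
exact: IH.
Qed.

Lemma forbid_ok s c : {subset s <= D} -> c \in forbid s ->
  c.1 \in D /\ {in D, forall u, u ^ c.2 \in D}.
Proof.
move=> sD; have J := tsetJ tD.
rewrite !mem_cat => /or4P[h|h|/allpairsP h|/allpairsP h].
- by move: h; rewrite !inE => /orP[] /eqP ->; split=> //= u; rewrite conjg1.
- case/flattenP: h => t /mapP[v /sD vD ->].
  by rewrite !inE => /or3P[] /eqP ->; split=> //= u uD; rewrite ?conjg1 ?J.
- by case: h => -[v w] /= [/sD vD /sD wD ->]; split=> [|u uD]; rewrite !J.
- case: h => -[v w] /= [/sD vD /sD wD ->]; split=> // u uD.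
  by rewrite (conjgM u (v * d)) (conjgM u v) !J.
Qed.

Lemma card_forbid_seq (l : seq (gT * gT)) :
  (forall c, c \in l -> c.1 \in D /\ {in D, forall u, u ^ c.2 \in D}) ->
  (#|[set u in D | has (fun c => ~~ adj c.1 (u ^ c.2)) l]| <= L.+1 * size l)%N.
Proof.
elim: l => [|c l IH] ok.
  by rewrite muln0 leqn0 cards_eq0; apply/eqP/setP => u; rewrite !inE andbF.
have [c1 c2] := ok c (mem_head _ _).
have {}IH := IH (fun b bl => ok b (@mem_behead _ (c :: l) b bl)).
rewrite /= mulnS; apply: leq_trans (leq_add (card_forbid c1 c2) IH).
apply: leq_trans (leq_card_setU _ _); apply/subset_leq_card/subsetP => u.
by rewrite !inE andb_orr.
Qed.

Lemma generic_exists n : (L.+1 * (2 + 3 * n + 2 * (n * n)) < #|D|)%N ->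
  exists2 s, generic s & size s = n.
Proof.
elim: n => [|n IH] hn; first by exists [::].
have hn' : (L.+1 * (2 + 3 * n + 2 * (n * n)) < #|D|)%N.
  by apply: leq_ltn_trans hn; rewrite leq_mul2l; apply/orP; right; nia.
have [s gs sz] := IH hn'.
have okl c := @forbid_ok s c (generic_sub gs).
have := card_forbid_seq okl; rewrite size_forbid sz => hc.
have : ~~ (D \subset [set u in D | has (fun c => ~~ adj c.1 (u ^ c.2)) (forbid s)]).
  by apply/negP => /subset_leq_card h; have := leq_ltn_trans (leq_trans h hc) hn'; rewrite ltnn.
case/subsetPn => u uD; rewrite in_set uD => /hasPn h.
exists (u :: s); last by rewrite /= sz.
by rewrite genericE gs uD; apply/allP => c /h; rewrite negbK.
Qed.

Lemma generic_triple s u v w : generic s -> subseq [:: u; v; w] s ->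
  exists s', [/\ generic (u :: s'), v \in s', w \in s' & exists s'',
    [/\ generic (v :: s''), w \in s'' & subseq (v :: s'') s']].
Proof.
have sub1 r : generic r -> subseq [:: v; w] r ->
    exists s'', [/\ generic (v :: s''), w \in s'' & subseq (v :: s'') r].
  elim: r => // y r IH g; rewrite [subseq _ _]/=; case: eqP => [e|_] sub.
    exists r; rewrite e; split=> //; first by apply: (mem_subseq sub); rewrite inE eqxx.
  have [|s'' [h1 h2 h3]] := IH _ sub; first by case/and3P: g.
  by exists s''; split=> //; apply: subseq_trans h3 (subseq_cons _ _).
elim: s => // x s IH g; rewrite [subseq _ _]/=; case: eqP => [e|_] sub; last first.
  by apply: IH sub; case/and3P: g.
exists s; rewrite e; split=> //.
- by apply: (mem_subseq sub); rewrite inE eqxx.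
- by apply: (mem_subseq sub); rewrite !inE eqxx orbT.
by apply: sub1 sub; case/and3P: g.
Qed.

Lemma generic_head u s : generic (u :: s) ->
  [/\ u \in D, adj d u, adj f u, {in s, forall v, [/\ adj v u, adj (d ^ u) v & adj f (u ^ v)]}
    & {in s &, forall v w, adj (d ^ (w ^ v)) (u ^ v) /\ adj f (u ^ (v * d * (w ^ v)))}].
Proof.
case/and3P=> gs uD /allP h.
have du : adj d u by have := h (d, 1); rewrite conjg1 !inE eqxx => /(_ isT).
split=> //.
- by have := h (f, 1); rewrite conjg1 !inE eqxx orbT => /(_ isT).
- move=> v vs.
  have hv c : c \in [:: (v, 1); (v, d); (f, v)] -> adj c.1 (u ^ c.2).
    move=> cv; apply: h; rewrite !mem_cat; apply/or4P/Or42.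
    by apply/flattenP; exists [:: (v, 1); (v, d); (f, v)] => //; apply: map_f.
  split.
  + by have := hv (v, 1); rewrite conjg1 inE eqxx => /(_ isT).
  + have := hv (v, d); rewrite !inE eqxx orbT => /(_ isT) /=.
    by rewrite (tset_braid tD dD uD du) adjC.
  + by have := hv (f, v); rewrite !inE eqxx !orbT => /(_ isT).
move=> v w vs ws; split.
  have := h (d ^ (w ^ v), v); apply; rewrite !mem_cat; apply/or4P/Or43.
  by apply/allpairsP; exists (v, w).
have := h (f, v * d * (w ^ v)); apply; rewrite !mem_cat; apply/or4P/Or44.
by apply/allpairsP; exists (v, w).
Qed.


Lemma generic_mem s x : generic s -> x \in s -> adj d x /\ adj f x.
Proof.
elim: s => //= u s IH g; rewrite inE => /predU1P[->|xs]; last by case/and3P: g => gs _ _; exact: IH.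
by have [_ du fu _ _] := generic_head g.
Qed.

Section Colour.

Let Dd := commpts D d.
Let l := #|Dd|.

(** The action of the holonomy on the points commuting with [d], read through an enumeration of
    them: the number of colours then depends on [l] only. *)
Definition colour x y : {ffun 'I_l -> 'I_l} :=
  [ffun i => enum_rank_in fcd (enum_val i ^ zz d x y)].

Let zzDd x y h : x \in D -> y \in D -> aff d x y -> h \in Dd -> h ^ zz d x y \in Dd.
Proof.
move=> xD yD A; have P := aff_plane tD dD xD yD A.
have [ez _ _] := zz_fix tD dD xD yD P.
rewrite !inE => /and3P[hD hd dh].
have J := tsetJ tD.
have hzD : h ^ zz d x y \in D.
  case/affP: A => dx _ _ _; rewrite (zzE tD) ?(adj_cub tD) // (conjgM h d).
  by rewrite (conjgM (h ^ d)) (conjgM (h ^ d)) !J.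
apply/and3P; split=> //.
  by apply: contra_neq hd => e; apply: (@conjg_inj _ (zz d x y)); rewrite e ez.
by rewrite -[adj d h](adjJ d h (zz d x y)) ez in dh.
Qed.

Lemma colour_eq x y x' y' h : x \in D -> y \in D -> x' \in D -> y' \in D ->
  aff d x y -> aff d x' y' -> colour x y = colour x' y' -> h \in Dd ->
  h ^ zz d x y = h ^ zz d x' y'.
Proof.
move=> xD yD xD' yD' A A' /ffunP e hd.
have := e (enum_rank_in fcd h); rewrite !ffunE enum_rankK_in //.
move/(congr1 enum_val); rewrite !enum_rankK_in //; exact: zzDd.
Qed.

(** By [zz_trapezoid] the holonomy of [w ^ v] and [u ^ v] is the product of three factors, each
    acting on the commuting points as the inverse of [zz d u v]. As the cube of the latter is 1, the
    product fixes [f], against [no_fixed_commuting]. *)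
Lemma no_monochromatic s u v w : generic s -> subseq [:: u; v; w] s ->
  colour v w = colour u v -> colour u w = colour u v -> False.
Proof.
move=> gs sub c1 c2.
have [s1 [g1 vs1 ws1 [s2 [g2 ws2 sub2]]]] := generic_triple gs sub.
have [uD du fu hu hu2] := generic_head g1.
have [vD dv fv hv _] := generic_head g2.
have wD : w \in D by apply: (generic_sub gs); apply: (mem_subseq sub); rewrite !inE eqxx !orbT.
have [vu duv fuv] := hu v vs1; have [wu duw fuw] := hu w ws1.
have [wv dvw fvw] := hv w ws2.
have [dw fw] := generic_mem gs (mem_subseq sub (mem_last u [:: v; w])).
have Auv : aff d u v by apply/affP; rewrite adjC in vu.
have Auw : aff d u w by apply/affP; rewrite adjC in wu.
have Avw : aff d v w by apply/affP; rewrite adjC in wv.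
have Awv := aff23 tD dD vD wD Avw.
have {}Awv : aff d w v by [].
have uvD : u ^ v \in D by exact: tsetJ.
have wvD : w ^ v \in D by exact: tsetJ.
have [h1 h2] := hu2 v w vs1 ws1.
have A : aff d (w ^ v) (u ^ v).
  have dJ x : adj d (x ^ v) = adj (d ^ v) x.
    by rewrite -(adjJ _ _ v) (tset_conjK tD).
  apply/affP; split=> //.
  - by rewrite dJ.
  - by rewrite adjJ.
  - by rewrite dJ (tset_braid tD dD vD dv) -(adjJ _ _ d) (tset_conjK tD) // -(tset_braid tD dD uD du) adjC.
suff e : f ^ zz d (w ^ v) (u ^ v) = f.
  have fwv : adj f (w ^ v) by rewrite -(tset_braid tD vD wD) // adjC.
  rewrite (conjgM u (v * d)) (conjgM u v) in h2.
  by have := no_fixed_commuting tD dD wvD uvD fD A nfd fd fwv fuv h2; rewrite e eqxx.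
have P x y : x \in D -> y \in D -> aff d x y -> plane d x y by exact: aff_plane.
rewrite (zz_trapezoid tD dD uD wD vD); [|exact: P..].
have DdV x y h : x \in D -> y \in D -> aff d x y -> h \in Dd -> h ^ (zz d x y)^-1 \in Dd.
  move=> xD yD B hd; have z3 := zz3 tD dD xD yD (P _ _ xD yD B).
  have -> : (zz d x y)^-1 = zz d x y * zz d x y.
    by apply: mulg1_eq; rewrite -z3 !expgS expg0 mulg1.
  by rewrite conjgM; exact: (zzDd xD yD B (zzDd xD yD B hd)).
have inv x y h : x \in D -> y \in D -> aff d x y -> colour x y = colour u v -> h \in Dd ->
    h ^ (zz d x y)^-1 = h ^ (zz d u v)^-1.
  move=> xD yD B c hd; have hi := DdV _ _ _ xD yD B hd.
  apply: (@conjg_inj _ (zz d u v)); rewrite conjgKV.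
  by rewrite -(colour_eq xD yD uD vD B Auv c hi) conjgKV.
rewrite (zzC d v w) conjgM conjgM (inv v w) // (inv u w) //; last exact: DdV.
have z3 := zz3 tD dD uD vD (P _ _ uD vD Auv).
rewrite -2!conjgM -[RHS]conjg1 -(invg1 gT) -z3 !expgS expg0 mulg1 !invMg mulgA.
by [].
Qed.

End Colour.

End BoundedCommuting.

Lemma bounded_commuting L : exists N, forall (gT : finGroupType) (D : {set gT}),
  tset D -> {in D, forall d, #|commpts D d| <= L} ->
  forall d f, d \in D -> f \in commpts D d -> #|D| <= N.
Proof.
have [n RT] := ramsey_triangle (L ^ L)%N.
exists (L.+1 * (2 + 3 * n + 2 * (n * n)))%N => gT D tD cL d f dD fcd.
rewrite leqNgt; apply/negP => /(generic_exists tD cL dD fcd)[s gs sz].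
have lL : #|commpts D d| <= L by exact: cL.
have l0 : 0 < #|commpts D d| by apply/card_gt0P; exists f.
have szk : (size (enum {ffun 'I_#|commpts D d| -> 'I_#|commpts D d|}) <= L ^ L)%N.
  rewrite -cardE card_ffun card_ord; apply: (@leq_trans (L ^ #|commpts D d|)%N).
    by rewrite leq_exp2r.
  by rewrite leq_pexp2l // (leq_trans l0).
have [||u [v [w [sub c1 c2]]]] := RT _ _ (colour fcd) (enum {ffun 'I_#|commpts D d| -> 'I_#|commpts D d|}) s szk.
- by rewrite sz.
- by apply/(pairwiseP d) => i j _ _ _; rewrite mem_enum.
exact: (no_monochromatic tD dD gs sub c1 c2).
Qed.

Lemma card_bigcup_le (T I : finType) (A : {pred I}) (F : I -> {set T}) :
  (#|\bigcup_(i in A) F i| <= \sum_(i in A) #|F i|)%N.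
Proof.
elim/big_rec2: _ => [|i n B _ h]; first by rewrite cards0.
by apply: leq_trans (leq_card_setU _ _) _; rewrite leq_add2l.
Qed.

Lemma starless_bound t n0 : 0 < t -> exists N, forall (gT : finGroupType) (D : {set gT}),
  tset D -> joined D -> psd D t -> starless D n0 ->
  {in D &, forall x y, #|nbrs D x| = #|nbrs D y|} ->
  forall d f, d \in D -> f \in commpts D d -> #|D| <= N.
Proof.
move=> t0; have [k [L CB]] := commuting_points_bound n0 t0.
have [M BC] := bounded_commuting L.
(* Degree at least [k] bounds the commuting points everywhere, by regularity. Degree below [k] gives
   [1 + k + k * k], since any two vertices are at distance at most 2. *)
exists (maxn M (1 + k + k * k)) => gT D tD jD pD nst reg d f dD fcd.
have {}CB := CB gT D tD jD pD nst.
case: (leqP k #|nbrs D d|) => hk.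
  apply: leq_trans (leq_maxl _ _); apply: (BC gT D tD _ d f dD fcd) => x xD.
  by apply: CB => //; rewrite (reg x d).
apply: leq_trans (leq_maxr _ _).
have sub : D \subset d |: nbrs D d :|: \bigcup_(x in nbrs D d) nbrs D x.
  apply/subsetP => y yD; rewrite !inE yD; case: (eqVneq y d) => //= nyd.
  case h: (adj d y) => //=.
  have [|g [gD gd gy]] := jD d y dD yD _ h; first by rewrite eq_sym.
  apply/bigcupP; exists g; rewrite !inE ?gD ?yD //= adjC //.
apply: leq_trans (subset_leq_card sub) _.
apply: leq_trans (leq_card_setU _ _) _; apply: leq_add.
  by rewrite cardsU1; apply: leq_add; [exact: leq_b1 | exact: ltnW].
apply: leq_trans (card_bigcup_le _ _) _.
apply: (@leq_trans (\sum_(x in nbrs D d) k)%N).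
  by apply: leq_sum => x; rewrite inE => /andP[xD _]; rewrite (reg x d) // ltnW.
by rewrite sum_nat_const leq_mul2r ltnW ?orbT.
Qed.

(** * Large stars and coordinates *)

Section FreshReplacement.

Variables (T : finType) (V : {set T}) (P : seq T -> bool).

Hypothesis fresh_step : forall p x y q, uniq (p ++ x :: q) -> y \notin p ++ x :: q ->
  {subset p ++ x :: q <= V} -> y \in V -> P (p ++ x :: q) = P (p ++ y :: q).

Lemma fresh_disjoint p s q : size s = size q -> uniq (p ++ s) -> uniq (p ++ q) ->
  ~~ has (mem s) q -> {subset p ++ s <= V} -> {subset q <= V} -> P (p ++ s) = P (p ++ q).
Proof.
elim: s p q => [|x s IH] p [|y q] //= [sz] ups upq dis sV qV.
have ynew : y \notin p ++ x :: s.
  rewrite mem_cat; apply/norP; split.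
    by move: upq; rewrite cat_uniq => /and3P[_ /norP[]].
  by move: dis => /norP[].
rewrite (fresh_step ups ynew sV) ?qV ?inE ?eqxx // -!cat_rcons; apply: IH => //.
- rewrite -cats1 -catA /= cat_uniq /=.
  move: ups ynew; rewrite cat_uniq mem_cat inE !negb_or /=.
  move=> /and3P[-> /andP[_ hs] /andP[_ ->]] /and3P[yp _ ys].
  by rewrite (negPf yp) ys hs.
- by rewrite cat_rcons.
- case/norP: dis => _ /hasPn dq; apply/hasPn => z /dq.
  by rewrite /= inE => /norP[].
- move=> z; rewrite cat_rcons mem_cat inE => /or3P[zp|/eqP->|zs].
  + by apply: sV; rewrite mem_cat zp.
  + by apply: qV; rewrite inE eqxx.
  + by apply: sV; rewrite mem_cat inE zs !orbT.
- by move=> z zq; apply: qV; rewrite inE zq orbT.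
Qed.

(** A third sequence, disjoint from both, serves as an intermediate; the factor 3 leaves room for
    it. *)
Lemma fresh_const s q : size s = size q -> uniq s -> uniq q ->
  {subset s <= V} -> {subset q <= V} -> (3 * size s <= #|V|)%N -> P s = P q.
Proof.
move=> sz us uq sV qV hV.
pose r := take (size s) [seq x <- enum V | x \notin s ++ q].
have ur : uniq r by apply: take_uniq; apply: filter_uniq; exact: enum_uniq.
have rsq x : x \in r -> x \notin s ++ q by move/mem_take; rewrite mem_filter => /andP[].
have rV : {subset r <= V} by move=> x /mem_take; rewrite mem_filter mem_enum => /andP[].
have szr : size r = size s.
  rewrite size_takel // size_filter -(leq_add2l (count (mem (s ++ q)) (enum V))).
  rewrite (count_predC (mem (s ++ q))) -cardE.
  have : count (mem (s ++ q)) (enum V) <= size (s ++ q).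
    rewrite -size_filter; apply: uniq_leq_size; first exact: filter_uniq (enum_uniq _).
    by move=> x; rewrite mem_filter => /andP[].
  by rewrite size_cat -sz; move: hV; lia.
transitivity (P r).
  apply: (@fresh_disjoint [::]); rewrite ?szr //.
  by apply/hasPn => x /rsq; rewrite mem_cat => /norP[].
apply/esym/(@fresh_disjoint [::]); rewrite ?szr //.
by apply/hasPn => x /rsq; rewrite mem_cat => /norP[].
Qed.

End FreshReplacement.

(** A matching of unrelated pairs is grown greedily; where it stops, the uncovered points are
    pairwise related. *)
Lemma matching_or_class (T : finType) (R : rel T) c :
  (exists s : seq (T * T), [/\ size s = c, uniq (flatten [seq [:: p.1; p.2] | p <- s])
      & {in s, forall p, ~~ R p.1 p.2}])
  \/ (exists U : {set T}, (#|~: U| <= 2 * c)%N /\ {in U &, forall x y, x != y -> R x y}).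
Proof.
elim: c => [|c [[s [sz us hs]]|[U [cU hU]]]]; first by left; exists [::].
  pose U := [set x | x \notin flatten [seq [:: p.1; p.2] | p <- s]].
  case: (boolP [forall x in U, forall y in U, (x != y) ==> R x y]) => h.
    right; exists U; split; last first.
      by move=> x y xU yU xy; have /forall_inP/(_ x xU)/forall_inP/(_ y yU)/implyP := h; apply.
    apply: (@leq_trans (size (flatten [seq [:: p.1; p.2] | p <- s]))).
      apply: leq_trans (card_size _); apply/subset_leq_card/subsetP => x.
      by rewrite !inE negbK.
    rewrite size_flatten /shape -map_comp -sz.
    by elim: (s) => //= p s' IH; lia.
  move: h; rewrite negb_forall => /existsP[x]; rewrite negb_imply => /andP[xU].
  rewrite negb_forall => /existsP[y]; rewrite negb_imply => /andP[yU].
  rewrite negb_imply => /andP[xy nR].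
  left; exists ((x, y) :: s); split; first by rewrite /= sz.
    rewrite /= us inE (negPf xy) /=; move: xU yU; rewrite !inE => -> ->. by [].
  by move=> p; rewrite inE => /predU1P[->|/hs].
right; exists U; split=> //; apply: leq_trans cU _; lia.
Qed.

Section Frames.

Variables (gT : finGroupType) (D : {set gT}) (m : nat) (dd : 'I_m -> 'I_m -> gT).
Hypothesis tD : tset D.

(* dd i j plays the role of the transposition (i j). *)
Definition frame := [/\ forall i j, i != j -> dd i j \in D,
  forall i j, dd i j = dd j i,
  forall i j k, i != j -> j != k -> i != k ->
    dd i j ^ dd j k = dd i k /\ adj (dd i j) (dd j k)
  & forall i j k l, uniq [:: i; j; k; l] -> adj (dd i j) (dd k l) = false].

End Frames.

Lemma star_cons (gT : finGroupType) (D : {set gT}) e (s : seq gT) : tset D -> e \in D ->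
  star D s -> {in s, forall x, adj e x} ->
  {in s &, forall x y, x != y -> adj (x ^ y) e = false} -> star D (e :: s).
Proof.
move=> tD eD [sD cs ss] es ees.
have cin := clique_in cs.
split=> [x||]; first by rewrite inE => /predU1P[->|/sD].
  by rewrite /clique /= -/(clique s) cs andbT; apply/allP.
have sw x y : x \in s -> y \in s -> x != y -> adj (e ^ x) y = false /\ adj (x ^ e) y = false.
  move=> xs ys xy; have [xD yD] := (sD _ xs, sD _ ys).
  have n : ~~ aff x y e by apply/negP => /affP[_ _ _]; rewrite ees.
  have b : e ^ x = x ^ e by apply: (tset_braid tD) => //; exact: es.
  suff h : adj (x ^ e) y = false by rewrite b h.
  apply: contraNF n => h; apply: (aff23 tD) => //; apply/affP; split=> //.
  - by rewrite adjC es.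
  - exact: es.
  - exact: cin.
move=> x y z; rewrite !inE => /predU1P[->|xs] /predU1P[->|ys] /predU1P[->|zs];
  rewrite ?eqxx // => xy yz xz.
- by have [] := sw _ _ ys zs yz.
- by have [] := sw _ _ xs zs xz.
- exact: ees.
- exact: ss.
Qed.

Lemma uniq_consE (T : eqType) (x : T) s : uniq (x :: s) -> x \notin s /\ uniq s.
Proof. by case/andP. Qed.

Lemma notin_consE (T : eqType) (x y : T) s : x \notin y :: s -> x != y /\ x \notin s.
Proof. by rewrite inE negb_or => /andP. Qed.

Lemma notin_seq1 (T : eqType) (x y : T) : x \notin [:: y] -> x != y.
Proof. by rewrite inE. Qed.

Ltac neqs :=
  repeat match goal with
  | H : is_true (uniq (_ :: _)) |- _ => move/uniq_consE in H; destruct H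
  | H : is_true (~~ in_mem _ _) |- _ => first [move/notin_seq1 in H | move/notin_consE in H; destruct H]
  end.

Ltac neq := neqs; rewrite /= ?inE ?negb_or ?andbT; repeat (apply/andP; split);
  first [assumption | rewrite eq_sym; assumption | exact: isT].

(** * How a vertex meets a large frame *)

Section LargeFrame.

Variables (gT : finGroupType) (D : {set gT}) (t m : nat) (dd : 'I_m -> 'I_m -> gT).
Hypotheses (tD : tset D) (pD : psd D t) (t0 : 0 < t) (fr : frame D dd).
Implicit Types (i j k l : 'I_m) (e f h : gT).

Lemma ddD i j : i != j -> dd i j \in D. Proof. by case: fr => H _ _ _; exact: H. Qed.
Lemma ddC i j : dd i j = dd j i. Proof. by case: fr => _ H _ _; exact: H. Qed.
Lemma dd_chain i j k : i != j -> j != k -> i != k -> dd i j ^ dd j k = dd i k.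
Proof. by case: fr => _ _ H _ a b c; have [] := H _ _ _ a b c. Qed.
Lemma dd_adj i j k : i != j -> j != k -> i != k -> adj (dd i j) (dd j k).
Proof. by case: fr => _ _ H _ a b c; have [] := H _ _ _ a b c. Qed.
Lemma dd_nadj i j k l : uniq [:: i; j; k; l] -> adj (dd i j) (dd k l) = false.
Proof. by case: fr => _ _ _ H; exact: H. Qed.
Lemma dd_disj i j k l : uniq [:: i; j; k; l] -> dd i j ^ dd k l = dd i j.
Proof. by move=> u; apply: nadjJ; rewrite dd_nadj. Qed.

Ltac tps := repeat first [rewrite tpermL | rewrite tpermR
  | rewrite tpermD; [|solve [neq]|solve [neq]]].

Lemma dd_conj i j k l : i != j -> k != l ->
  dd i j ^ dd k l = dd (tperm k l i) (tperm k l j).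
Proof.
move=> ij kl; have lk : l != k by rewrite eq_sym.
have ji : j != i by rewrite eq_sym.
case: (tpermP k l i) => [e|e|/eqP ik /eqP il]; case: (tpermP k l j) => [e'|e'|/eqP jk /eqP jl];
  subst; rewrite ?eqxx // in ij *.
- by rewrite (nadjJ (negbT (adjxx _))) ddC.
- by rewrite (ddC k j) dd_chain 1?ddC //; neq.
- by rewrite ddC (nadjJ (negbT (adjxx _))).
- by rewrite (ddC l j) (ddC k l) dd_chain 1?ddC //; neq.
- by rewrite dd_chain //; neq.
- by rewrite (ddC k l) dd_chain //; neq.
- by rewrite dd_disj //; neq.
Qed.

Lemma dd_adj_conj e i j : i != j -> forall x, adj (x ^ dd i j) e = adj x (e ^ dd i j).
Proof. by move=> ij x; rewrite -(adjJ _ _ (dd i j)) (tset_conjK tD) // ddD. Qed.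

(* An element e that meets the frame in two rows i1, i2 and has a neighbour h
   missing both rows has many images under the frame which are all adjacent to h;
   these images contain either a large claw or the cliques of no_two_claws. *)
Section Moving.

Variables (e h : gT) (i1 i2 : 'I_m) (V : {set 'I_m}).
Hypotheses (eD : e \in D) (hD : h \in D) (i12 : i1 != i2).
Hypotheses (i1V : i1 \notin V) (i2V : i2 \notin V).
Hypothesis eV : {in V &, forall i j, i != j -> adj e (dd i j) = false}.
Hypothesis e1 : {in V, forall j, adj e (dd i1 j)}.
Hypothesis e2 : {in V, forall j, adj e (dd i2 j)}.
Hypothesis h1 : {in V, forall j, adj h (dd i1 j) = false}.
Hypothesis h2 : {in V, forall j, adj h (dd i2 j) = false}.
Hypothesis he : adj h e.

(** The symmetric group of the frame carries the rows [i1], [i2] of [e] to [j], [k]. As [h] misses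
    both rows, all these images stay adjacent to it. *)
Definition moved j k := (e ^ dd i1 j) ^ dd i2 k.

Let n1 j : j \in V -> i1 != j. Proof. by move=> jV; apply: contraNneq i1V => ->. Qed.
Let n2 j : j \in V -> i2 != j. Proof. by move=> jV; apply: contraNneq i2V => ->. Qed.

Lemma movedD j k : j \in V -> k \in V -> moved j k \in D.
Proof. by move=> jV kV; rewrite /moved !(tsetJ tD) // ddD ?n1 ?n2. Qed.

Lemma moved_h j k : j \in V -> k \in V -> adj h (moved j k).
Proof. by move=> jV kV; rewrite /moved !adj_fixr ?h1 ?h2. Qed.

Lemma moved_adj j k x : j \in V -> k \in V ->
  adj (moved j k) x = adj e ((x ^ dd i2 k) ^ dd i1 j).
Proof. by move=> jV kV; rewrite /moved !dd_adj_conj ?n1 ?n2. Qed.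

Ltac neqV := repeat match goal with H : is_true (in_mem ?j _) |- _ =>
  lazymatch goal with _ : is_true (i1 != j) |- _ => fail
  | _ => pose proof (n1 H); pose proof (n2 H) end end.

Lemma moved_dd_l j k l : j \in V -> k \in V -> l \in V -> uniq [:: j; k; l] ->
  adj (moved j k) (dd j l).
Proof.
move=> jV kV lV u; neqV; rewrite moved_adj // dd_conj; [|neq..]; tps.
rewrite dd_conj; [|neq..]; tps; exact: e1.
Qed.

Lemma moved_dd_r j k l : j \in V -> k \in V -> l \in V -> uniq [:: j; k; l] ->
  adj (moved j k) (dd k l).
Proof.
move=> jV kV lV u; neqV; rewrite moved_adj // dd_conj; [|neq..]; tps.
rewrite dd_conj; [|neq..]; tps; exact: e2.
Qed.

Lemma moved_dd_n j k l r : j \in V -> k \in V -> l \in V -> r \in V ->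
  uniq [:: j; k; l; r] -> adj (moved j k) (dd l r) = false.
Proof.
move=> jV kV lV rV u; neqV; rewrite moved_adj // dd_conj; [|neq..]; tps.
rewrite dd_conj; [|neq..]; tps; apply: eV => //; neq.
Qed.

Lemma moved_step_l j k l : j \in V -> k \in V -> l \in V -> uniq [:: j; k; l] ->
  moved j k ^ dd j l = moved l k.
Proof.
move=> jV kV lV u; neqV; rewrite /moved conjJg [X in _ ^ X]dd_conj; [|neq..]; tps.
congr (_ ^ _); rewrite conjJg [X in _ ^ X]dd_conj; [|neq..]; tps.
by congr (_ ^ _); apply: nadjJ; rewrite eV //; neq.
Qed.

Lemma moved_step_r j k l : j \in V -> k \in V -> l \in V -> uniq [:: j; k; l] ->
  moved j k ^ dd k l = moved j l.
Proof.
move=> jV kV lV u; neqV; rewrite /moved conjJg [X in _ ^ X]dd_conj; [|neq..]; tps.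
congr (_ ^ _); rewrite conjJg [X in _ ^ X]dd_conj; [|neq..]; tps.
by congr (_ ^ _); apply: nadjJ; rewrite eV //; neq.
Qed.

Lemma moved_fix j k l r : j \in V -> k \in V -> l \in V -> r \in V ->
  uniq [:: j; k; l; r] -> moved j k ^ dd l r = moved j k.
Proof. by move=> jV kV lV rV u; apply: nadjJ; rewrite moved_dd_n. Qed.

(** Replacing one index by a fresh one is conjugation by a frame element that fixes the other moved
    vertex, so [fresh_const] applies; 12 is three times four indices. *)
Lemma moved_uniform s q : size s = 4 -> size q = 4 -> uniq s -> uniq q ->
  {subset s <= V} -> {subset q <= V} -> (12 <= #|V|)%N ->
  let P r := adj (moved (nth i1 r 0) (nth i1 r 1)) (moved (nth i1 r 2) (nth i1 r 3)) in
  P s = P q.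
Proof.
move=> zs zq us uq sV qV hV P.
pose P' r := (size r == 4) && P r.
suff : P' s = P' q by rewrite /P' zs zq.
apply: (@fresh_const _ V P') => //; rewrite ?zs ?zq //.
move=> p x y r; rewrite /P' !size_cat /=; case: eqP => //= zz u yn sub yV.
have U : uniq (y :: p ++ x :: r) by rewrite /= yn u.
case: p zz {u} yn sub U => [|a [|b [|c [|d p]]]] /= zz yn sub U;
  case: r zz yn sub U => [|a' [|b' [|c' [|d' r]]]] //= zz yn sub U;
  try (by exfalso; clear -zz; lia).
- have {}U : uniq [:: y; x; a'; b'; c'] := U.
  have [xV aV bV cV] : [/\ x \in V, a' \in V, b' \in V & c' \in V].
    by split; apply: sub; rewrite !inE eqxx ?orbT.
  by rewrite /P /= -(adjJ _ _ (dd x y)) moved_step_l ?moved_fix //; neq.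
- have {}U : uniq [:: y; a; x; a'; b'] := U.
  have [xV aV bV cV] : [/\ x \in V, a \in V, a' \in V & b' \in V].
    by split; apply: sub; rewrite !inE eqxx ?orbT.
  by rewrite /P /= -(adjJ _ _ (dd x y)) moved_step_r ?moved_fix //; neq.
- have {}U : uniq [:: y; a; b; x; a'] := U.
  have [xV aV bV cV] : [/\ x \in V, a \in V, b \in V & a' \in V].
    by split; apply: sub; rewrite !inE eqxx ?orbT.
  by rewrite /P /= -(adjJ _ _ (dd x y)) moved_step_l ?moved_fix //; neq.
- have {}U : uniq [:: y; a; b; c; x] := U.
  have [xV aV bV cV] : [/\ x \in V, a \in V, b \in V & c \in V].
    by split; apply: sub; rewrite !inE eqxx ?orbT.
  by rewrite /P /= -(adjJ _ _ (dd x y)) moved_step_r ?moved_fix //; neq.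
Qed.

Lemma moved_inj j k j' k' l : j \in V -> k \in V -> j' \in V -> k' \in V -> l \in V ->
  uniq [:: j; k; j'; k'; l] -> moved j k != moved j' k'.
Proof.
move=> jV kV jV' kV' lV u.
have hh : adj (moved j k) (dd j l) by apply: moved_dd_l => //; neq.
by apply: contraTneq hh => ->; rewrite moved_dd_n //; neq.
Qed.

Lemma no_moving : (2 * t.+1 ^ 2 + 2 * t ^ 2 + 12 <= #|V|)%N -> False.
Proof.
have [c ec] : exists c, c = (t.+1 ^ 2)%N by exists (t.+1 ^ 2)%N.
have [T eT] : exists T, T = (t ^ 2)%N by exists (t ^ 2)%N.
rewrite -ec -eT; set M := (_ + _)%N => hV.
pose en := enum V; have uen : uniq en := enum_uniq _.
have szen : (M <= size en)%N by rewrite -cardE.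
have enV x : x \in en -> x \in V by rewrite mem_enum.
pose x (i : nat) := nth i1 en i.
have xV (i : nat) : (i < M)%N -> x i \in V.
  by move=> hi; apply/enV/mem_nth/(leq_trans hi).
have xI (i j : nat) : (i < M)%N -> (j < M)%N -> (x i == x j) = (i == j).
  by move=> hi hj; rewrite nth_uniq // (leq_trans _ szen).
have U4 (j k l r : nat) : (j < M)%N -> (k < M)%N -> (l < M)%N -> (r < M)%N ->
    uniq [:: j; k; l; r] -> uniq [:: x j; x k; x l; x r].
  by move=> hj hk hl hr; rewrite /= !inE !xI.
have hV12 : (12 <= #|V|)%N by clear -hV; rewrite /M in hV; lia.
pose P j k l r := adj (moved j k) (moved l r).
have unif j k l r j' k' l' r' : j \in V -> k \in V -> l \in V -> r \in V ->
    j' \in V -> k' \in V -> l' \in V -> r' \in V ->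
    uniq [:: j; k; l; r] -> uniq [:: j'; k'; l'; r'] -> P j k l r = P j' k' l' r'.
  move=> *; apply: (@moved_uniform [:: j; k; l; r] [:: j'; k'; l'; r']) => // z;
    by rewrite !inE => /or4P[] /eqP ->.
(* By uniformity one pair decides for all. If it is adjacent, two rows of moved vertices form the
   clique of [no_two_claws]; if not, moved vertices on disjoint pairs of indices form a claw at
   [h]. *)
case P0 : (P (x 0) (x 1%N) (x 2) (x 3)).
- have PT (j k l r : nat) : (j < M)%N -> (k < M)%N -> (l < M)%N -> (r < M)%N ->
    uniq [:: j; k; l; r] -> adj (moved (x j) (x k)) (moved (x l) (x r)).
    move=> hj hk hl hr u; apply: etrans P0.
    by apply: unif; rewrite ?xV ?U4 // /M; clear; lia.
  pose s1 := [seq moved (x 0) (x (4 + i)) | i : nat <- iota 0 T].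
  pose s2 := [seq moved (x 2) (x (4 + T + i)) | i : nat <- iota 0 T].
  have row (a j k : nat) : (a < M)%N -> (j < M)%N -> (k < M)%N -> uniq [:: a; j; k] ->
     adj (moved (x a) (x j)) (moved (x a) (x k)).
    move=> ha hj hk u.
    have u3 : uniq [:: x a; x j; x k] by move: u; rewrite /= !inE !xI.
    have <- := moved_step_r (xV a ha) (xV j hj) (xV k hk) u3.
    have jk : x j != x k by neq.
    rewrite adjC; apply: (adj_third tD); rewrite ?movedD ?ddD ?xV //.
    by apply: moved_dd_r; rewrite ?xV.
  have b1 (i : nat) : i \in iota 0 T -> (4 + i < M)%N by rewrite mem_iota /M; clear; lia.
  have b2 (i : nat) : i \in iota 0 T -> (4 + T + i < M)%N by rewrite mem_iota /M; clear; lia.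
  have hM : (12 <= M)%N by exact: leq_addl.
  have [m0 m1 m2 m3] : [/\ 0 < M, 1 < M, 2 < M & 3 < M]%N by split; apply: leq_trans hM.
  have cl : clique (s1 ++ s2).
    rewrite /clique pairwise_cat !pairwise_map; apply/and3P; split.
    - apply/allrelP => _ _ /mapP[i iT ->] /mapP[j jT ->].
      apply: PT; [exact: m0|exact: b1|exact: m2|exact: b2|]; rewrite /= ?inE; move: iT; rewrite mem_iota; clear; lia.
    - apply: pairwise_of_in => [|i j iT jT ij]; first exact: iota_uniq.
      by apply: row; rewrite ?b1 //= ?inE; move: ij; clear; lia.
    - apply: pairwise_of_in => [|i j iT jT ij]; first exact: iota_uniq.
      by apply: row; rewrite ?b2 //= ?inE; move: ij; clear; lia.
  have xx (i j : nat) : (i < M)%N -> (j < M)%N -> i != j -> x i != x j by move=> hi hj; rewrite xI.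
  apply: (@no_two_claws _ D t pD (dd (x 0) (x 1%N)) (dd (x 2) (x 3)) s1 s2) => //.
  - move=> y; rewrite !inE mem_cat => /or4P[/eqP->|/eqP->|/mapP[i iT ->]|/mapP[i iT ->]].
    + by rewrite ddD // xx.
    + by rewrite ddD // xx.
    + by rewrite movedD ?xV ?b1.
    + by rewrite movedD ?xV ?b2.
  - have hh : adj (moved (x 0) (x 4)) (dd (x 0) (x 1%N)).
      by apply: moved_dd_l; rewrite ?xV //= ?inE ?xI //; rewrite /M; clear; lia.
    apply: contraTneq hh => ->; rewrite moved_dd_n ?xV //= ?inE ?xI //; rewrite /M; clear; lia.
  - by rewrite dd_nadj //= !inE !xI.
  - exact: clique_uniq.
  - move=> _ /mapP[i iT ->]; rewrite adjC; apply: moved_dd_l; rewrite ?xV ?b1 //= !inE !xI ?b1 //.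
  - move=> _ /mapP[i iT ->]; rewrite adjC moved_dd_n ?xV ?b1 //= !inE !xI ?b1 //.
  - move=> _ /mapP[i iT ->]; rewrite adjC; apply: moved_dd_l; rewrite ?xV ?b2 //= !inE !xI ?b2 //.
  - move=> _ /mapP[i iT ->]; rewrite adjC moved_dd_n ?xV ?b2 //= !inE !xI ?b2 //.
  - by rewrite size_map size_iota eT.
  - by rewrite size_map size_iota eT.
pose s := [seq moved (x (i + i)) (x (i + i).+1) | i : nat <- iota 0 c].
have b (i : nat) : i \in iota 0 c -> (i + i < M)%N /\ ((i + i).+1 < M)%N.
  by rewrite mem_iota /M; clear; lia.
have PF (i j : nat) : i \in iota 0 c -> j \in iota 0 c -> i != j ->
    adj (moved (x (i + i)) (x (i + i).+1)) (moved (x (j + j)) (x (j + j).+1)) = false.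
  move=> /b[i1' i2'] /b[j1 j2] ij; rewrite -[adj _ _]/(P _ _ _ _) -P0.
  by apply: unif; rewrite ?xV ?U4 //= ?inE; rewrite /M; move: ij; clear; lia.
apply: (@no_claw _ D t pD h s) => //.
- by move=> _ /mapP[i /b[h1' h2'] ->]; rewrite movedD ?xV.
- rewrite map_inj_in_uniq ?iota_uniq // => i j ic jc e'.
  have [[hi1 hi2] [hj1 hj2]] := (b _ ic, b _ jc); move: ic jc; rewrite !mem_iota => ic jc.
  apply/eqP; apply: contra_eqT e' => ij.
  have hc : (c + c < M)%N by rewrite /M; clear; lia.
  apply: (@moved_inj _ _ _ _ (x (c + c))); rewrite ?xV //.
  by rewrite /= !inE !xI //; lia.
- by move=> _ /mapP[i /b[h1' h2'] ->]; rewrite moved_h ?xV.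
- move=> _ _ /mapP[i ic ->] /mapP[j jc ->]; case: (eqVneq i j) => [->|ij].
    exact: adjxx.
  exact: PF.
- by rewrite size_map size_iota ec.
Qed.

End Moving.

End LargeFrame.

Lemma exists_fresh m (s : seq 'I_m) : (size s < m)%N -> exists r, r \notin s.
Proof.
move=> h; apply/existsP; rewrite -[X in (_ < X)%N](card_ord m) in h.
apply: contraLR h => /existsPn h; rewrite -leqNgt.
apply: leq_trans (card_size s); apply/subset_leq_card/subsetP => x _.
by have := h x; rewrite negbK.
Qed.

Lemma uniq_flatten_pairs (T : eqType) (s : seq (T * T)) p q :
  uniq (flatten [seq [:: p.1; p.2] | p <- s]) -> p \in s -> q \in s -> p != q ->
  uniq [:: p.1; p.2; q.1; q.2].
Proof.
have inF (s' : seq (T * T)) r : r \in s' ->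
    (r.1 \in flatten [seq [:: p.1; p.2] | p <- s']) && (r.2 \in flatten [seq [:: p.1; p.2] | p <- s']).
  move=> rs; apply/andP; split; apply/flattenP; exists [:: r.1; r.2];
    by rewrite ?inE ?eqxx ?orbT // map_f.
elim: s => // r s IH; rewrite map_cons [flatten _]/= [uniq _]/= => /and3P[].
rewrite inE negb_or => /andP[r12 r1] r2 us; rewrite !inE => /predU1P[->|ps] /predU1P[->|qs].
- by rewrite eqxx.
- move=> _; have /andP[q1 q2] := inF s q qs.
  have q12 : q.1 != q.2.
    elim: (s) us qs => // r' s' IH'; rewrite map_cons [flatten _]/= [uniq _]/= inE negb_or.
    case/and3P=> /andP[r'12 _] _ us'; rewrite inE => /predU1P[->//|]; exact: IH'.
  rewrite /= !inE !negb_or r12 q12 !andbT /=.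
  have N x y : x \notin flatten [seq [:: p0.1; p0.2] | p0 <- s] ->
      y \in flatten [seq [:: p0.1; p0.2] | p0 <- s] -> x != y.
    by move=> h1 h2; apply: contraNneq h1 => ->.
  by rewrite !N.
- move=> _; have /andP[q1 q2] := inF s p ps.
  have q12 : p.1 != p.2.
    elim: (s) us ps => // r' s' IH'; rewrite map_cons [flatten _]/= [uniq _]/= inE negb_or.
    case/and3P=> /andP[r'12 _] _ us'; rewrite inE => /predU1P[->//|]; exact: IH'.
  rewrite /= !inE !negb_or r12 q12 !andbT /=.
  have N x y : x \notin flatten [seq [:: p0.1; p0.2] | p0 <- s] ->
      y \in flatten [seq [:: p0.1; p0.2] | p0 <- s] -> y != x.
    by move=> h1 h2; apply: contraNneq h1 => <-.
  by rewrite !N.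
- exact: IH.
Qed.

(** [frame_class] loses at most [2 (t + 1) ^ 2] indices, and [no_moving] needs
    [2 (t + 1) ^ 2 + 2 t ^ 2 + 12] of the remaining ones; the rest of the constant is a reserve of
    fresh indices. *)
Definition large_frame t := (4 * t.+1 ^ 2 + 2 * t ^ 2 + 20)%N.

Section FrameTypes.

Variables (gT : finGroupType) (D : {set gT}) (t m : nat) (dd : 'I_m -> 'I_m -> gT).
Hypotheses (tD : tset D) (pD : psd D t) (jD : joined D) (t0 : 0 < t).
Hypotheses (fr : frame D dd) (nst : starless D m) (hm : (large_frame t <= m)%N).
Implicit Types (i j k l : 'I_m) (e f g h : gT).

Let ddD := ddD fr.
Let ddC := ddC fr.
Let dd_conj := dd_conj fr.

Let m20 : (20 <= m)%N.
Proof. by apply: leq_trans hm; rewrite /large_frame leq_addl. Qed.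

Lemma dd_neq i j k l : uniq [:: i; j; k; l] -> dd i j != dd k l.
Proof.
move=> u; have [|r hr] := @exists_fresh m [:: i; j; k; l]; first by rewrite /=; lia.
have h : adj (dd i j) (dd j r) by apply: (dd_adj fr); neq.
by apply: contraTneq h => ->; rewrite (dd_nadj fr) //; neq.
Qed.

(** Equality or commutation of [e] with [dd i j] is an equivalence relation on the indices, because
    [dd i k = dd i j ^ dd j k]. Disjoint pairs of inequivalent indices give a claw at [e], so one
    class, which is [V], contains almost all indices. *)
Lemma frame_class e : e \in D -> exists V : {set 'I_m}, [/\ (#|~: V| <= 2 * t.+1 ^ 2)%N,
  {in V &, forall i j, i != j -> adj e (dd i j) = false}
  & forall i j, i \in V -> j \notin V -> adj e (dd j i)].
Proof.
move=> eD; pose R i j := (i == j) || ~~ adj e (dd i j).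
have Rs i j : R i j = R j i by rewrite /R eq_sym ddC.
have Rt i j k : R i j -> R j k -> R i k.
  rewrite /R => /predU1P[->//|nij] /predU1P[<-|njk]; first by rewrite nij orbT.
  case: (eqVneq i k) => //= ik; case: (eqVneq i j) => [->//|ij].
  case: (eqVneq j k) => [<-//|jk].
  by rewrite -(dd_chain fr ij jk ik) adj_fixr.
case: (matching_or_class R (t.+1 ^ 2)%N) => [[s [sz us hs]]|[U [cU hU]]].
  exfalso; have ss p q : p \in s -> q \in s -> p != q -> uniq [:: p.1; p.2; q.1; q.2].
    exact: uniq_flatten_pairs.
  have sadj p : p \in s -> (p.1 != p.2) /\ adj e (dd p.1 p.2).
    by move=> /hs; rewrite /R negb_or negbK => /andP[].
  apply: (@no_claw _ D t pD e [seq dd p.1 p.2 | p <- s]) => //.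
  - by move=> _ /mapP[p /sadj[ps _] ->]; exact: ddD.
  - have us' : uniq s.
      by elim: (s) us => //= p s' IH /and3P[h1 h2 /IH ->]; rewrite andbT; apply: contraNN h2 => ps;
        apply/flattenP; exists [:: p.1; p.2]; rewrite ?inE ?eqxx ?orbT // map_f.
    rewrite map_inj_in_uniq // => p q ps qs epq; apply/eqP; apply: contra_eqT epq => pq.
    by apply: dd_neq; apply: ss.
  - by move=> _ /mapP[p /sadj[_ ps] ->].
  - move=> _ _ /mapP[p ps ->] /mapP[q qs ->]; case: (eqVneq p q) => [->|pq]; first exact: adjxx.
    by rewrite (dd_nadj fr) // ss.
  - by rewrite size_map sz.
have /card_gt0P[u0 u0U] : 0 < #|U|.
  have := cardsC U; rewrite card_ord; move: hm cU; rewrite /large_frame.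
  by set c := (t.+1 ^ 2)%N; lia.
exists [set x | R u0 x]; split.
- apply: leq_trans cU; apply/subset_leq_card/subsetP => x; rewrite !inE; apply: contraNN => xU.
  by case: (eqVneq u0 x) => [->|u0x]; [rewrite /R eqxx | exact: hU].
- move=> i j; rewrite !inE => Ri Rj ij; apply/negbTE.
  have : R i j by apply: Rt Rj; rewrite Rs.
  by rewrite /R (negPf ij).
- move=> i j; rewrite !inE => Ri; apply: contraR => h; apply: (Rt _ _ _ Ri).
  by rewrite /R ddC h orbT.
Qed.

(* e meets the frame as the transposition (i j) does. *)
Definition ftype i j e := [/\ e \in D, i != j,
  forall k l, uniq [:: i; j; k; l] -> adj e (dd k l) = false
  & forall k, k != i -> k != j -> adj e (dd i k) /\ adj e (dd j k)].

Lemma ftypeC i j e : ftype i j e -> ftype j i e.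
Proof.
case=> eD ij h1 h2; split=> //; first by rewrite eq_sym.
  by move=> k l u; apply: h1; neq.
by move=> k kj ki; have [] := h2 k ki kj.
Qed.

Lemma ftype_dd i j : i != j -> ftype i j (dd i j).
Proof.
move=> ij; split=> // [|k l u|k ki kj]; first exact: ddD.
  exact: (dd_nadj fr).
by split; [rewrite ddC; apply: (dd_adj fr) | apply: (dd_adj fr)]; neq.
Qed.

Lemma no_moving_frame e h i1 i2 (V : {set 'I_m}) : e \in D -> h \in D -> i1 != i2 ->
  i1 \notin V -> i2 \notin V ->
  {in V &, forall i j, i != j -> adj e (dd i j) = false} ->
  {in V, forall j, adj e (dd i1 j)} -> {in V, forall j, adj e (dd i2 j)} ->
  {in V, forall j, adj h (dd i1 j) = false} -> {in V, forall j, adj h (dd i2 j) = false} ->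
  adj h e -> (2 * t.+1 ^ 2 + 2 * t ^ 2 + 12 <= #|V|)%N -> False.
Proof. exact: (no_moving tD pD t0 fr). Qed.

(** If only [w] were outside [V], then [e] would extend the star of the [dd w j] to one with [m]
    elements. *)
Lemma frame_class_not1 e (V : {set 'I_m}) w : e \in D ->
  {in V &, forall i j, i != j -> adj e (dd i j) = false} ->
  (forall i j, i \in V -> j \notin V -> adj e (dd j i)) -> ~: V <> [set w].
Proof.
move=> eD h1 h2 VW.
have inV x : (x \in V) = (x != w) by rewrite -(in_set1 x w) -VW inE negbK.
pose s := [seq dd w j | j <- enum V].
have : star D (e :: s).
  have wV j : j \in V -> w != j by rewrite inV eq_sym.
  have dj j k : j \in V -> k \in V -> j != k -> dd w j ^ dd w k = dd j k.
    by move=> jV kV jk; rewrite (ddC w j) (dd_chain fr) // ?wV // eq_sym wV.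
  apply: star_cons => //.
  - split.
    + by move=> z /mapP[j]; rewrite mem_enum => /wV wj ->; exact: ddD.
    + rewrite /clique pairwise_map; apply: pairwise_of_in; first exact: enum_uniq.
      move=> j k; rewrite !mem_enum /= => jV kV jk; rewrite (ddC w j).
      by apply: (dd_adj fr); rewrite ?wV // eq_sym wV.
    + move=> _ _ _ /mapP[j jV ->] /mapP[k kV ->] /mapP[l lV ->].
      rewrite !mem_enum in jV kV lV => jk kl jl.
      have [njk nkl njl] : [/\ j != k, k != l & j != l].
        by split; [apply: contraNneq jk | apply: contraNneq kl | apply: contraNneq jl] => ->.
      by rewrite dj // (dd_nadj fr) //; have := wV _ jV; have := wV _ kV; have := wV _ lV => *; neq.
  - by move=> z /mapP[j]; rewrite mem_enum => jV ->; apply: h2; rewrite // inV eqxx.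
  - move=> _ _ /mapP[j jV ->] /mapP[k kV ->] jk; rewrite !mem_enum in jV kV.
    have njk : j != k by apply: contraNneq jk => ->.
    by rewrite dj // adjC h1.
move/nst; rewrite /= size_map -cardE.
by have := cardsC V; rewrite VW cards1 card_ord addn1 => ->; rewrite ltnn.
Qed.

(** Exactly two indices lie outside the large class of [e]. If there were none, a common neighbour
    of [e] and a frame element would be a moving element for [h = e]; if there were three, [i], [j],
    [k], then [e] itself would be moving, with [h = dd k v]. Both are excluded by [no_moving]. *)
Lemma frame_types e : e \in D -> exists i j, ftype i j e.
Proof.
move=> eD; have [V [cV h1 h2]] := frame_class eD.
have bigV (V' : {set 'I_m}) : (#|~: V'| <= 2 * t.+1 ^ 2)%N -> (2 * t.+1 ^ 2 + 2 * t ^ 2 + 13 <= #|V'|)%N.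
  have := cardsC V'; rewrite card_ord; move: hm; rewrite /large_frame.
  by set c := (t.+1 ^ 2)%N; set c' := (t ^ 2)%N; lia.
have two (W : {set 'I_m}) : W != set0 -> (forall w, W <> [set w]) ->
    exists i j, [/\ i \in W, j \in W & i != j].
  case/set0Pn => i iW nW; have /set0Pn[j] : W :\ i != set0.
    apply/eqP => h; apply: (nW i); apply/eqP; rewrite eqEsubset sub1set iW andbT.
    by rewrite -setD_eq0 h eqxx.
  by rewrite !inE => /andP[ji jW]; exists i, j; rewrite eq_sym.
have not1 w : ~: V <> [set w] by exact: (frame_class_not1 eD h1 h2).
case: (eqVneq (~: V) set0) => [V0|nV0].
  exfalso; have allV x : x \in V by rewrite -[V]setCK V0 setC0 inE.
  pose i0 : 'I_m := Ordinal (leq_trans (isT : 0 < 20) m20).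
  pose i1 : 'I_m := Ordinal (leq_trans (isT : 1 < 20) m20).
  have n01 : i0 != i1 by [].
  have ned : e != dd i0 i1.
    have [|r hr] := @exists_fresh m [:: i0; i1]; first by rewrite /=; lia.
    have h : adj (dd i0 i1) (dd i1 r) by apply: (dd_adj fr); neq.
    by apply: contraTneq h => <-; rewrite h1 //; neq.
  have [f [fD fe fd]] := jD eD (ddD n01) ned (h1 _ _ (allV _) (allV _) n01).
  have [V' [cV' h1' h2']] := frame_class fD.
  have [|i [j [iV jV ij]]] := two (~: V') _ (fun w => frame_class_not1 fD h1' h2').
    apply/eqP => V'0; have allV' x : x \in V' by rewrite -[V']setCK V'0 setC0 inE.
    by rewrite h1' in fd.
  rewrite !inE in iV jV.
  have nV' x : x \in V' -> (i != x) /\ (j != x).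
    by move=> xV; split; [apply: contraNneq iV => -> | apply: contraNneq jV => ->].
  apply: (@no_moving_frame f e i j V') => //.
  - by move=> k kV; apply: h2'.
  - by move=> k kV; apply: h2'.
  - by move=> k /nV'[ik jk]; apply: h1.
  - by move=> k /nV'[ik jk]; apply: h1.
  - by rewrite adjC.
  - by move: (bigV _ cV'); clear; lia.
have [i [j [iV jV ij]]] := two _ nV0 not1.
rewrite !inE in iV jV.
have [Wij|nWij] := eqVneq (~: V) [set i; j].
  have inV x : (x \in V) = (x != i) && (x != j).
    by rewrite -[V]setCK Wij !inE negb_or.
  exists i, j; split=> //.
  - by move=> k l u; apply: h1; rewrite ?inV; neq.
  - by move=> k ki kj; split; apply: h2; rewrite // inV ki.
have /set0Pn[k] : ~: V :\: [set i; j] != set0.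
  apply: contraNneq nWij => h; rewrite eqEsubset -setD_eq0 h eqxx /=.
  by apply/subsetP => x; rewrite !inE => /orP[] /eqP ->.
rewrite !inE negb_or => /andP[/andP[ki kj] kV].
exfalso; have /card_gt0P[v vV] : 0 < #|V| by move: (bigV _ cV); clear; lia.
have nV x : x \in V -> [/\ i != x, j != x & k != x].
  by move=> xV; split; [apply: contraNneq iV => -> | apply: contraNneq jV => -> | apply: contraNneq kV => ->].
have [iv jv kv] := nV v vV.
apply: (@no_moving_frame e (dd k v) i j (V :\ v)) => //.
- exact: ddD.
- by rewrite !inE negb_and iV orbT.
- by rewrite !inE negb_and jV orbT.
- by move=> x y; rewrite !inE => /andP[_ xV] /andP[_ yV]; apply: h1.
- by move=> x; rewrite !inE => /andP[_ xV]; apply: h2.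
- by move=> x; rewrite !inE => /andP[_ xV]; apply: h2.
- move=> x; rewrite !inE => /andP[xv /nV[ix jx kx]]; apply: (dd_nadj fr); neq.
- move=> x; rewrite !inE => /andP[xv /nV[ix jx kx]]; apply: (dd_nadj fr); neq.
- by rewrite adjC; apply: h2.
- by move: (bigV _ cV); rewrite (cardsD1 v V) vV; clear; lia.
Qed.

End FrameTypes.

Section FinGroup.

Variables (T : finType) (mul : T -> T -> T) (one : T) (inv : T -> T).
Hypotheses (mA : associative mul) (m1 : left_id one mul) (mV : left_inverse one inv mul).

(** The laws are phantom parameters: a carrier that mentions them can be given a group structure as
    an instance. *)
Definition group_carrier (_ : associative mul) (_ : left_id one mul)
  (_ : left_inverse one inv mul) : Type := T.

HB.instance Definition _ := Finite.on (group_carrier mA m1 mV).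
HB.instance Definition _ := Finite_isGroup.Build (group_carrier mA m1 mV) mA m1 mV.

Lemma fin_group : exists (A : finGroupType) (f : A -> T),
    [/\ bijective f, f 1 = one & {morph f : x y / x * y >-> mul x y}].
Proof. by exists (group_carrier mA m1 mV), id; split=> //; exists id. Qed.

End FinGroup.

Lemma fin_group_in (T : finType) (E : {set T}) (mul : T -> T -> T) (one : T) :
  one \in E -> {in E &, forall x y, mul x y \in E} ->
  {in E & &, forall x y z, mul x (mul y z) = mul (mul x y) z} ->
  {in E, forall x, mul one x = x} -> {in E, forall x, exists2 y, y \in E & mul y x = one} ->
  exists (A : finGroupType) (f : A -> T),
    [/\ injective f, forall a, f a \in E, forall x, x \in E -> exists a, x = f a, f 1 = one
      & {morph f : x y / x * y >-> mul x y}].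
Proof.
move=> oE mE mA m1 mV; pose S := {x | x \in E}.
pose mul' (x y : S) : S := exist _ (mul (val x) (val y)) (mE _ _ (valP x) (valP y)).
have iE (x : S) : [exists y : S, mul (val y) (val x) == one].
  by have [y yE h] := mV _ (valP x); apply/existsP; exists (exist _ y yE); apply/eqP.
pose inv x := xchoose (existsP (iE x)).
have [||| A [f [[g fK gK] f1 fM]]] := @fin_group S mul' (exist _ one oE) inv.
- by move=> x y z; apply: val_inj; exact: mA (valP x) (valP y) (valP z).
- by move=> x; apply: val_inj; exact: m1 (valP x).
- by move=> x; apply: val_inj; apply/eqP; exact: (xchooseP (existsP (iE x))).
exists A, (fun a => val (f a)); split.
- by move=> a b h; apply: (can_inj fK); apply: val_inj.
- by move=> a; apply: valP.
- by move=> x xE; exists (g (exist _ x xE)); rewrite gK.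
- by rewrite f1.
- by move=> a b; rewrite fM.
Qed.

(* In the wreath product of A by Sym(m), acting on the pairs (x, i), the element
   w i j a exchanges (x, i) with (x * a, j). *)
Definition coords (gT : finGroupType) (D : {set gT}) (A : finGroupType) m
    (w : 'I_m -> 'I_m -> A -> gT) :=
  [/\ forall i j a, i != j -> w i j a \in D,
      forall e, e \in D -> exists i j a, i != j /\ e = w i j a,
      forall i j a, i != j -> w j i a = w i j a^-1,
      forall i j k a b, i != j -> j != k -> i != k -> w i j a ^ w j k b = w i k (a * b)
    & forall i j k l a b, uniq [:: i; j; k; l] -> w i j a ^ w k l b = w i j a] /\
  (forall i j k l a b, i != j -> k != l -> w i j a = w k l b ->
     i = k /\ j = l /\ a = b \/ i = l /\ j = k /\ a = b^-1).

(** * The group of coordinates over a frame *)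

Section Coordinates.

Variables (gT : finGroupType) (D : {set gT}) (m : nat) (dd : 'I_m -> 'I_m -> gT).
Hypotheses (tD : tset D) (fr : frame D dd) (m8 : (8 <= m)%N).
Notation ftype := (ftype D dd).
Hypothesis allT : forall e, e \in D -> exists i j, ftype i j e.
Hypothesis dis : forall i j k l e f, uniq [:: i; j; k; l] ->
  ftype i j e -> ftype k l f -> adj e f = false.
Implicit Types (i j k l : 'I_m) (e f g h x y z : gT).

Let ddD := ddD fr.
Let ddC := ddC fr.
Let dd_conj := dd_conj fr.

Lemma ftype_in i j e : ftype i j e -> e \in D. Proof. by case. Qed.

Lemma ftype_conj i j e k l : k != l -> ftype i j e ->
  ftype (tperm k l i) (tperm k l j) (e ^ dd k l).
Proof.
move=> kl [eD ij h1 h2]; set s := tperm k l.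
have sK : involutive s by exact: tpermK.
have si : injective s by exact: inv_inj.
have A a b : a != b -> adj (e ^ dd k l) (dd a b) = adj e (dd (s a) (s b)).
  by move=> ab; rewrite (dd_adj_conj tD fr) // dd_conj.
split; first by rewrite (tsetJ tD) ?ddD.
- by rewrite (inj_eq si).
- move=> a b u; rewrite A; last by neq.
  apply: h1; move: u; rewrite -(map_inj_uniq si) /= !sK. by [].
- move=> a ai aj; rewrite !A ?sK; try by rewrite eq_sym.
  by apply: h2; rewrite -(inj_eq si) sK.
Qed.

Ltac tps := repeat first [rewrite tpermL | rewrite tpermR
  | rewrite tpermD; [|solve [neq]|solve [neq]]].

Lemma fresh (s : seq 'I_m) : (size s < 8)%N -> exists r, r \notin s.
Proof. by move=> h; apply: exists_fresh; apply: leq_trans m8. Qed.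

Lemma ftype_mem i j a b e : ftype i j e -> ftype a b e -> i \in [:: a; b].
Proof.
move=> [_ ij _ h] [_ ab h' _]; apply/negP => /negP n.
have [//|r hr] := @fresh [:: i; j; a; b].
have [] : adj e (dd i r) /\ adj e (dd j r) by apply: h; neq.
by rewrite h' //; neq.
Qed.

Lemma ftype_uniq i j a b e : ftype i j e -> ftype a b e ->
  i = a /\ j = b \/ i = b /\ j = a.
Proof.
move=> h h'; have := ftype_mem h h'; have := ftype_mem (ftypeC h) h'.
case: (h) => _ ij _ _; rewrite !inE.
by case/orP=> /eqP ej /orP[] /eqP ei; subst; rewrite ?eqxx // in ij *; [right|left].
Qed.

(** If [e] and [f] commuted, the vertex [f ^ dd j r], of type [(r k)] and so commuting with [e],
    would show after conjugation by [f] that [e] commutes with [dd j r]. The type of [e ^ f] must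
    contain [i] and [k]: otherwise a frame element through that index and a fresh one would be
    adjacent to [e ^ f] although the type forbids it. *)
Lemma ftype_cross i j k e f : uniq [:: i; j; k] -> ftype i j e -> ftype j k f ->
  adj e f /\ ftype i k (e ^ f).
Proof.
move=> u he hf; have [eD fD] := (ftype_in he, ftype_in hf).
have ad : adj e f.
  apply: (@contraT (adj e f)) => n; have [//|r hr] := @fresh [:: i; j; k].
  have [_ _ _ /(_ r)] := he; case; [neq|neq|] => _ ejr.
  have [_ _ _ /(_ r)] := hf; case; [neq|neq|] => fjr _.
  have jr : j != r by neq.
  have g3 : ftype r k (f ^ dd j r) by have := ftype_conj jr hf; tps.
  have br : f ^ dd j r = dd j r ^ f by apply: (tset_braid tD); rewrite ?ddD.
  have : adj e (f ^ dd j r) = false by apply: (dis _ he g3); neq.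
  rewrite br => h; have : adj (e ^ f) (dd j r ^ f) = adj e (dd j r) by rewrite adjJ.
  by rewrite (nadjJ n) h ejr.
split=> //; have efD : e ^ f \in D by rewrite (tsetJ tD).
have br : e ^ f = f ^ e by apply: (tset_braid tD).
have [a [b hab]] := allT efD.
have [_ ab h1 _] := hab.
have mi : i \in [:: a; b].
  apply/negP => /negP n; have [//|r hr] := @fresh [:: i; j; k; a; b].
  have [_ _ _ /(_ r)] := he; case; [neq|neq|] => eir _.
  have [_ _ hf' _] := hf.
  have nf : ~~ adj f (dd i r) by rewrite hf' //; neq.
  have ir : i != r by neq.
  have : adj (e ^ f) (dd i r ^ f) by rewrite adjJ.
  rewrite (nadjJ (_ : ~~ adj (dd i r) f)); last by rewrite adjC.
  by rewrite h1 //; neq.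
have mk : k \in [:: a; b].
  apply/negP => /negP n; have [//|r hr] := @fresh [:: i; j; k; a; b].
  have [_ _ _ /(_ r)] := hf; case; [neq|neq|] => _ fkr.
  have [_ _ he' _] := he.
  have ne : ~~ adj e (dd k r) by rewrite he' //; neq.
  have : adj (f ^ e) (dd k r ^ e) by rewrite adjJ.
  rewrite (nadjJ (_ : ~~ adj (dd k r) e)); last by rewrite adjC.
  by rewrite -br h1 //; neq.
have ik : i != k by neq.
move: mi mk hab; rewrite !inE => /orP[/eqP ei|/eqP ei] /orP[/eqP ek|/eqP ek];
  subst; rewrite ?eqxx // in ik *; exact: ftypeC.
Qed.

End Coordinates.

Section FrameCoordinates.

Variables (gT : finGroupType) (D : {set gT}) (m : nat) (dd : 'I_m -> 'I_m -> gT).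
Hypotheses (tD : tset D) (fr : frame D dd) (m8 : (8 <= m)%N).
Notation ftype := (ftype D dd).
Hypothesis allT : forall e, e \in D -> exists i j, ftype i j e.
Hypothesis dis : forall i j k l e f, uniq [:: i; j; k; l] ->
  ftype i j e -> ftype k l f -> adj e f = false.
Variables (o p q : 'I_m).
Hypothesis opq : uniq [:: o; p; q].
Implicit Types (i j k l : 'I_m) (e f g h x y z : gT).

Let op : o != p. Proof. by have U := opq; neq. Qed.
Let oq : o != q. Proof. by have U := opq; neq. Qed.
Let pq : p != q. Proof. by have U := opq; neq. Qed.
Let ddD := ddD fr.
Let ddC := ddC fr.
Let cross := ftype_cross tD fr m8 allT dis.
Let tconj := @ftype_conj _ _ _ _ tD fr.
Let tin := @ftype_in _ D m dd.
Let tyC := @ftypeC _ D m dd.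

Ltac tps := repeat first [rewrite tpermL | rewrite tpermR
  | rewrite tpermD; [|solve [neq]|solve [neq]]].

Lemma ftype_disJ i j k l e f : uniq [:: i; j; k; l] ->
  ftype i j e -> ftype k l f -> e ^ f = e.
Proof. by move=> u he hf; apply: nadjJ; rewrite (dis u he hf). Qed.

Lemma ftype_fix i j k l e : uniq [:: i; j; k; l] -> ftype i j e -> e ^ dd k l = e.
Proof. by move=> u he; apply: (ftype_disJ u he); apply: (ftype_dd fr); neq. Qed.

Lemma ftype_ddK i j e : i != j -> (e ^ dd i j) ^ dd i j = e.
Proof. by move=> ij; apply: (tset_conjK tD); rewrite ddD. Qed.

Lemma ftype_move i j k l e : uniq [:: i; j; k; l] -> ftype i j e ->
  (e ^ dd j k) ^ dd k l = e ^ dd j l.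
Proof.
move=> u he; rewrite conjJg (ftype_fix u he); congr (_ ^ _).
by rewrite (dd_chain fr) //; neq.
Qed.

Lemma ftype_third i j k e f : uniq [:: i; j; k] -> ftype i j e -> ftype j k f ->
  e ^ (e ^ f) = f.
Proof.
by move=> u he hf; have [ad _] := cross u he hf; apply: (tset_third tD) => //;
  [exact: tin he | exact: tin hf].
Qed.

Definition ftypeb i j e := [&& e \in D, i != j,
  [forall k, forall l, uniq [:: i; j; k; l] ==> ~~ adj e (dd k l)]
  & [forall k, (k != i) ==> (k != j) ==> adj e (dd i k) && adj e (dd j k)]].

Lemma ftypeP i j e : reflect (ftype i j e) (ftypeb i j e).
Proof.
apply: (iffP and4P) => [[eD ij /forallP h1 /forallP h2]|[eD ij h1 h2]]; split=> //.
- by move=> k l u; have /forallP/(_ l)/implyP/(_ u)/negbTE := h1 k.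
- by move=> k ki kj; have /implyP/(_ ki)/implyP/(_ kj)/andP := h2 k.
- apply/forallP => k; apply/forallP => l; apply/implyP => u.
  by rewrite h1.
- by apply/forallP => k; apply/implyP => ki; apply/implyP => kj; apply/andP; apply: h2.
Qed.

(** The group is the fibre [E] over [(o p)] with unit [u]. The frame transports it to the fibre over
    [(o i)] by [th i]; [cc i j a] is the vertex over [(i j)] that sends the unit [th i u] to
    [th j a]; and [mu x a] is the action of this vertex on [x], brought back to [E]. *)
Let E := [set e | ftypeb o p e].
Let u := dd o p.
Let th i x := if i == p then x else x ^ dd p i.
Let cc i j a := th i u ^ th j a.
Let mu x a := (x ^ cc p q a) ^ dd p q.

Lemma ET x : x \in E -> ftype o p x. Proof. by rewrite inE => /ftypeP. Qed.

Let uE : u \in E.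
Proof. by rewrite inE; apply/ftypeP/(ftype_dd fr); neq. Qed.

Lemma th_type i x : i != o -> x \in E -> ftype o i (th i x).
Proof.
move=> io /ET xT; rewrite /th; case: eqP => [->//|/eqP ip].
have pi : p != i by neq.
by have := tconj pi xT; tps.
Qed.

Lemma thE i j x : i != o -> j != o -> i != j -> x \in E -> th i x ^ dd i j = th j x.
Proof.
move=> io jo ij xE; have xT := ET xE; rewrite /th.
case: eqP => [ei|/eqP ip]; case: eqP => [ej|/eqP jp]; subst.
- by rewrite eqxx in ij.
- by [].
- by rewrite (ddC i) ftype_ddK // eq_sym.
- by apply: ftype_move xT; neq.
Qed.

Lemma th_fix i k l x : uniq [:: o; i; k; l] -> x \in E -> th i x ^ dd k l = th i x.
Proof. by move=> U xE; apply: (ftype_fix U); apply: th_type => //; neq. Qed.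

Lemma th_inj i : injective (th i).
Proof. by rewrite /th => x y; case: eqP => // _; exact: conjg_inj. Qed.

Lemma th_surj i y : i != o -> ftype o i y -> exists2 x, x \in E & y = th i x.
Proof.
move=> io yT; rewrite /th; case: eqP => [ei|/eqP ip].
  by exists y; rewrite ?inE; first by apply/ftypeP; rewrite -ei.
have pi : p != i by rewrite eq_sym.
exists (y ^ dd p i); last by rewrite ftype_ddK.
by rewrite inE; apply/ftypeP; have := tconj pi yT; tps.
Qed.

Lemma cc_type i j a : uniq [:: o; i; j] -> a \in E -> ftype i j (cc i j a).
Proof.
move=> U aE; have [_ h] : adj (th i u) (th j a) /\ ftype i j (th i u ^ th j a); last exact: h.
by apply: (@cross i o j); [neq | apply/tyC/th_type; rewrite ?uE; neq | apply: th_type; rewrite ?aE; neq].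
Qed.

Lemma cc_u i j a : uniq [:: o; i; j] -> a \in E -> th i u ^ cc i j a = th j a.
Proof.
move=> U aE; apply: (@ftype_third i o j); first by neq.
  by apply/tyC/th_type; rewrite ?uE; neq.
by apply: th_type; rewrite ?aE; neq.
Qed.

Lemma cc_eq i j a F : uniq [:: o; i; j] -> a \in E -> ftype i j F ->
  th i u ^ F = th j a -> F = cc i j a.
Proof.
move=> U aE FT h; rewrite /cc -h; apply/esym; apply: (@ftype_third o i j) => //.
by apply: th_type; rewrite ?uE; neq.
Qed.

Lemma cc_surj i j F : uniq [:: o; i; j] -> ftype i j F -> exists2 a, a \in E & F = cc i j a.
Proof.
move=> U FT; have iT : ftype o i (th i u) by apply: th_type; rewrite ?uE; neq.
have [_ h] := cross U iT FT.
have [|a aE ea] := th_surj _ h; first by neq.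
by exists a => //; apply: cc_eq.
Qed.

Lemma cc_inj i j a b : uniq [:: o; i; j] -> a \in E -> b \in E -> cc i j a = cc i j b -> a = b.
Proof. by move=> U aE bE h; apply: (@th_inj j); rewrite -(cc_u U aE) -(cc_u U bE) h. Qed.

Lemma cc_r i j k a : uniq [:: o; i; j; k] -> a \in E -> cc i j a ^ dd j k = cc i k a.
Proof.
move=> U aE; rewrite /cc conjJg th_fix //; try by neq.
by rewrite thE //; neq.
Qed.

Lemma cc_l i j k a : uniq [:: o; i; j; k] -> a \in E -> cc i j a ^ dd i k = cc k j a.
Proof.
move=> U aE; rewrite /cc conjJg (th_fix (i := j)) //; try by neq.
by rewrite thE //; neq.
Qed.

Lemma mu_in x a : x \in E -> a \in E -> mu x a \in E.
Proof.
move=> xE aE; rewrite inE; apply/ftypeP.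
have cT : ftype p q (cc p q a) by apply: cc_type => //; neq.
have [_ h] := cross opq (ET xE) cT.
by have := tconj pq h; tps.
Qed.

Lemma cc_act i j x a : uniq [:: o; i; j] -> x \in E -> a \in E ->
  th i x ^ cc i j a = th j (mu x a).
Proof.
pose P i j := uniq [:: o; i; j] /\ th i x ^ cc i j a = th j (mu x a).
move=> U xE aE; suff [] : P i j by [].
have base : P p q.
  split; first exact: opq.
  rewrite /th eqxx; case: eqP => [e|_]; first by move: opq; rewrite e /= !inE eqxx andbF.
  by rewrite /mu ftype_ddK //; neq.
have mE := mu_in xE aE.
have right i' j' k : P i' j' -> uniq [:: o; i'; j'; k] -> P i' k.
  move=> [U' h] U4; split; first by neq.
  have f4 : uniq [:: o; i'; j'; k] by [].
  rewrite -(@cc_r i' j' k) // -{1}(@th_fix i' j' k) // -conjJg h thE //; neq.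
have left i' j' k : P i' j' -> uniq [:: o; i'; j'; k] -> P k j'.
  move=> [U' h] U4; split; first by neq.
  rewrite -(@cc_l i' j' k) // -(@thE i' k) //; [|neq..].
  by rewrite -conjJg h th_fix //; neq.
(* An index can only be replaced by one different from all those in play, so [(p, q)] is joined to
   [(i, j)] through two fresh indices. *)
have [|k hk] := @exists_fresh m [:: o; p; q; i; j]; first by apply: leq_trans m8.
have [|l hl] := @exists_fresh m [:: o; p; q; i; j; k]; first by apply: leq_trans m8.
have P1 : P k q by apply: (left p) => //; neq.
have P2 : P k l by apply: (right _ q) => //; neq.
have P3 : P i l by apply: (left k) => //; neq.
by apply: (right _ l) => //; neq.
Qed.

Lemma mu1 a : a \in E -> mu u a = a.
Proof.
move=> aE; have U : uniq [:: o; p; q] := opq.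
by apply: (@th_inj q); rewrite -(@cc_act p q) // cc_u.
Qed.

Lemma cc_chain i j k a b : uniq [:: o; i; j; k] -> a \in E -> b \in E ->
  cc i j a ^ cc j k b = cc i k (mu a b).
Proof.
move=> U aE bE; have [U1 U2 U3] : [/\ uniq [:: o; i; j], uniq [:: o; j; k] & uniq [:: o; i; k]].
  by split; neq.
have [_ h] : adj (cc i j a) (cc j k b) /\ ftype i k (cc i j a ^ cc j k b).
  by apply: (@cross i j k); [neq | apply: cc_type | apply: cc_type].
apply: cc_eq; rewrite ?mu_in //.
have fx : th i u ^ cc j k b = th i u.
  by apply: (@ftype_disJ o i j k) => //; [apply: th_type; rewrite ?uE; neq | apply: cc_type].
by rewrite -{1}fx -conjJg cc_u // cc_act.
Qed.

(** [cc p r (mu y z)] is the conjugate of [cc p q y] by [cc q r z], which fixes [th p x]; acting on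
    [th p x] in two ways gives associativity. *)
Lemma muA : {in E & &, forall x y z, mu x (mu y z) = mu (mu x y) z}.
Proof.
move=> x y z xE yE zE.
have [|r hr] := @exists_fresh m [:: o; p; q]; first by apply: leq_trans m8.
have U : uniq [:: o; p; q; r] by neq.
apply: (@th_inj r); rewrite -(@cc_act p r) ?mu_in //; last by neq.
rewrite -(@cc_chain p q r) //.
have fx : th p x ^ cc q r z = th p x.
  by apply: (@ftype_disJ o p q r) => //; [apply: th_type => //; neq | apply: cc_type => //; neq].
rewrite -{1}fx -conjJg !cc_act ?mu_in //; neq.
Qed.

Lemma muV : {in E, forall x, exists2 y, y \in E & mu y x = u}.
Proof.
move=> x xE; have U : uniq [:: o; p; q] := opq.
have qT : ftype o q (th q u) by apply: th_type; rewrite ?uE; neq.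
have cT : ftype q p (cc p q x) by apply/tyC/cc_type.
have [|_ h] := cross _ qT cT; first by neq.
exists (th q u ^ cc p q x); first by rewrite inE; apply/ftypeP.
apply: (@th_inj q); rewrite -(@cc_act p q) //; last by rewrite inE; apply/ftypeP.
rewrite {1}/th eqxx; apply: (tset_conjK tD); exact: tin cT.
Qed.

Lemma cc_flip i j a b : uniq [:: o; i; j] -> a \in E -> b \in E -> mu b a = u ->
  cc j i a = cc i j b.
Proof.
move=> U aE bE h; have U' : uniq [:: o; j; i] by neq.
have cT : ftype j i (cc j i a) by apply: cc_type.
apply: cc_eq; rewrite // -/u; first exact: tyC.
rewrite -h -(@cc_act j i) //; apply: (tset_conjK tD); exact: tin cT.
Qed.

Lemma frame_coords : exists (A : finGroupType) (w : 'I_m -> 'I_m -> A -> gT), coords D w.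
Proof.
have [A [v [vI vE vS v1 vM]]] := fin_group_in uE mu_in muA mu1 muV.
pose c i j a := cc i j (v a).
(* [cc] is only available away from [o]. Exchanging [o] with a fresh [k] and conjugating back
   reaches the pairs that contain [o]; the result does not depend on [k]. *)
pose W k i j a := c (tperm o k i) (tperm o k j) a ^ dd o k.
have W_o i j k a : uniq [:: o; i; j; k] -> W k i j a = c i j a.
  move=> U; rewrite /W; tps; apply: (@ftype_fix i j); first by neq.
  by apply: cc_type => //; neq.
have indep i j k k' a : i != j -> k \notin [:: o; i; j] -> k' \notin [:: o; i; j] ->
    W k i j a = W k' i j a.
  move=> ij hk hk'; case: (eqVneq k k') => [->//|kk'].
  case: (eqVneq i o) => [ei|io]; first subst.
    rewrite /W; tps; rewrite /c -(@cc_l k j k') //; last by neq.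
    rewrite (ddC o k') (@ftype_move j k k' o) //; first by rewrite ddC.
      by neq.
    by apply/tyC/cc_type => //; neq.
  case: (eqVneq j o) => [ej|jo]; first subst.
    rewrite /W; tps; rewrite /c -(@cc_r i k k') //; last by neq.
    rewrite (ddC o k') (@ftype_move i k k' o) //; first by rewrite ddC.
      by neq.
    by apply/cc_type => //; neq.
  by rewrite !W_o //; neq.
pose new i j := xchoose (@exists_fresh m [:: o; i; j] (leq_trans (isT : 4 <= 8)%N m8)).
pose w i j a := W (new i j) i j a.
have wE i j k a : i != j -> k \notin [:: o; i; j] -> w i j a = W k i j a.
  by move=> ij hk; apply: indep => //; apply: (xchooseP (@exists_fresh m [:: o; i; j] _)).
have sK k : involutive (tperm o k) by exact: tpermK.
have si k : injective (tperm o k) by exact: inv_inj.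
have so i j k : k \notin [:: o; i; j] -> i != j -> uniq [:: o; tperm o k i; tperm o k j].
  move=> hk ij; rewrite -(map_inj_uniq (si k)) /= !sK tpermL; neq.
have wT i j a : i != j -> ftype i j (w i j a).
  move=> ij; have [|k hk] := @exists_fresh m [:: o; i; j]; first by apply: leq_trans m8.
  rewrite (wE _ _ k) //; have ok : o != k by neq.
  rewrite -{1}[i](sK k) -{1}[j](sK k); apply: tconj => //.
  by apply: cc_type => //; apply: so.
have wI i j a b : i != j -> w i j a = w i j b -> a = b.
  move=> ij; have [|k hk] := @exists_fresh m [:: o; i; j]; first by apply: leq_trans m8.
  rewrite !(wE _ _ k) // => /conjg_inj h; apply: vI.
  by apply: (@cc_inj (tperm o k i) (tperm o k j)) => //; apply: so.
have wF i j a : i != j -> w j i a = w i j a^-1.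
  move=> ij; have [|k hk] := @exists_fresh m [:: o; i; j]; first by apply: leq_trans m8.
  have hk' : k \notin [:: o; j; i] by neq.
  rewrite (wE _ _ k) // 1?eq_sym // (wE _ _ k) //; congr (_ ^ _).
  by apply: cc_flip => //; [exact: so | rewrite -vM mulVg].
exists A, w; split; first split.
- by move=> i j a /wT/tin.
- move=> e eD; have [i [j eT]] := allT eD; have [_ ij _ _] := eT.
  have [|k hk] := @exists_fresh m [:: o; i; j]; first by apply: leq_trans m8.
  have ok : o != k by neq.
  have [b bE eb] := cc_surj (so _ _ _ hk ij) (tconj ok eT).
  have [a ea] := vS _ bE; exists i, j, a; split=> //.
  by rewrite (wE _ _ k) // /W /c -ea -eb ftype_ddK.
- exact: wF.
- move=> i j k a b ij jk ik.
  have [|l hl] := @exists_fresh m [:: o; i; j; k]; first by apply: leq_trans m8.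
  rewrite !(wE _ _ l) //; try by neq.
  rewrite /W -conjJg /c cc_chain -?vM //.
  rewrite -(map_inj_uniq (si l)) /= !sK tpermL; neq.
- by move=> i j k l a b U; apply: (@ftype_disJ i j k l) => //; apply: wT; neq.
move=> i j k l a b ij kl h.
have kT : ftype k l (w i j a) by rewrite h; apply: wT.
case: (ftype_uniq m8 (wT i j a ij) kT) => -[? ?]; subst.
  by left; do 2!split=> //; apply: wI h.
right; do 2!split=> //; rewrite (wF _ _ b) // in h; exact: wI h.
Qed.

End FrameCoordinates.

Section StarFrame.

Variables (gT : finGroupType) (D : {set gT}) (s : seq gT).
Hypotheses (tD : tset D) (sD : star D s).
Let n := size s.
Implicit Types i j k l : 'I_n.+1.

(** The members of the star become the transpositions [(i oo)], with [ord_max] in the role of [oo];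
    conjugation yields the transpositions [(i j)]. Hence there is one index more than the star has
    members. *)
Definition star_frame i j : gT :=
  if i == ord_max then nth 1 s j else if j == ord_max then nth 1 s i
  else nth 1 s i ^ nth 1 s j.

Let a i := nth 1 s i.

Let aD i : i != ord_max -> a i \in D.
Proof.
case: sD => h _ _ im; apply: h; apply: mem_nth.
by have := ltn_ord i; rewrite ltnS leq_eqVlt => /predU1P[e|//]; case/eqP: im; apply: val_inj.
Qed.

Let lt i : i != ord_max -> (i < size s)%N.
Proof.
move=> im; have := ltn_ord i; rewrite ltnS leq_eqVlt => /predU1P[e|//].
by case/eqP: im; apply: val_inj.
Qed.

Let aneq i j : i != ord_max -> j != ord_max -> i != j -> a i != a j.
Proof.
move=> im jm ij; case: sD => _ cs _; rewrite nth_uniq ?lt //.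
exact: clique_uniq.
Qed.

Let aadj i j : i != ord_max -> j != ord_max -> i != j -> adj (a i) (a j).
Proof.
move=> im jm ij; case: sD => _ cs _.
by apply: (clique_in cs); rewrite ?mem_nth ?lt // aneq.
Qed.

Let astar i j k : i != ord_max -> j != ord_max -> k != ord_max -> uniq [:: i; j; k] ->
  adj (a i ^ a j) (a k) = false.
Proof.
move=> im jm km U; case: sD => _ _; apply; rewrite ?mem_nth ?lt //; apply: aneq => //; neq.
Qed.

Lemma star_frameP : frame D star_frame.
Proof.
have hE j : star_frame ord_max j = a j by rewrite /star_frame eqxx.
have hE' j : star_frame j ord_max = a j by rewrite /star_frame eqxx; case: eqP => // ->.
have nE i j : i != ord_max -> j != ord_max -> star_frame i j = a i ^ a j.
  by rewrite /star_frame => /negPf-> /negPf->.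
have br i j : i != ord_max -> j != ord_max -> a i ^ a j = a j ^ a i.
  move=> im jm; case: (eqVneq i j) => [->//|ij].
  by apply: (tset_braid tD); rewrite ?aD ?aadj.
split.
- move=> i j ij; case: (eqVneq i ord_max) => [ei|im]; first by rewrite ei hE aD // eq_sym -ei.
  case: (eqVneq j ord_max) => [ej|jm]; first by rewrite ej hE' aD.
  by rewrite nE // (tsetJ tD) ?aD.
- move=> i j; case: (eqVneq i ord_max) => [->|im]; first by rewrite hE hE'.
  case: (eqVneq j ord_max) => [->|jm]; first by rewrite hE hE'.
  by rewrite !nE // br.
- move=> i j k ij jk ik.
  case: (eqVneq i ord_max) => [ei|im]; first subst.
    have [jm km] : j != ord_max /\ k != ord_max by rewrite ![_ == ord_max]eq_sym.
    rewrite !hE nE //; split; first by apply: (tset_third tD); rewrite ?aD ?aadj.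
    by rewrite adjC; apply: (adj_third tD); rewrite ?aD ?aadj.
  case: (eqVneq j ord_max) => [ej|jm]; first subst.
    have km : k != ord_max by rewrite eq_sym.
    by rewrite hE hE' nE // aadj.
  case: (eqVneq k ord_max) => [ek|km]; first subst.
    by rewrite !hE' nE // (tset_conjK tD) ?aD // adj_conjl aadj.
  rewrite !nE // (br j k) // -conjJg adjJ aadj //; split=> //; apply: nadjJ.
  by rewrite astar //; neq.
move=> i j k l U.
have far x y z w' : x != ord_max -> y != ord_max -> z != ord_max ->
    uniq [:: x; y; z; w'] -> adj (a x) (a y ^ a z) = false.
  by move=> xm ym zm U'; rewrite adjC astar //; neq.
case: (eqVneq i ord_max) => [ei|im]; first subst.
  have [jm km lm] : [/\ j != ord_max, k != ord_max & l != ord_max] by split; neq.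
  by rewrite hE nE // (far _ _ _ ord_max) //; neq.
case: (eqVneq j ord_max) => [ej|jm]; first subst.
  have [km lm] : k != ord_max /\ l != ord_max by split; neq.
  by rewrite hE' nE // (far _ _ _ ord_max) //; neq.
case: (eqVneq k ord_max) => [ek|km]; first subst.
  have lm : l != ord_max by neq.
  by rewrite hE nE // astar //; neq.
case: (eqVneq l ord_max) => [el|lm]; first subst.
  by rewrite hE' nE // astar //; neq.
rewrite !nE //.
have fi : adj (a i) (a k ^ a l) = false by apply: (far _ _ _ j) => //; neq.
have fj : adj (a j) (a k ^ a l) = false by apply: (far _ _ _ i) => //; neq.
by rewrite adj_fixl // adjC fj.
Qed.

End StarFrame.

Lemma big_star_coords t (gT : finGroupType) (D : {set gT}) : 0 < t -> tset D ->
  joined D -> psd D t -> ~ starless D (large_frame t) ->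
  exists (A : finGroupType) m (w : 'I_m -> 'I_m -> A -> gT), (4 <= m)%N /\ coords D w.
Proof.
move=> t0 tD jD pD nst.
pose P n := exists2 s, star D s & size s = n.
have bP s : star D s -> (size s <= #|D|)%N.
  case=> sD cs _; rewrite -(card_uniqP (clique_uniq cs)).
  by apply/subset_leq_card/subsetP.
(* The star is chosen of maximal size, so that no star has as many members as its frame has indices:
   this is the hypothesis [starless D m] of [frame_types]. *)
have [n [s [ss sz hs hn]]] : exists n s, [/\ star D s, size s = n,
    forall s', star D s' -> (size s' <= n)%N & (large_frame t <= n)%N].
  have st0 : exists2 s, star D s & (large_frame t <= size s)%N.
    apply: NNPP => h; apply: nst => s ss; rewrite ltnNge; apply/negP => hs.
    by apply: h; exists s.
  case: st0 => s ss hs; move: {2}(#|D| - size s)%N (leqnn (#|D| - size s)) => c.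
  elim: c s ss hs => [|c IH] s ss hs hc.
    exists (size s), s; split=> // s' /bP h; clear -h hc; lia.
  case: (classic (exists2 s', star D s' & (size s < size s')%N)) => [[s' ss' lt]|h].
    apply: (IH s') => //; first by lia.
    by have := bP _ ss'; lia.
  exists (size s), s; split=> // s' ss'; rewrite leqNgt; apply/negP => lt.
  by apply: h; exists s'.
subst n; have fr := star_frameP tD ss; set dd := @star_frame _ s in fr.
have st : starless D (size s).+1 by move=> s' /hs.
have hm : (large_frame t <= (size s).+1)%N by exact: leqW.
have m20 : (20 <= (size s).+1)%N by apply: leq_trans hm; rewrite /large_frame leq_addl.
have m8 : (8 <= (size s).+1)%N by apply: leq_trans m20.
have allT := frame_types tD pD jD t0 fr st hm.
pose o : 'I_(size s).+1 := ord0.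
pose p : 'I_(size s).+1 := Ordinal (leq_trans (isT : 1 < 20)%N m20).
pose q : 'I_(size s).+1 := Ordinal (leq_trans (isT : 2 < 20)%N m20).
have [] := @frame_coords _ _ _ dd tD fr m8 allT _ o p q isT; last first.
  by move=> A [w cw]; exists A, (size s).+1, w; split=> //; apply: leq_trans m8.
move=> i j k l e f U [eD ij h1 h2] [fD kl h1' h2'].
(* It remains to see that vertices of disjoint types commute: if adjacent, [e] would be a moving
   element with rows [i], [j], both missed by [f]. *)
pose V := ~: [set i; j; k; l].
have inV x : x \in V -> [/\ x != i, x != j, x != k & x != l].
  by rewrite !inE !negb_or -!andbA => /and4P[].
case ef: (adj e f) => //; exfalso.
apply: (@no_moving_frame _ _ _ _ _ tD pD t0 fr e f i j V) => //.
- by rewrite !inE eqxx.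
- by rewrite !inE eqxx orbT.
- by move=> x y /inV[xi xj _ _] /inV[yi yj _ _] xy; apply: h1; neq.
- by move=> x /inV[xi xj _ _]; have [] := h2 x xi xj.
- by move=> x /inV[xi xj _ _]; have [] := h2 x xi xj.
- by move=> x /inV[xi xj xk xl]; apply: h1'; neq.
- by move=> x /inV[xi xj xk xl]; apply: h1'; neq.
- by rewrite adjC.
have c4 : (#|[set i; j; k; l]| <= 4)%N.
  apply: leq_trans (card_size [:: i; j; k; l]).
  by apply/subset_leq_card/subsetP => x; rewrite !inE -!orbA.
move: hm (cardsC [set i; j; k; l]) c4; rewrite /large_frame card_ord -/V.
move: (t.+1 ^ 2)%N (t ^ 2)%N (#|V|) (#|_|) => c c' x y; clear; lia.
Qed.

(** * 3-transposition groups and their central types *)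

Lemma tset_norm (gT : finGroupType) (D : {set gT}) : tset D -> <<D>> \subset 'N(D).
Proof.
move=> tD; rewrite gen_subG; apply/subsetP => z zD; rewrite inE.
by apply/subsetP => _ /imsetP[y yD ->]; exact: tsetJ.
Qed.

Section TgroupFacts.

Variable X : tgroup.
Notation G := (tg_group X).
Notation D := (tg_class X).

Lemma tg_gen : <<D>> = G. Proof. by case: (tg_axiom X). Qed.

Lemma tg_sub : D \subset G. Proof. by rewrite -tg_gen subset_gen. Qed.

Lemma tg_conj x y : x \in D -> y \in D -> exists2 g, g \in G & y = x ^ g.
Proof.
case: (tg_axiom X) => _ /imsetP[d dG ->] _ _ /imsetP[h hG ->] /imsetP[k kG ->].
by exists (h^-1 * k); rewrite ?groupM ?groupV // -conjgM mulKVg.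
Qed.

Lemma tg_neq0 : exists d, d \in D.
Proof.
case: (tg_axiom X) => _ /imsetP[d dG ->] _ _.
by exists d; apply: class_refl.
Qed.

Lemma tg_mulgg x : x \in D -> x * x = 1.
Proof. by case: (tg_axiom X) => _ _ h _ /h o; rewrite -(expg_order x) o. Qed.

Lemma tg_tset : tset D.
Proof.
have inv x : x \in D -> x^-1 = x by move/tg_mulgg => e; apply/eqP; rewrite eq_invg_mul e.
split=> [x|x y xD yD|x y xD yD]; first exact: tg_mulgg.
  case: (tg_axiom X) => _ /imsetP[d dG eD] _ _; move: xD yD; rewrite eD.
  move=> /imsetP[h hG ->] /imsetP[k kG ->]; rewrite -conjgM.
  by apply/imsetP; exists (h * d ^ k) => //; rewrite groupM //; exact: groupJ.
rewrite /adj !conjgE !inv // => ad; case: (tg_axiom X) => _ _ _ /(_ _ _ xD yD).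
have e := expg_order (x * y).
rewrite !inE => /or3P[] /eqP o; rewrite o in e.
- have exy : y = x by rewrite -(inv x xD); apply/esym/eqP; rewrite eq_invg_mul -[_ * _]expg1 e.
  by case/eqP: ad; rewrite exy tg_mulgg // mulg1.
- have e' : x * y * (x * y) = 1 by rewrite -[RHS]e expgS expg1.
  by case/eqP: ad; apply: (mulgI x); rewrite (tg_mulgg xD) -e' -!mulgA.
have e' : x * y * (x * y) * (x * y) = 1 by rewrite -[RHS]e !expgS expg0 mulg1 !mulgA.
have e2 : y * (x * y) * (x * (y * x)) = 1.
  by apply: (mulgI x); apply: (mulIg x); rewrite mulg1 !mulgA; rewrite !mulgA in e'; rewrite e' mul1g.
apply: (mulIg (x * (y * x))); rewrite e2.
by rewrite -!mulgA (mulgA x x) tg_mulgg // mul1g (mulgA y y) tg_mulgg // mul1g tg_mulgg.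
Qed.

(** The vertices at distance at most 2 from [x] are stable under conjugation by [D], so they exhaust
    the class. In the critical case [w] is at distance 2 from [x] through [f], and [f] commutes with
    [w ^ z]; then [f ^ w] is adjacent to both [x] and [w ^ z]. *)
Lemma tg_joined : joined D.
Proof.
have tD := tg_tset.
move=> x y xD yD xy nxy.
pose C := [set y in D | [|| y == x, adj y x | [exists f in D, adj f x && adj f y]]].
have xC : x \in C by rewrite inE xD eqxx.
have : y \in C.
  have [g gG ->] := tg_conj xD yD.
  suff /subsetP/(_ g gG) gC : G \subset 'N(C) by rewrite memJ_norm.
  rewrite -tg_gen gen_subG; apply/subsetP => z zD; rewrite inE.
  apply/subsetP => _ /imsetP[w wC ->].
  case wz: (adj w z); last by rewrite nadjJ ?wz.
  move: wC; rewrite inE => /andP[wD wC].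
  have vD : w ^ z \in D by rewrite (tsetJ tD).
  have wv : adj (w ^ z) w by apply: (adj_third tD).
  rewrite inE vD /=; case/or3P: wC => [/eqP e|wx|/exists_inP[f fD /andP[fx fw]]].
  - by rewrite -e wv orbT.
  - by apply/or3P/Or33/exists_inP; exists w; rewrite // wx adjC wv.
  apply/or3P; case vx: (adj (w ^ z) x); first exact: Or32.
  apply: Or33; case wx: (adj w x).
    by apply/exists_inP; exists w; rewrite // wx adjC wv.
  case fv: (adj f (w ^ z)).
    by apply/exists_inP; exists f; rewrite // fx fv.
  apply/exists_inP; exists (f ^ w); first by rewrite (tsetJ tD).
  rewrite adj_fixl; last by rewrite adjC wx.
  rewrite fx (tset_braid tD) // adj_fixl; first by rewrite adjC wv.
  by rewrite adjC fv.
rewrite inE => /andP[_ /or3P[/eqP e|yx|/exists_inP[f fD /andP[fx fy]]]].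
- by rewrite e eqxx in xy.
- by rewrite adjC yx in nxy.
by exists f.
Qed.

Lemma tg_regular : {in D &, forall x y, #|nbrs D x| = #|nbrs D y|}.
Proof.
move=> x y xD yD; have [g gG ->] := tg_conj xD yD.
have gN : g \in 'N(D) by apply: (subsetP (tset_norm tg_tset)); rewrite tg_gen.
rewrite -(cardJg (nbrs D x) g); apply: eq_card => z.
by rewrite -[z](conjgKV g) memJ_conjg !inE (memJ_norm _ gN) adjJ.
Qed.

Lemma tg_diagram x y : x \in D -> y \in D -> diagram X x y = adj x y.
Proof.
move=> xD yD; have tD := tg_tset; rewrite /diagram /=.
apply/idP/idP => [/eqP o|ad].
  apply: (@contraT (adj x y)) => n; have c := nadj_commute n.
  have : #[x * y] %| 2.
    by rewrite order_dvdn expgMn // !expgS !expg0 !mulg1 (tg_mulgg xD) (tg_mulgg yD) mul1g.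
  by rewrite o.
apply/eqP; apply: nt_prime_order => //.
  by rewrite !expgS expg0 mulg1 !mulgA (tset_order3 tD).
apply: contraTneq ad => e; rewrite -(mulgK y x) e mul1g (tset_inv tD) //.
by rewrite adjxx.
Qed.

End TgroupFacts.

Lemma tset_tgroup (gT : finGroupType) (D : {set gT}) d0 :
  tset D -> joined D -> d0 \in D -> 1 \notin D ->
  is_3transposition_group <<D>>%G D.
Proof.
move=> tD jD dD n1; split=> //.
- apply/imsetP; exists d0; first exact: mem_gen.
  apply/setP => y; apply/idP/imsetP => [yD|[g gG ->]]; last first.
    by rewrite memJ_norm // (subsetP (tset_norm tD)).
  have st x z : x \in D -> z \in D -> adj x z -> exists2 g, g \in <<D>> & z = x ^ g.
    move=> xD zD ad; exists (x ^ z); last by rewrite (tset_third tD).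
    by apply: mem_gen; rewrite (tsetJ tD).
  case: (eqVneq d0 y) => [<-|dy]; first by exists 1; rewrite ?group1 ?conjg1.
  case ad: (adj d0 y); first exact: st.
  have [f [fD fd fy]] := jD _ _ dD yD dy ad.
  have [|g gG ef] := st _ _ dD fD; first by rewrite adjC.
  have [h hG ey] := st _ _ fD yD fy.
  by exists (g * h); rewrite ?groupM // conjgM -ef.
- move=> d dD'; apply: nt_prime_order => //; first by rewrite !expgS expg0 mulg1 (tset_mulgg tD).
  by apply: contraNneq n1 => <-.
move=> d e dD' eD; case ad: (adj d e).
  have : #[d * e] %| 3 by rewrite order_dvdn !expgS expg0 mulg1 !mulgA (tset_order3 tD).
  by rewrite (dvdn_divisors) // !inE => /orP[]/eqP ->.
have c : commute d e by apply: nadj_commute; rewrite ad.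
have : #[d * e] %| 2.
  by rewrite order_dvdn expgMn // !expgS !expg0 !mulg1 (tset_mulgg tD dD') (tset_mulgg tD eD) mul1g.
by rewrite (dvdn_divisors) // !inE => /orP[]/eqP ->.
Qed.

(** * Conjugation operations and central types *)

Section QuandleIso.

Definition qiso (gT hT : finGroupType) (D : {set gT}) (D' : {set hT}) :=
  exists phi : gT -> hT, [/\ {in D &, injective phi}, phi @: D = D'
    & {in D &, {morph phi : x y / x ^ y}}].

Lemma qiso_refl (gT : finGroupType) (D : {set gT}) : qiso D D.
Proof. by exists id; split=> //; rewrite imset_id. Qed.

Lemma qiso_sym (gT hT : finGroupType) (D : {set gT}) (D' : {set hT}) :
  {in D &, forall x y, x ^ y \in D} -> qiso D D' -> qiso D' D.
Proof.
move=> cD [phi [inj im mor]].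
pose psi y := odflt 1 [pick x in D | phi x == y].
have psiP y : y \in D' -> psi y \in D /\ phi (psi y) = y.
  rewrite -im => /imsetP[x xD ->]; rewrite /psi; case: pickP => [z /andP[zD /eqP]//|/(_ x)].
  by rewrite xD eqxx.
have phiD x : x \in D -> phi x \in D' by move=> xD; rewrite -im imset_f.
have phiK x : x \in D -> psi (phi x) = x.
  by move=> xD; have [h1 h2] := psiP _ (phiD _ xD); apply: inj.
exists psi; split.
- by move=> y z /psiP[_ {2}<-] /psiP[_ {2}<-] ->.
- apply/setP => x; apply/imsetP/idP => [[y /psiP[h _] ->]//|xD].
  by exists (phi x); rewrite ?phiK ?phiD.
move=> y z yD zD; have [[yD' ey] [zD' ez]] := (psiP _ yD, psiP _ zD).
by rewrite -{1}ey -{1}ez -mor // phiK ?cD.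
Qed.

Lemma qiso_trans (gT hT kT : finGroupType) (D : {set gT}) (E : {set hT}) (F : {set kT}) :
  qiso D E -> qiso E F -> qiso D F.
Proof.
move=> [f [fi fE fm]] [g [gi gE gm]]; exists (g \o f).
have fD x : x \in D -> f x \in E by move=> xD; rewrite -fE imset_f.
split.
- by move=> x y xD yD /gi h; apply: fi => //; apply: h; rewrite fD.
- by rewrite imset_comp fE gE.
- by move=> x y xD yD; rewrite /= fm // gm // fD.
Qed.

Lemma qiso_adj (gT hT : finGroupType) (D : {set gT}) (phi : gT -> hT) :
  {in D &, forall x y, x ^ y \in D} -> {in D &, injective phi} ->
  {in D &, {morph phi : x y / x ^ y}} ->
  {in D &, forall x y, adj (phi x) (phi y) = adj x y}.
Proof.
move=> cD inj mor x y xD yD; rewrite /adj -mor //; congr (~~ _).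
by apply/eqP/eqP => [/inj->|->]; rewrite ?cD.
Qed.

End QuandleIso.

(** Two vertices with the same image in the central quotient act alike on [D], so they commute. If
    they differed, a common neighbour [f] would recover both from [f ^ d = f ^ e] as the same third
    point. *)
Lemma tg_coset_inj (X : tgroup) : {in tg_class X &, injective (coset 'Z(tg_group X))}.
Proof.
move=> d e dD eD; have tD := tg_tset X; set Z := 'Z(_) => h.
have NZ : {subset tg_class X <= 'N(Z)}.
  by move=> x /(subsetP (tg_sub X)); apply: (subsetP (normal_norm (center_normal _))).
have [z zZ ee] : exists2 z, z \in Z & d = z * e.
  by have /rcoset_kercosetP := h; move/(_ (NZ _ dD) (NZ _ eD)) => /rcosetP[z zZ ->]; exists z.
have zc f : f \in tg_class X -> f ^ z = f.
  move=> fD; apply/conjg_fixP/commgP; case/setIP: zZ => _ /centP; move/(_ f).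
  by rewrite (subsetP (tg_sub X)) // => /(_ isT).
have same f : f \in tg_class X -> f ^ d = f ^ e by move=> fD; rewrite ee conjgM zc.
apply/eqP; apply: (@contraT (d == e)) => de.
have nde : adj d e = false.
  by rewrite /adj -same // [_ ^ _](nadjJ (negbT (adjxx d))) eqxx.
have [f [fD fd fe]] := tg_joined dD eD de nde.
by case/eqP: de; rewrite -(tset_third tD fD dD fd) -(tset_third tD fD eD fe) same.
Qed.

Lemma same_central_qiso X Y : same_central_type X Y -> qiso (tg_class X) (tg_class Y).
Proof.
case=> f [isof fD]; have injf : 'injm f by case/isomP: isof.
set ZX := 'Z(tg_group X) in f isof fD injf *; set ZY := 'Z(tg_group Y) in f isof fD injf *.
have NX : {subset tg_group X <= 'N(ZX)} by apply/subsetP/normal_norm/center_normal.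
have NY : {subset tg_group Y <= 'N(ZY)} by apply/subsetP/normal_norm/center_normal.
have sX := subsetP (tg_sub X); have sY := subsetP (tg_sub Y).
have cX x : x \in tg_group X -> coset ZX x \in tg_group X / ZX.
  by move=> xG; apply: mem_quotient.
have Q x : x \in tg_class X -> exists2 y, y \in tg_class Y & f (coset ZX x) = coset ZY y.
  move=> xD; have : f (coset ZX x) \in f @* (tg_class X / ZX).
    apply: mem_morphim; first by apply/cX/sX.
    by apply: mem_morphim => //; apply/NX/sX.
  by rewrite fD => /morphimP[y _ yD ->]; exists y.
pose phi x := odflt 1 [pick y in tg_class Y | f (coset ZX x) == coset ZY y].
have phiP x : x \in tg_class X -> phi x \in tg_class Y /\ f (coset ZX x) = coset ZY (phi x).
  move=> xD; rewrite /phi; case: pickP => [y /andP[yD /eqP]//|h].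
  by have [y yD e] := Q _ xD; have := h y; rewrite yD e eqxx.
exists phi; split.
- move=> x y xD yD e; have [_ ex] := phiP _ xD; have [_ ey] := phiP _ yD.
  apply: (tg_coset_inj xD yD); apply: (injmP injf); rewrite ?cX ?sX //.
  by rewrite ex ey e.
- apply/setP => y; apply/imsetP/idP => [[x /phiP[h _] ->]//|yD].
  have : coset ZY y \in f @* (tg_class X / ZX) by rewrite fD; apply: mem_morphim => //; apply/NY/sY.
  move=> /morphimP[c _ /morphimP[x _ xD ->] e]; exists x => //.
  by have [h e'] := phiP _ xD; apply: (tg_coset_inj yD h); apply: etrans e'.
move=> x y xD yD; have [[hx ex] [hy ey]] := (phiP _ xD, phiP _ yD).
have xyD : x ^ y \in tg_class X by rewrite (tsetJ (tg_tset X)).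
have [hxy exy] := phiP _ xyD.
apply: (tg_coset_inj hxy); first by rewrite (tsetJ (tg_tset Y)).
apply: etrans (esym exy) _; rewrite morphJ ?NX ?sX // morphJ ?cX ?sX //.
by rewrite ex ey -morphJ ?NY ?sY.
Qed.

Lemma tg_centerP (X : tgroup) g : g \in tg_group X ->
  reflect {in tg_class X, forall x, x ^ g = x} (g \in 'Z(tg_group X)).
Proof.
move=> gG; rewrite inE gG -tg_gen cent_gen; apply: (iffP centP) => h x xD.
  exact/conjg_fixP/commgP/esym/h.
exact/commgP/commgP/esym/commgP/conjg_fixP/h.
Qed.

Section CentralType.

Variables (X Y : tgroup) (phi : tg_sort X -> tg_sort Y).
Notation D := (tg_class X).
Notation D' := (tg_class Y).
Hypotheses (inj : {in D &, injective phi}) (im : phi @: D = D')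
  (mor : {in D &, {morph phi : x y / x ^ y}}).

Let phiD x : x \in D -> phi x \in D'. Proof. by move=> xD; rewrite -im imset_f. Qed.
Let DJ x g : x \in D -> g \in tg_group X -> x ^ g \in D.
Proof. by rewrite -tg_gen => xD gG; rewrite memJ_norm ?(subsetP (tset_norm (tg_tset X))). Qed.

(* The subgroup of the product generated by the graph of phi projects onto
   both groups, and the two projections have the same centre-valued elements:
   these are the ones acting trivially on D, respectively on D'. *)
Let K := <<[set (x, phi x) | x in D]>>.

Let compat := [set k : tg_sort X * tg_sort Y | [&& k.1 \in tg_group X, k.2 \in tg_group Y
  & [forall x in D, phi (x ^ k.1) == phi x ^ k.2]]].

Let compatP k : reflect [/\ k.1 \in tg_group X, k.2 \in tg_group Y
  & {in D, forall x, phi (x ^ k.1) = phi x ^ k.2}] (k \in compat).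
Proof.
rewrite inE; apply: (iffP and3P) => [[h1 h2 /forall_inP h]|[h1 h2 h]]; split=> //.
  by move=> x /h/eqP.
by apply/forall_inP => x xD; rewrite h.
Qed.

Let compat_group : group_set compat.
Proof.
apply/group_setP; split.
  by apply/compatP; split; rewrite ?group1 // => x xD; rewrite !conjg1.
move=> k l /compatP[k1 k2 hk] /compatP[l1 l2 hl]; apply/compatP; split.
- by rewrite /= groupM.
- by rewrite /= groupM.
by move=> x xD; rewrite /= !conjgM hl ?DJ // hk.
Qed.

Let KP k : k \in K -> [/\ k.1 \in tg_group X, k.2 \in tg_group Y
  & {in D, forall x, phi (x ^ k.1) = phi x ^ k.2}].
Proof.
move=> kK; apply/compatP; move: k kK; apply/subsetP.
rewrite -[compat]/(gval (Group compat_group)) gen_subG; apply/subsetP => _ /imsetP[x xD ->].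
apply/compatP; split=> [||y yD] /=; try exact: mor.
  exact: (subsetP (tg_sub X)).
by apply: (subsetP (tg_sub Y)); exact: phiD.
Qed.

Let K1 g : g \in tg_group X -> exists2 k, k \in K & k.1 = g.
Proof.
move=> gG; have : g \in fst @* <<[set (x, phi x) | x in D]>>%G.
  move: g gG; apply/subsetP; rewrite -tg_gen gen_subG; apply/subsetP => x xD.
  apply/morphimP; exists (x, phi x); rewrite ?inE //.
  by apply: mem_gen; apply/imsetP; exists x.
by case/morphimP => k _ kK ->; exists k.
Qed.

Let K2 g : g \in tg_group Y -> exists2 k, k \in K & k.2 = g.
Proof.
move=> gG; have : g \in snd @* <<[set (x, phi x) | x in D]>>%G.
  move: g gG; apply/subsetP; rewrite -tg_gen gen_subG -im.
  apply/subsetP => _ /imsetP[x xD ->].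
  apply/morphimP; exists (x, phi x); rewrite ?inE //.
  by apply: mem_gen; apply/imsetP; exists x.
by case/morphimP => k _ kK ->; exists k.
Qed.

Let KZ k : k \in K -> (k.1 \in 'Z(tg_group X)) = (k.2 \in 'Z(tg_group Y)).
Proof.
move=> /KP[k1 k2 hk]; apply/(tg_centerP k1)/(tg_centerP k2) => h x xD.
  by move: xD; rewrite -im => /imsetP[y yD ->]; rewrite -hk // h.
by apply: inj; rewrite ?DJ // hk // h // phiD.
Qed.

Lemma qiso_same_central : same_central_type X Y.
Proof.
set ZX := 'Z(tg_group X); set ZY := 'Z(tg_group Y).
have NX : {subset tg_group X <= 'N(ZX)} by apply/subsetP/normal_norm/center_normal.
have NY : {subset tg_group Y <= 'N(ZY)} by apply/subsetP/normal_norm/center_normal.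
(* A coset is lifted to [K] and projected to the other factor; [cosK] makes the result independent
   of the lift, and 1 is only a default outside the quotient. *)
pose F (c : coset_of ZX) : coset_of ZY :=
  odflt 1 (omap (fun k => coset ZY k.2) [pick k in K | coset ZX k.1 == c]).
have cosX x y : x \in tg_group X -> y \in tg_group X ->
    (coset ZX x == coset ZX y) = (x * y^-1 \in ZX).
  by move=> xG yG; apply/eqP/idP => h;
    [rewrite -mem_rcoset; apply/(rcoset_kercosetP (NX _ xG) (NX _ yG))
    | apply/(rcoset_kercosetP (NX _ xG) (NX _ yG)); rewrite mem_rcoset].
have cosY x y : x \in tg_group Y -> y \in tg_group Y ->
    (coset ZY x == coset ZY y) = (x * y^-1 \in ZY).
  by move=> xG yG; apply/eqP/idP => h;
    [rewrite -mem_rcoset; apply/(rcoset_kercosetP (NY _ xG) (NY _ yG))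
    | apply/(rcoset_kercosetP (NY _ xG) (NY _ yG)); rewrite mem_rcoset].
have cosK k l : k \in K -> l \in K ->
    (coset ZX k.1 == coset ZX l.1) = (coset ZY k.2 == coset ZY l.2).
  move=> kK lK; have [[k1 k2 _] [l1 l2 _]] := (KP kK, KP lK).
  by rewrite cosX // cosY // -(@KZ (k * l^-1)) // groupM // groupV.
have FE k : k \in K -> F (coset ZX k.1) = coset ZY k.2.
  move=> kK; rewrite /F; case: pickP => [l /andP[lK]|/(_ k)]; last by rewrite kK eqxx.
  by rewrite cosK //= => /eqP.
have lift c : c \in tg_group X / ZX -> exists2 k, k \in K & c = coset ZX k.1.
  by move=> /morphimP[g _ gG ->]; have [k kK <-] := K1 gG; exists k.
have FM : {in tg_group X / ZX &, {morph F : c d / c * d}}.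
  move=> _ _ /lift[k kK ->] /lift[l lK ->].
  have [[k1 k2 _] [l1 l2 _]] := (KP kK, KP lK).
  rewrite -morphM ?NX // -[k.1 * l.1]/((k * l).1) !FE ?groupM //.
  by rewrite morphM ?NY.
exists (Morphism FM); split.
  apply/isomP; split.
    apply/injmP => _ _ /lift[k kK ->] /lift[l lK ->] /= e.
    by apply/eqP; rewrite cosK // -!FE // e.
  apply/setP => d; apply/morphimP/idP => [[c _ /lift[k kK ->] ->]|].
    by rewrite /= FE //; have [_ k2 _] := KP kK; apply: mem_quotient.
  case/morphimP => g _ gG ->; have [k kK <-] := K2 gG; have [k1 _ _] := KP kK.
  by exists (coset ZX k.1); rewrite /= ?FE // mem_quotient.
have FD x : x \in D -> F (coset ZX x) = coset ZY (phi x).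
  by move=> xD; apply: (FE (x, phi x)); apply: mem_gen; apply/imsetP; exists x.
have sX := subsetP (tg_sub X); have sY := subsetP (tg_sub Y).
apply/setP => d; apply/morphimP/morphimP => [[c _ /morphimP[x xN xD ->] ->]|[y yN yD ->]].
  by exists (phi x); rewrite ?phiD ?NY ?sY ?phiD //= FD.
move: yD; rewrite -im => /imsetP[x xD ->].
have xG := sX _ xD.
exists (coset ZX x); rewrite ?mem_quotient //= ?FD //.
by apply: mem_morphim => //; exact: NX.
Qed.

End CentralType.

Lemma same_centralP X Y : same_central_type X Y <-> qiso (tg_class X) (tg_class Y).
Proof.
split; first exact: same_central_qiso.
by case=> phi [inj im mor]; exact: qiso_same_central inj im mor.
Qed.

Section Spectrum.

(** * The minimum eigenvalue *)

Local Open Scope ring_scope.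

Section HermitianForm.

Import mathcomp.algebra.spectral.
Local Open Scope sesquilinear_scope.
Variables (n : nat) (A : 'M[algC]_n).
Hypothesis hermA : A ^t* = A.

Let P := spectralmx A.
Let sp := spectral_diag A.

Let PV : invmx P = P ^t*.
Proof. by rewrite invmx_unitary ?spectral_unitarymx. Qed.

Let specA : A = invmx P *m diag_mx sp *m P.
Proof. by apply/orthomx_spectralP/normalmxP; rewrite hermA. Qed.

Lemma spectral_eigenvalue i : eigenvalue A (sp 0 i).
Proof.
apply/eigenvalueP; exists (row i P).
  rewrite -row_mul {1}specA !mulmxA mulmxV ?spectral_unit // mul1mx.
  by rewrite row_mul row_diag_mx -scalemxAl -rowE.
have /row_freeP[Q QP] : row_free P by rewrite row_free_unit spectral_unit.
apply: (@contra_eq_neq _ _ _ _ (row i (P *m Q)) (row i 1%:M)); last by rewrite QP.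
move=> r0; rewrite row_mul r0 mul0mx; apply/eqP => /rowP/(_ i).
by rewrite !mxE eqxx => /eqP; rewrite eq_sym oner_eq0.
Qed.

Lemma spectral_real i : sp 0 i \is Num.real.
Proof.
apply: (mxOverP (hermitian_spectral_diag_real _)).
by apply/is_hermitianmxP; rewrite expr0 scale1r hermA.
Qed.

Lemma hermitian_min_eigenvalue : (0 < n)%N ->
  exists2 r, eigenvalue A r & forall i, r <= sp 0 i.
Proof.
move=> n0.
suff [i hi] : exists i, forall j, j \in enum 'I_n -> sp 0 i <= sp 0 j.
  by exists (sp 0 i) => [|j]; [exact: spectral_eigenvalue | apply: hi; rewrite mem_enum].
elim: (enum _) => [|k s [i hi]]; first by exists (Ordinal n0).
have := real_leVge (spectral_real i) (spectral_real k); case/orP => ik.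
  by exists i => j; rewrite inE => /predU1P[->//|/hi].
exists k => j; rewrite inE => /predU1P[->//|/hi]; exact: le_trans.
Qed.

Lemma hermitian_formE (v : 'rV_n) (t : algC) : let w := v *m P ^t* in
  (v *m A *m v ^t*) 0 0 + t * (v *m v ^t*) 0 0 = \sum_i (sp 0 i + t) * (w 0 i * (w 0 i)^*).
Proof.
move=> w; have vE : v = w *m P by rewrite /w -PV mulmxKV ?spectral_unit.
have vsE : v ^t* = P ^t* *m w ^t* by rewrite {1}vE trmx_mul map_mxM.
have e1 : v *m A *m v ^t* = w *m diag_mx sp *m w ^t*.
  rewrite vsE {1}vE {1}specA !mulmxA -PV mulmxK ?spectral_unit //.
  by rewrite mulmxK ?spectral_unit.
have e2 : v *m v ^t* = w *m w ^t*.
  by rewrite vsE {1}vE mulmxA -PV mulmxK ?spectral_unit.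
rewrite e1 e2 !mxE mulr_sumr -big_split; apply: eq_bigr => i _ /=.
by rewrite mul_mx_diag !mxE; ring.
Qed.

Lemma hermitian_min_form (t : algC) :
  (forall a, eigenvalue A a -> - t <= a) <->
  forall v : 'rV_n, 0 <= (v *m A *m v ^t*) 0 0 + t * (v *m v ^t*) 0 0.
Proof.
split=> [h v|h a /eigenvalueP[v vA v0]].
  rewrite hermitian_formE; apply: sumr_ge0 => i _; apply: mulr_ge0; last exact: mul_conjC_ge0.
  by rewrite -lerBlDr sub0r; apply/h/spectral_eigenvalue.
have := h v; rewrite vA -scalemxAl mxE -mulrDl.
have vv : 0 < (v *m v ^t*) 0 0.
  rewrite mxE lt_neqAle sumr_ge0 ?andbT; last by move=> i _; rewrite !mxE mul_conjC_ge0.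
  rewrite eq_sym; apply: contraNneq v0 => /eqP.
  rewrite psumr_eq0 => [/allP z|i _]; last by rewrite !mxE mul_conjC_ge0.
  apply/eqP/rowP => i; have := z i; rewrite mem_index_enum => /(_ isT).
  by rewrite !mxE mul_conjC_eq0 => /eqP.
by rewrite pmulr_lge0 // -lerBlDr sub0r.
Qed.

End HermitianForm.

(** The complex version is the one equivalent to the bound on the spectrum. It is also invariant
    under [qiso], and [psd] is its restriction to integer vectors. *)
Definition cpsd (gT : finGroupType) (D : {set gT}) (t : nat) := forall v : gT -> algC,
  0 <= \sum_(x in D) \sum_(y in D) v x * (v y)^* * (adj x y)%:R
       + t%:R * \sum_(x in D) v x * (v x)^*.

Lemma cpsd_psd (gT : finGroupType) (D : {set gT}) t : cpsd D t -> psd D t.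
Proof.
move=> h v; have := h (fun x => (v x)%:~R).
rewrite -(ler_int algC) rmorph0 rmorphD rmorphM /= !rmorph_sum /= rmorph_nat.
congr (_ <= _ + _ * _).
  apply: eq_bigr => x _; rewrite rmorph_sum; apply: eq_bigr => y _ /=.
  by rewrite !rmorphM /= rmorph_int rmorph_nat.
by apply: eq_bigr => x _; rewrite rmorph_int expr2 rmorphM.
Qed.

Lemma cpsd_qiso (gT hT : finGroupType) (D : {set gT}) (D' : {set hT}) t :
  {in D &, forall x y, (x ^ y)%g \in D} -> qiso D D' -> cpsd D t -> cpsd D' t.
Proof.
move=> cD [phi [inj im mor]] h v; have := h (v \o phi).
rewrite -im !big_imset //=; congr (_ <= _ + _); apply: eq_bigr => x xD.
rewrite big_imset //=; apply: eq_bigr => y yD.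
by rewrite (qiso_adj cD inj mor).
Qed.

Section Bridge.

Variable X : tgroup.
Notation D := (tg_class X).

Let hermD : ((diagram_mx X)^T ^ (@Num.conj algC))%sesqui = diagram_mx X.
Proof.
apply/matrixP => i j; rewrite !mxE rmorph_nat.
by rewrite !tg_diagram ?enum_valP // adjC.
Qed.

Lemma cpsd_mx t : cpsd D t <-> forall v : 'rV_#|D|,
  0 <= (v *m diagram_mx X *m (v^T ^ (@Num.conj algC))%sesqui) 0 0
       + t%:R * (v *m (v^T ^ (@Num.conj algC))%sesqui) 0 0.
Proof.
have E (v : tg_sort X -> algC) (r : 'rV_#|D|) : (forall i, r 0 i = v (enum_val i)) ->
    \sum_(x in D) \sum_(y in D) v x * (v y)^* * (adj x y)%:R
       + t%:R * \sum_(x in D) v x * (v x)^* =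
    (r *m diagram_mx X *m (r^T ^ (@Num.conj algC))%sesqui) 0 0
       + t%:R * (r *m (r^T ^ (@Num.conj algC))%sesqui) 0 0.
  move=> rE; rewrite !mxE; congr (_ + _ * _); last first.
    by rewrite big_enum_val; apply: eq_bigr => i _; rewrite !mxE rE.
  rewrite big_enum_val exchange_big big_enum_val; apply: eq_bigr => j _ /=.
  rewrite !mxE mulr_suml; apply: eq_bigr => i _.
  by rewrite !mxE !rE tg_diagram ?enum_valP //; ring.
split=> h v.
  pose u x := oapp (fun i => v 0 i) 0 [pick i : 'I_#|D| | enum_val i == x].
  rewrite -(E u); first exact: h.
  move=> i; rewrite /u; case: pickP => [j /eqP/enum_val_inj ->//|/(_ i)].
  by rewrite eqxx.
by rewrite (E v (\row_i v (enum_val i))); [exact: h | move=> i; rewrite mxE].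
Qed.

Lemma rho_min_cpsd (t : nat) :
  (exists2 r : algC, is_rho_min X r & - t%:R <= r) <-> cpsd D t.
Proof.
have [d dD] := tg_neq0 X.
have n0 : (0 < #|D|)%N by apply/card_gt0P; exists d.
split=> [[r [_ rmin] tr]|h].
  apply/cpsd_mx/(hermitian_min_form hermD) => a /rmin; exact: le_trans.
have h' := (hermitian_min_form hermD t%:R).2 ((cpsd_mx t).1 h).
have [r er rmin] := hermitian_min_eigenvalue hermD n0.
exists r; last exact: h'.
(* That [r] bounds every eigenvalue, and not only the diagonal entries, is [hermitian_min_form] with
   [- r] in place of [t]. *)
split=> // a ea; rewrite -[r]opprK.
by apply: ((hermitian_min_form hermD (- r)).2 _ _ ea) => v; rewrite hermitian_formE //;
  apply: sumr_ge0 => i _; rewrite mulr_ge0 ?mul_conjC_ge0 // subr_ge0.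
Qed.

End Bridge.

End Spectrum.

Definition complete (gT : finGroupType) (D : {set gT}) := {in D &, forall x y, x != y -> adj x y}.

Lemma complete_qiso (gT hT : finGroupType) (D : {set gT}) (D' : {set hT}) :
  {in D &, forall x y, x ^ y \in D} -> qiso D D' -> complete D -> complete D'.
Proof.
move=> cD [phi [inj im mor]] h; rewrite -im => _ _ /imsetP[x xD ->] /imsetP[y yD ->] n.
by rewrite (qiso_adj cD inj mor) // h //; apply: contraNneq n => ->.
Qed.

Lemma moufang_typeE (X : tgroup) : moufang_type X <-> complete (tg_class X).
Proof.
by split=> h x y xD yD xy; have := h x y xD yD xy; rewrite tg_diagram.
Qed.

Lemma complete_moufang (X : tgroup) : complete (tg_class X) -> moufang_3u2 X.
Proof.
move=> cX; split; first exact/moufang_typeE.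
have [d dD] := tg_neq0 X; have tD := tg_tset X; have dG := subsetP (tg_sub X) _ dD.
set N := 'O_3(tg_group X).
have pN : 3.-group N by exact: pcore_pgroup.
have inN e : e \in tg_class X -> d * e \in N.
  move=> eD; apply: (moufang_pcore tD) => // [x y xD yD||x g xD gG].
  - case: (eqVneq x y) => [->|xy]; first by rewrite (tset_mulgg tD) ?expg1n.
    by rewrite !expgS expg0 mulg1 !mulgA (tset_order3 tD) // cX.
  - exact: tg_sub.
  - by rewrite memJ_norm // (subsetP (tset_norm tD)) // tg_gen.
have [u uE] := p_natP pN.
exists u, [group of N], d; split=> //.
have nN : <[d]> \subset 'N(N) by rewrite cycle_subG (subsetP (normal_norm (pcore_normal _ _))).
rewrite sdprodE //.
- apply/eqP; rewrite eqEsubset mul_subG ?pcore_sub ?cycle_subG //=.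
  rewrite -norm_joinEr // -{1}tg_gen gen_subG; apply/subsetP => e eD.
  rewrite -[e](tset_mulKV tD _ dD) groupM //.
    by rewrite mem_gen // inE cycle_id orbT.
  by rewrite mem_gen // inE inN.
apply: coprime_TIg; have od : #[d] = 2 by case: (tg_axiom X) => _ _ h _; exact: h.
by rewrite -orderE od /= uE coprimeXl.
Qed.

Lemma central_moufangE (X : tgroup) :
  in_central_types moufang_3u2 X <-> complete (tg_class X).
Proof.
split=> [[Y [/moufang_typeE cY _] /same_centralP q]|cX].
  apply: complete_qiso cY; last apply: qiso_sym q.
  - by case: (tg_tset Y).
  - by case: (tg_tset X).
by exists X; [exact: complete_moufang | apply/same_centralP/qiso_refl].
Qed.

Section RhoMin.

Variable X : tgroup.
Notation D := (tg_class X).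
Local Open Scope ring_scope.

Lemma psd1_complete : psd D 1 -> complete D.
Proof.
move=> pD x y xD yD xy; apply: (@contraT (adj x y)) => n.
have [f [fD fx fy]] := tg_joined xD yD xy (negbTE n).
have fx' := adj_neq fx; have fy' := adj_neq fy.
(* On this path of length 2 the vector takes the value [- 4 + 3 = - 1]. *)
have := psd_seq pD (l := [:: (f, -1); (x, 1); (y, 1)]).
rewrite /= !inE !negb_or fx' fy' xy => /(_ isT).
rewrite !big_cons !big_nil /= !adjxx fx fy (adjC x f) (adjC y f) fx fy (negPf n).
rewrite (adjC y x) (negPf n) => h.
suff : 0 <= (-1 : int) by [].
apply: le_trans (h _) _ => //.
by move=> z; rewrite !inE => /or3P[] /eqP ->.
Qed.

(** The adjacency matrix is the all-one matrix minus the identity, and the form of the former is the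
    squared modulus of the sum of the entries. *)
Lemma complete_cpsd : complete D -> forall t, (0 < t)%N -> cpsd D t.
Proof.
move=> cD t t0 v; pose S := \sum_(x in D) v x.
suff -> : \sum_(x in D) \sum_(y in D) v x * (v y)^* * (adj x y)%:R
    + t%:R * \sum_(x in D) v x * (v x)^*
    = S * S^* + (t.-1)%:R * \sum_(x in D) v x * (v x)^*.
  apply: addr_ge0; first exact: mul_conjC_ge0.
  by apply: mulr_ge0; rewrite ?ler0n // sumr_ge0 // => x _; exact: mul_conjC_ge0.
have -> : t%:R = 1 + t.-1%:R :> algC by rewrite -[1]/(1%:R) -natrD add1n prednK.
rewrite mulrDl mul1r addrA; congr (_ + _).
rewrite -big_split /S mulr_suml; apply: eq_bigr => x xD /=.
rewrite rmorph_sum mulr_sumr [RHS](bigD1 x) //= (bigD1 x) //= adjxx mulr0 add0r addrC.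
congr (_ + _); apply: eq_bigr => y /andP[yD yx].
by rewrite cD ?mulr1 // eq_sym.
Qed.

(** On a single vertex the only eigenvalue is 0, whence the condition on the size. On two or more,
    the difference of two unit vectors has eigenvalue [- 1]. *)
Lemma rho_min_N1 : is_rho_min X (-1) <-> complete D /\ (1 < #|D|)%N.
Proof.
split=> [h|[cD D1]].
  split.
    by apply/psd1_complete/cpsd_psd/rho_min_cpsd; exists (-1).
  rewrite ltnNge; apply/negP => D1; case: h => /eigenvalueP[v vA v0] _.
  case/eqP: v0; have -> : v = - (-1 *: v) by rewrite scaleN1r opprK.
  rewrite -vA.
  suff -> : diagram_mx X = 0 by rewrite mulmx0 oppr0.
  apply/matrixP => i j; rewrite !mxE tg_diagram ?enum_valP //.
  suff -> : enum_val i = enum_val j by rewrite adjxx.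
  by move/card_le1_eqP: D1; apply; rewrite enum_valP.
have [r [er rm] r1] := (rho_min_cpsd X 1).2 (complete_cpsd cD (isT : 0 < 1)%N).
suff e1 : eigenvalue (diagram_mx X) (-1).
  have -> : -1 = r by apply/eqP; rewrite eq_le r1 rm.
  by split.
pose i0 := Ordinal (ltnW D1); pose i1 := Ordinal D1.
have n01 : i0 != i1 by [].
apply/eigenvalueP; exists (delta_mx 0 i0 - delta_mx 0 i1); last first.
  apply/eqP => /rowP/(_ i0); rewrite !mxE /= subr0 => /eqP.
  by rewrite oner_eq0.
rewrite scaleN1r opprB mulmxBl -!rowE; apply/rowP => k; rewrite !mxE /=.
have E i : diagram X (enum_val i) (enum_val k) = (i != k).
  rewrite tg_diagram ?enum_valP //; case: (eqVneq i k) => [->|ik]; first exact: adjxx.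
  by rewrite cD ?enum_valP //; apply: contraNneq ik => /enum_val_inj ->.
rewrite !E [i0 == k]eq_sym [i1 == k]eq_sym.
case: (eqVneq k i0) => [->|_]; first by rewrite (negPf n01).
by case: (eqVneq k i1) => _; rewrite ?subrr ?subr0.
Qed.

End RhoMin.

(** * Point reflections of affine spaces over the field of three elements *)

Section Reflections.

Variable k : nat.
Local Open Scope ring_scope.
Let T := 'rV['F_3]_k.+1.

Let refl_inj (a : T) : injective (fun x => a - x).
Proof. by move=> x y /addrI/oppr_inj. Qed.

Let sg (a : T) : {perm T} := perm (@refl_inj a).

Let sgE a x : sg a x = a - x. Proof. by rewrite permE. Qed.

Let sg_inj : injective sg.
Proof. by move=> a b /permP/(_ 0); rewrite !sgE !subr0. Qed.

Let sg2 a : (sg a * sg a = 1)%g.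
Proof. by apply/permP => x; rewrite permM !sgE perm1 subKr. Qed.

Let sgJ a b : (sg a ^ sg b)%g = sg (b + b - a).
Proof.
rewrite conjgE; have -> : ((sg b)^-1 = sg b)%g by apply/eqP; rewrite eq_invg_mul sg2.
apply/permP => x; rewrite !permM !sgE; apply/rowP => i; rewrite !mxE; ring.
Qed.

Lemma char3 (a : T) : a + a + a = 0.
Proof.
apply/rowP => i; rewrite !mxE -mulr2n -mulrSr -mulr_natr.
by rewrite (_ : 3%:R = 0 :> 'F_3) ?mulr0 //; apply: val_inj.
Qed.

Let refls := [set sg a | a in [set: T]].

(** Conjugating the reflection in [a] by that in [b] gives [2 b - a], which in characteristic 3 is
    the symmetric expression [- a - b]: any two reflections braid. The number of vertices then
    separates the central types. *)
Lemma reflections : exists X : tgroup, moufang_3u2 X /\ #|tg_class X| = (3 ^ k.+1)%N.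
Proof.
have J3 a b : (sg a ^ sg b = sg b ^ sg a)%g.
  rewrite !sgJ; congr sg; apply/eqP; rewrite -subr_eq0.
  have -> : b + b - a - (a + a - b) = (b + b + b) - (a + a + a).
    by apply/rowP => i; rewrite !mxE; ring.
  by rewrite !char3 subrr.
have tD : tset refls.
  split=> [_ /imsetP[a _ ->]|_ _ /imsetP[a _ ->] /imsetP[b _ ->]|
    _ _ /imsetP[a _ ->] /imsetP[b _ ->] _]; [exact: sg2 | | exact: J3].
  by rewrite sgJ imset_f.
have cD : complete refls.
  move=> _ _ /imsetP[a _ ->] /imsetP[b _ ->]; rewrite /adj sgJ !(inj_eq sg_inj).
  apply: contraNneq => e; rewrite -subr_eq0; apply/eqP.
  have -> : a - b = (a - b + (a - b) + (a - b)) - (a - (b + b - a)).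
    by apply/rowP => i; rewrite !mxE; ring.
  by rewrite char3 e subrr subr0.
have n1 : 1%g \notin refls.
  apply/imsetP => -[a _] /permP h; have := h 0; have := h (const_mx 1).
  by rewrite !sgE !perm1 subr0 => h1 h0; move: h1; rewrite -h0 sub0r => /rowP/(_ ord0); rewrite !mxE.
have d0 : sg 0 \in refls by rewrite imset_f.
have jD : joined refls by move=> x y xD yD xy; rewrite cD.
exists (TGroup (tset_tgroup tD jD d0 n1)); split; first exact: complete_moufang.
by rewrite card_imset // cardsT card_mx mul1n card_Fp.
Qed.

End Reflections.

Lemma infinitely_many_moufang : infinitely_many_central_types moufang_3u2.
Proof.
pose Y k := proj1_sig (constructive_indefinite_description _ (reflections k)).
have YP k : moufang_3u2 (Y k) /\ #|tg_class (Y k)| = (3 ^ k.+1)%N.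
  by rewrite /Y; case: constructive_indefinite_description.
exists Y; split=> [k|k l kl /same_centralP[phi [inj im _]]]; first by have [] := YP k.
have [[_ ck] [_ cl]] := (YP k, YP l).
have : #|tg_class (Y k)| = #|tg_class (Y l)| by rewrite -im card_in_imset.
by rewrite ck cl => /eqP; rewrite eqn_exp2l // eqSS (negPf kl).
Qed.

(** * The groups with coordinates in a finite group *)

Section CoordsTheory.

Variables (gT A : finGroupType) (D : {set gT}) (m : nat) (w : 'I_m -> 'I_m -> A -> gT).
Hypotheses (cw : coords D w) (m3 : (3 <= m)%N).
Implicit Types (i j k l : 'I_m) (a b : A) (x y : gT).

Lemma coordsD i j a : i != j -> w i j a \in D.
Proof. by case: cw => [[h _ _ _ _] _]; exact: h. Qed.

Lemma coords_flip i j a : i != j -> w j i a = w i j a^-1.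
Proof. by case: cw => [[_ _ h _ _] _]; exact: h. Qed.

Lemma coords_chain i j k a b : i != j -> j != k -> i != k ->
  w i j a ^ w j k b = w i k (a * b).
Proof. by case: cw => [[_ _ _ h _] _]; exact: h. Qed.

Lemma coords_disjoint i j k l a b : uniq [:: i; j; k; l] -> w i j a ^ w k l b = w i j a.
Proof. by case: cw => [[_ _ _ _ h] _]; exact: h. Qed.

Lemma coords_eq i j k l a b : i != j -> k != l -> w i j a = w k l b ->
  i = k /\ j = l /\ a = b \/ i = l /\ j = k /\ a = b^-1.
Proof. by case: cw => [_ h]; exact: h. Qed.

Lemma coords_inj i j a b : i != j -> w i j a = w i j b -> a = b.
Proof. by move=> ij /(coords_eq ij ij)[[_ [_ h]]//|[e _]]; rewrite e eqxx in ij. Qed.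

Lemma coords_pick x : x \in D -> exists i j a, i != j /\ x = w i j a.
Proof. by case: cw => [[_ h _ _ _] _]; exact: h. Qed.

Lemma third_index i j : exists k, uniq [:: i; j; k] || (i == j).
Proof.
have [|k hk] := @exists_fresh m [:: i; j]; first exact: m3.
exists k; case: (eqVneq i j) => ij; rewrite ?orbT // orbF.
neq.
Qed.

(** The operation inside a fibre is forced by the other fibres: [w i j a] is written as
    [w i k a ^ w k j 1] through a third index, and both factors are moved by the chain rule. *)
Lemma coords_same i j a b : i != j -> w i j a ^ w i j b = w i j (b * a^-1 * b).
Proof.
move=> ij; have [k] := third_index i j; rewrite (negPf ij) orbF => u.
have [ik jk] : i != k /\ j != k by split; neq.
have [ji ki kj] : [/\ j != i, k != i & k != j] by split; rewrite eq_sym.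
have -> : w i j a = w i k a ^ w k j 1 by rewrite coords_chain ?mulg1.
rewrite conjJg (_ : w i k a ^ w i j b = w k j (a^-1 * b)); last first.
  by rewrite (coords_flip _ ki) coords_chain.
have -> : w k j 1 ^ w i j b = w k i b^-1.
  by rewrite (coords_flip _ ji) coords_chain // mul1g.
rewrite (coords_flip _ jk) coords_chain // (coords_flip _ ij) !invMg !invgK mulgA.
by [].
Qed.

(** Every check on pairs of vertices reduces to three relative positions; flipping coordinates
    brings a shared index to the middle. *)
Lemma coords_case x y : x \in D -> y \in D ->
  [\/ exists i j a b, [/\ i != j, x = w i j a & y = w i j b],
      exists i j k a b, [/\ uniq [:: i; j; k], x = w i j a & y = w j k b]
    | exists i j k l a b, [/\ uniq [:: i; j; k; l], x = w i j a & y = w k l b]].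
Proof.
move=> /coords_pick[i [j [a [ij ->]]]] /coords_pick[k [l [b [kl ->]]]].
have [ji lk] : j != i /\ l != k by split; rewrite eq_sym.
case: (eqVneq i k) => [eik|ik]; first subst.
  case: (eqVneq j l) => [ejl|jl]; first by subst; apply: Or31; exists k, l, a, b.
  apply: Or32; exists j, k, l, a^-1, b; split=> //; first by neq.
  by rewrite (coords_flip _ ij) invgK.
case: (eqVneq i l) => [eil|il]; first subst.
  case: (eqVneq j k) => [ejk|jk].
    by subst; apply: Or31; exists l, k, a, b^-1; split; rewrite // -coords_flip.
  apply: Or32; exists j, l, k, a^-1, b^-1; split; first by neq.
    by rewrite (coords_flip _ ij) invgK.
  by rewrite (coords_flip _ kl) invgK.
case: (eqVneq j k) => [ejk|jk]; first subst.
  by apply: Or32; exists i, k, l, a, b; split=> //; neq.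
case: (eqVneq j l) => [ejl|jl]; first subst.
  apply: Or32; exists i, l, k, a, b^-1; split=> //; first by neq.
  by rewrite (coords_flip _ kl) invgK.
by apply: Or33; exists i, j, k, l, a, b; split=> //; neq.
Qed.

Lemma coords_adj_same i j a b : i != j ->
  adj (w i j a) (w i j b) = (b * a^-1 * b != a).
Proof.
move=> ij; rewrite /adj coords_same //; congr (~~ _).
by apply/eqP/eqP => [/(coords_inj ij)|->].
Qed.

Lemma coords_adj_chain i j k a b : uniq [:: i; j; k] -> adj (w i j a) (w j k b).
Proof.
move=> u; have [ij jk ik] : [/\ i != j, j != k & i != k] by split; neq.
rewrite /adj coords_chain //; apply/eqP => /(coords_eq ik ij) [[_ [e _]]|[e _]].
  by rewrite e eqxx in jk.
by rewrite e eqxx in ij.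
Qed.

Lemma coords_adj_disjoint i j k l a b : uniq [:: i; j; k; l] ->
  adj (w i j a) (w k l b) = false.
Proof. by move=> u; rewrite /adj coords_disjoint // eqxx. Qed.

(** Only pairs inside one fibre restrict [A]: for [a] and [a * c] the braid relation, required when
    [c * c] is not 1, says that the cube of [c] is 1. *)
Lemma coords_tset : {in D, forall x, x * x = 1} ->
  (forall a, a * a = 1 \/ a * a * a = 1) -> tset D.
Proof.
move=> h2 hA; split=> //= [x y xD yD|x y xD yD].
  case: (coords_case xD yD) => [[i [j [a [b [ij -> ->]]]]]|[i [j [k [a [b [u -> ->]]]]]]|
    [i [j [k [l [a [b [u -> ->]]]]]]]].
  - by rewrite coords_same // coordsD.
  - by rewrite coords_chain ?coordsD //; neq.
  - by rewrite coords_disjoint // coordsD //; neq.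
case: (coords_case xD yD) => [[i [j [a [b [ij -> ->]]]]]|[i [j [k [a [b [u -> ->]]]]]]|
  [i [j [k [l [a [b [u -> ->]]]]]]]].
- rewrite coords_adj_same // !coords_same // => n; congr w.
  have [c eb] : exists c, b = a * c by exists (a^-1 * b); rewrite mulKVg.
  subst b; move: n; rewrite invMg -!mulgA mulKg mulVg mulg1; have [h|h] := hA c.
    by rewrite h mulg1 eqxx.
  by move=> _; congr (_ * _); apply: (mulIg c); rewrite h mulVg.
- move=> _; have [ij jk ik] : [/\ i != j, j != k & i != k] by split; neq.
  have [ji kj ki] : [/\ j != i, k != j & k != i] by split; rewrite eq_sym.
  rewrite coords_chain // (coords_flip _ kj) (coords_flip _ ji) coords_chain //.
  by rewrite (coords_flip _ ik) invMg !invgK.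
- by rewrite coords_adj_disjoint.
Qed.

Lemma coords_joined : joined D.
Proof.
move=> x y xD yD xy n.
case: (coords_case xD yD) => [[i [j [a [b [ij ex ey]]]]]|[i [j [k [a [b [u ex ey]]]]]]|
  [i [j [k [l [a [b [u ex ey]]]]]]]]; subst.
- have [k] := third_index i j; rewrite (negPf ij) orbF => u.
  exists (w j k 1); split; first by apply: coordsD; neq.
    by rewrite adjC coords_adj_chain.
  by rewrite adjC coords_adj_chain.
- by rewrite coords_adj_chain in n.
exists (w j k 1); split; first by apply: coordsD; neq.
  by rewrite adjC coords_adj_chain //; neq.
by rewrite coords_adj_chain //; neq.
Qed.

Lemma coords_order : tset D -> forall a, a * a = 1 \/ a * a * a = 1.
Proof.
move=> tD a; pose o : 'I_m := Ordinal (leq_trans (isT : 0 < 3)%N m3).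
pose p : 'I_m := Ordinal (leq_trans (isT : 1 < 3)%N m3).
have op : o != p by [].
case: (eqVneq (a * a) 1) => h; [by left|right].
have ad : adj (w o p 1) (w o p a) by rewrite coords_adj_same // invg1 mulg1.
have := tset_braid tD (coordsD _ op) (coordsD _ op) ad.
rewrite !coords_same // => /(coords_inj op); rewrite invg1 mulg1 mul1g mulg1 => ->.
by rewrite mulVg.
Qed.

End CoordsTheory.

Lemma coords_qiso (A gT hT : finGroupType) (D : {set gT}) (D' : {set hT}) m
    (w : 'I_m -> 'I_m -> A -> gT) (w' : 'I_m -> 'I_m -> A -> hT) :
  (3 <= m)%N -> coords D w -> coords D' w' -> qiso D D'.
Proof.
move=> m3 cw cw'.
pose phi x := odflt 1 (omap (fun p => w' p.1.1 p.1.2 p.2)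
  [pick p : ('I_m * 'I_m) * A | (p.1.1 != p.1.2) && (w p.1.1 p.1.2 p.2 == x)]).
have phiE i j a : i != j -> phi (w i j a) = w' i j a.
  move=> ij; rewrite /phi; case: pickP => [[[k l] b] /= /andP[kl /eqP]|/(_ ((i, j), a))].
    case/(coords_eq cw kl ij) => [[-> [-> ->]]//|[ek [el ->]]]; subst.
    by rewrite -(coords_flip cw').
  by rewrite /= ij eqxx.
exists phi; split.
- move=> x y /(coords_pick cw)[i [j [a [ij ->]]]] /(coords_pick cw)[k [l [b [kl ->]]]].
  rewrite !phiE // => /(coords_eq cw' ij kl)[[-> [-> ->]]//|[ei [ej ->]]]; subst.
  by rewrite -(coords_flip cw).
- apply/setP => y; apply/imsetP/idP => [[x /(coords_pick cw)[i [j [a [ij ->]]]] ->]|].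
    by rewrite phiE // coordsD.
  move=> /(coords_pick cw')[i [j [a [ij ->]]]]; exists (w i j a); rewrite ?phiE //.
  by rewrite (coordsD cw).
move=> x y xD yD.
case: (coords_case cw xD yD) => [[i [j [a [b [ij -> ->]]]]]|[i [j [k [a [b [u -> ->]]]]]]|
  [i [j [k [l [a [b [u -> ->]]]]]]]].
- by rewrite (coords_same cw) // !phiE // (coords_same cw').
- have [ij jk ik] : [/\ i != j, j != k & i != k] by split; neq.
  by rewrite (coords_chain cw) // !phiE // (coords_chain cw').
- have [ij kl] : i != j /\ k != l by split; neq.
  by rewrite (coords_disjoint cw) // !phiE // (coords_disjoint cw').
Qed.

(** * The transpositions of a wreath product *)

Section WreathTranspositions.

Variables (A : finGroupType) (m : nat).
Implicit Types (i j k l : 'I_m) (a b x : A).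
Notation T := (A * 'I_m)%type.

Definition wr_fun i j a (u : T) : T :=
  if u.2 == i then (u.1 * a, j) else if u.2 == j then (u.1 * a^-1, i) else u.

Lemma wr_fun_inj i j a : injective (wr_fun i j a).
Proof.
move=> [x k] [y l]; rewrite /wr_fun /=.
case: (eqVneq k i) => [->|ki]; case: (eqVneq l i) => [->|li].
- by case=> /mulIg ->.
- case: (eqVneq l j) => [el|lj]; last by case=> _ e; rewrite e eqxx in lj.
  by case=> _ ji; rewrite el ji eqxx in li.
- case: (eqVneq k j) => [ek|kj]; last by case=> _ e; rewrite e eqxx in kj.
  by case=> _ ji; rewrite ek -ji eqxx in ki.
case: (eqVneq k j) => [->|kj]; case: (eqVneq l j) => [->|lj] //.
- by case=> /mulIg ->.
- by case=> _ e; rewrite -e eqxx in li.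
- by case=> _ e; rewrite e eqxx in ki.
Qed.

Definition wr i j a : {perm T} := perm (@wr_fun_inj i j a).

Lemma wr_l i j a x : wr i j a (x, i) = (x * a, j).
Proof. by rewrite permE /wr_fun /= eqxx. Qed.

Lemma wr_r i j a x : i != j -> wr i j a (x, j) = (x * a^-1, i).
Proof. by move=> ij; rewrite permE /wr_fun /= eqxx eq_sym (negPf ij). Qed.

Lemma wr_o i j a x l : l != i -> l != j -> wr i j a (x, l) = (x, l).
Proof. by move=> li lj; rewrite permE /wr_fun /= (negPf li) (negPf lj). Qed.

Lemma wr_flip i j a : i != j -> wr j i a = wr i j a^-1.
Proof.
move=> ij; have ji : j != i by rewrite eq_sym.
apply/permP => -[x l]; case: (eqVneq l i) => [->|li]; first by rewrite wr_r // wr_l.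
case: (eqVneq l j) => [->|lj]; first by rewrite wr_l wr_r // invgK.
by rewrite !wr_o.
Qed.

Lemma wr2 i j a : i != j -> wr i j a * wr i j a = 1.
Proof.
move=> ij; apply/permP => -[x l]; rewrite permM perm1.
case: (eqVneq l i) => [->|li]; first by rewrite wr_l wr_r // mulgK.
case: (eqVneq l j) => [->|lj]; first by rewrite wr_r // wr_l mulgKV.
by rewrite !wr_o.
Qed.

Lemma conj_eq (gT : finGroupType) (s t u : gT) : s * t = t * u -> s ^ t = u.
Proof. by move=> e; rewrite conjgE e mulKg. Qed.

Definition wr_set := [set wr u.1.1 u.1.2 u.2 | u in [set u : ('I_m * 'I_m) * A | u.1.1 != u.1.2]].

Lemma wr_coords : coords wr_set wr.
Proof.
split; first split.
- by move=> i j a ij; apply/imsetP; exists ((i, j), a); rewrite ?inE.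
- move=> e /imsetP[[[i j] a]]; rewrite inE /= => ij ->.
  by exists i, j, a.
- by move=> *; exact: wr_flip.
- move=> i j k a b ij jk ik; apply: conj_eq.
  have [ji kj ki] : [/\ j != i, k != j & k != i] by split; rewrite eq_sym.
  apply/permP => -[x l]; rewrite !permM.
  case: (eqVneq l i) => [->|li].
    by rewrite wr_l [in RHS]wr_o // !wr_l mulgA.
  case: (eqVneq l j) => [->|lj].
    by rewrite wr_r // [in LHS]wr_o // wr_l wr_r // invMg mulgA mulgK.
  case: (eqVneq l k) => [->|lk].
    by rewrite wr_o // !wr_r // wr_o.
  by rewrite !wr_o.
- move=> i j k l a b u; apply: conj_eq.
  have [ij kl] : i != j /\ k != l by split; neq.
  have [ik il jk jl] : [/\ i != k, i != l, j != k & j != l] by split; neq.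
  have [ki li kj lj] : [/\ k != i, l != i, k != j & l != j] by split; rewrite eq_sym.
  apply/permP => -[x r]; rewrite !permM.
  case: (eqVneq r i) => [->|ri].
    by rewrite wr_l [in RHS]wr_o // wr_l wr_o.
  case: (eqVneq r j) => [->|rj].
    by rewrite wr_r // [in RHS]wr_o // wr_r // wr_o.
  case: (eqVneq r k) => [->|rk].
    by rewrite wr_o // wr_l wr_o.
  case: (eqVneq r l) => [->|rl].
    by rewrite wr_o // wr_r // wr_o.
  by rewrite !wr_o.
move=> i j k l a b ij kl /permP/(_ (1, i)); rewrite wr_l mul1g.
case: (eqVneq i k) => [->|ik]; first by rewrite wr_l mul1g => -[-> ->]; left.
case: (eqVneq i l) => [->|il]; first by rewrite wr_r // mul1g => -[-> ->]; right.
by rewrite wr_o // => -[_ e]; rewrite e eqxx in ij.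
Qed.

Hypothesis hA : forall a, a * a = 1 \/ a * a * a = 1.
Hypothesis m3 : (3 <= m)%N.

Lemma wr_tset : tset wr_set.
Proof.
apply: (coords_tset wr_coords m3 _ hA) => x /(coords_pick wr_coords)[i [j [a [ij ->]]]].
exact: wr2.
Qed.

Lemma wr_axiom : is_3transposition_group <<wr_set>>%G wr_set.
Proof.
pose o : 'I_m := Ordinal (leq_trans (isT : 0 < 3)%N m3).
pose p : 'I_m := Ordinal (leq_trans (isT : 1 < 3)%N m3).
apply: (tset_tgroup wr_tset (coords_joined wr_coords m3) (d0 := wr o p 1)).
  exact: (coordsD wr_coords).
apply/negP => /(coords_pick wr_coords)[i [j [a [ij /permP/(_ (1, i))]]]].
by rewrite perm1 wr_l => -[_ e]; rewrite e eqxx in ij.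
Qed.

Definition wr_group : tgroup := TGroup wr_axiom.

Definition over (s : {perm T}) (q : 'S_m) := [forall u, (s u).2 == q u.2].

Implicit Types (s : {perm T}) (q : 'S_m).

Lemma overP s q : reflect (forall u, (s u).2 = q u.2) (over s q).
Proof. by apply: (iffP forallP) => h u; apply/eqP. Qed.

Lemma over_wr i j a : i != j -> over (wr i j a) (tperm i j).
Proof.
move=> ij; apply/overP => -[x l] /=.
case: (tpermP i j l) => [->|->|/eqP li /eqP lj]; first by rewrite wr_l.
  by rewrite wr_r.
by rewrite wr_o.
Qed.

Lemma over_uniq s q q' : over s q -> over s q' -> q = q'.
Proof.
by move=> /overP h /overP h'; apply/permP => l; rewrite -(h (1, l)) -(h' (1, l)).
Qed.

Lemma overM s s' q q' : over s q -> over s' q' -> over (s * s') (q * q').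
Proof. by move=> /overP h /overP h'; apply/overP => u; rewrite !permM h' h. Qed.

Definition block_act (s : {perm T}) : 'S_m := odflt 1 [pick q | over s q].

Lemma block_actE s q : over s q -> block_act s = q.
Proof.
move=> h; rewrite /block_act; case: pickP => [q' h'|/(_ q)]; last by rewrite h.
exact: over_uniq h' h.
Qed.

Lemma block_group_set : group_set [set s | [exists q, over s q]].
Proof.
apply/group_setP; split.
  by rewrite inE; apply/existsP; exists 1; apply/overP => u; rewrite !perm1.
move=> s s'; rewrite !inE => /existsP[q h] /existsP[q' h'].
by apply/existsP; exists (q * q'); apply: overM.
Qed.

Let G := <<wr_set>>%G.

Lemma block_over s : s \in G -> over s (block_act s).
Proof.
move=> sG; have : s \in Group block_group_set.
  move: s sG; apply/subsetP; rewrite gen_subG; apply/subsetP => s.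
  case/(coords_pick wr_coords) => i [j [a [ij ->]]]; rewrite inE.
  by apply/existsP; exists (tperm i j); exact: over_wr.
by rewrite inE => /existsP[q h]; rewrite (block_actE h).
Qed.

Lemma block_actM : {in G &, {morph block_act : s s' / s * s'}}.
Proof. by move=> s s' sG sG'; apply: block_actE; apply: overM; exact: block_over. Qed.

Let f := Morphism block_actM.

Let lift_inj (q : 'S_m) : injective (fun u : T => (u.1, q u.2)).
Proof. by move=> [x k] [y l] /= [-> /perm_inj ->]. Qed.

(** Permuting the blocks without changing the coordinate in [A] gives a complement to the kernel; it
    lies in the group because the lift of a transposition is [wr i j 1]. *)
Let lift q : {perm T} := perm (@lift_inj q).

Let liftM : {in [set: 'S_m] &, {morph lift : q q' / q * q'}}.
Proof. by move=> q q' _ _; apply/permP => -[x k]; rewrite [RHS]permM !permE /= ?permM ?permE. Qed.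

Let g := Morphism liftM.

Let lift_over q : over (lift q) q.
Proof. by apply/overP => u; rewrite permE. Qed.

Let lift_tperm i j : i != j -> lift (tperm i j) = wr i j 1.
Proof.
move=> ij; apply/permP => -[x l]; rewrite permE /=.
case: (tpermP i j l) => [->|->|/eqP li /eqP lj]; first by rewrite wr_l mulg1.
  by rewrite wr_r // invg1 mulg1.
by rewrite wr_o.
Qed.

Let liftG q : lift q \in G.
Proof.
have o : 'I_m := Ordinal (leq_trans (isT : 0 < 3)%N m3).
have : q \in <<[set tperm o y | y : 'I_m]>>%G by rewrite /= gen_tperm inE.
move=> qT; have : g q \in g @* <<[set tperm o y | y : 'I_m]>>%G by rewrite mem_morphim ?inE.
rewrite morphim_gen ?subsetT //; apply/subsetP; rewrite gen_subG.
apply/subsetP => _ /morphimP[_ _ /imsetP[y _ ->] ->].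
case: (eqVneq o y) => [<-|oy]; first by rewrite tperm1 morph1 group1.
by rewrite /= lift_tperm // mem_gen // (coordsD wr_coords).
Qed.

Lemma wr_split : split_by_Sym m wr_group.
Proof.
have fl q : block_act (lift q) = q by exact: block_actE.
have fG : f @* G = [set: 'S_m].
  apply/setP => q; rewrite inE; apply/morphimP; exists (lift q); rewrite ?liftG //.
exists ('ker f)%G, (g @* [set: 'S_m])%G, f; split=> //; last first.
  apply/setP => q; rewrite [RHS]inE; apply/morphimP/existsP.
    move=> [s _ /(coords_pick wr_coords)[i [j [a [ij ->]]]] ->]; exists i.
    by apply/existsP; exists j; rewrite ij; apply/eqP; apply: block_actE; exact: over_wr.
  move=> [i /existsP[j /andP[ij /eqP ->]]]; exists (wr i j 1).
  - by apply: mem_gen; exact: (coordsD wr_coords).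
  - exact: (coordsD wr_coords).
  by apply/esym; apply: block_actE; exact: over_wr.
have gG : g @* [set: 'S_m] \subset G.
  by apply/subsetP => _ /morphimP[q _ _ ->]; exact: liftG.
rewrite sdprodE.
- apply/eqP; rewrite eqEsubset mul_subG ?subsetIl //=.
  apply/subsetP => s sG; apply/imset2P; exists (s * (lift (f s))^-1) (lift (f s)).
  - apply/kerP; first by rewrite groupM ?groupV ?liftG.
    by rewrite morphM ?groupV ?liftG // morphV ?liftG //= fl mulgV.
  - by apply/morphimP; exists (f s); rewrite ?inE.
  by rewrite mulgKV.
- apply: subset_trans gG _; exact: normal_norm (ker_normal f).
apply/trivgP/subsetP => s /setIP[/mker sk /morphimP[q _ _ es]].
move: sk; rewrite es /= fl => ->; rewrite -[lift _]/(g 1) morph1; exact: set11.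
Qed.

End WreathTranspositions.

(** * Positivity on the diagram and on the group of coordinates *)

Section ComplexForms.

Local Open Scope ring_scope.

Definition group_adj (A : finGroupType) (a b : A) := (b * a^-1 * b != a)%g.

(* The form of D is a sum of squares, one for the sum over the fibres w i j A
   through each index, plus one copy of this form on A for each fibre. A fibre
   contributes to two of the squares, whence the - 2. *)
Definition group_form (A : finGroupType) (y : A -> algC) :=
  \sum_a \sum_b y a * (y b)^* * ((group_adj a b)%:R - 2%:R).

Definition apsd (A : finGroupType) (t : nat) := forall y : A -> algC,
  0 <= group_form y + t%:R * \sum_a y a * (y a)^*.

Lemma group_form_scale (A : finGroupType) (c : algC) (y z : A -> algC) :
  (forall a, z a = c * y a) -> group_form z = c * c^* * group_form y.
Proof.
move=> zE; rewrite /group_form mulr_sumr; apply: eq_bigr => a _.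
by rewrite mulr_sumr; apply: eq_bigr => b _; rewrite !zE rmorphM; ring.
Qed.

(** For the constant vector, the coefficients of the form are at most [- 1], and equal to [- 2] on
    the diagonal; so [n = #|A|] satisfies [0 <= - n ^ 2 - n + t n]. *)
Lemma apsd_card (A : finGroupType) t : apsd A t -> (#|A| < t)%N.
Proof.
move=> /(_ (fun=> 1)); rewrite /group_form /= rmorph1 mul1r sumr_const -[#|_|]/#|A| => h.
have : 0 <= - (#|A| * #|A| + #|A|)%:R + t%:R * #|A|%:R :> algC.
  apply: le_trans h _; rewrite lerD2r.
  have -> : - (#|A| * #|A| + #|A|)%:R = \sum_(a : A) \sum_(b : A) (- 1 - (a == b)%:R) :> algC.
    transitivity (\sum_(a : A) (- #|A|%:R - 1) : algC).
      by rewrite sumr_const -[#|_|]/#|A| -mulr_natl natrD natrM; ring.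
    apply: eq_bigr => a _; rewrite sumrB sumr_const -[#|_|]/#|A| mulNrn; congr (_ - _).
    by rewrite (bigD1 a) //= eqxx big1 ?addr0 // => b /negPf; rewrite eq_sym => ->.
  apply: ler_sum => a _; apply: ler_sum => b _; rewrite mul1r.
  rewrite -subr_ge0.
  have -> : - 1 - (a == b)%:R - ((group_adj a b)%:R - 2%:R) = 1 - (a == b)%:R - (group_adj a b)%:R :> algC.
    by rewrite (natrD _ 1 1); ring.
  rewrite /group_adj; case: (eqVneq a b) => [->|ab].
    by rewrite mulgV mul1g eqxx subrr subr0.
  by case: (_ == _); rewrite subr0 ?subr0 ?subrr.
rewrite -natrM addrC subr_ge0 ler_nat.
have c0 : (0 < #|A|)%N by apply/card_gt0P; exists 1%g.
by rewrite -mulSnr leq_pmul2r.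
Qed.

Lemma mul_conj_sum (I : finType) (P : pred I) (F : I -> algC) :
  (\sum_(i | P i) F i) * (\sum_(i | P i) F i)^* =
  \sum_(i | P i) \sum_(j | P j) F i * (F j)^*.
Proof. by rewrite mulr_suml; apply: eq_bigr => i _; rewrite rmorph_sum mulr_sumr. Qed.

Section CoordsForm.

Variables (gT A : finGroupType) (D : {set gT}) (m : nat) (w : 'I_m -> 'I_m -> A -> gT).
Hypotheses (cw : coords D w) (m3 : (3 <= m)%N).
Implicit Types (i j k l r : 'I_m) (p q : 'I_m * 'I_m) (a b : A) (v : gT -> algC).

Notation ltp p := (p.1 < p.2)%N.

Lemma coords_sum (F : gT -> algC) :
  \sum_(x in D) F x = \sum_(p : 'I_m * 'I_m | ltp p) \sum_a F (w p.1 p.2 a).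
Proof.
rewrite pair_big_dep /=.
have -> : D = [set w u.1.1 u.1.2 u.2 | u in [set u : ('I_m * 'I_m) * A | ltp u.1]].
  apply/setP => x; apply/idP/imsetP => [/(coords_pick cw)[i [j [a [ij ->]]]]|[u]].
    have := ij; rewrite neq_ltn => /orP[lt|lt].
      by exists ((i, j), a); rewrite ?inE.
    exists ((j, i), a^-1)%g; rewrite ?inE // (coords_flip cw) ?invgK //.
    by rewrite eq_sym.
  rewrite inE => lt ->; apply: (coordsD cw).
  by apply: contraTneq lt => ->; rewrite ltnn.
rewrite big_imset /=; first by apply: eq_bigl => u; rewrite !inE andbT.
move=> [[i j] a] [[k l] b]; rewrite !inE /= => ij kl.
have n (x y : 'I_m) : (x < y)%N -> x != y by apply: contraTneq => ->; rewrite ltnn.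
case/(coords_eq cw (n _ _ ij) (n _ _ kl)) => [[-> [-> ->]]//|[ei [ej _]]].
by subst; move: (ltn_trans ij kl); rewrite ltnn.
Qed.

Definition inp r p : nat := ((r == p.1) + (r == p.2))%N.

Lemma inp_sum p q : ltp p -> ltp q ->
  \sum_r (inp r p)%:R * (inp r q)%:R = (inp p.1 q)%:R + (inp p.2 q)%:R :> algC.
Proof.
move=> hp hq; have n : p.1 != p.2 by apply: contraTneq hp => ->; rewrite ltnn.
rewrite (bigD1 p.1) //= (bigD1 p.2) /=; last by rewrite eq_sym.
rewrite big1 ?addr0; last first.
  by move=> r /andP[/negPf h1 /negPf h2]; rewrite /inp h1 h2 mul0r.
by rewrite /inp !eqxx (negPf n) [p.2 == p.1]eq_sym (negPf n) !mul1r.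
Qed.

(** The sum over [r] counts common indices. For distinct pairs it is 1 exactly when the vertices are
    adjacent, and otherwise 0; for equal pairs it is 2, which the last term replaces by the
    adjacency inside the fibre. *)
Lemma coords_adjE p q a b : ltp p -> ltp q ->
  (adj (w p.1 p.2 a) (w q.1 q.2 b))%:R =
  \sum_r (inp r p)%:R * (inp r q)%:R + (p == q)%:R * ((group_adj a b)%:R - 2%:R) :> algC.
Proof.
move=> hp hq; rewrite inp_sum //.
have n p' : ltp p' -> p'.1 != p'.2 by apply: contraTneq => ->; rewrite ltnn.
move: p q hp hq => [i j] [k l] /= hp hq; have [ij kl] := (n (i, j) hp, n (k, l) hq).
rewrite /= in ij kl; have [ji lk] : j != i /\ l != k by split; rewrite eq_sym.
rewrite xpair_eqE /inp /=.
case: (eqVneq i k) => [ek|ik]; first subst.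
  rewrite (negPf kl) [j == k](negPf ji); case: (eqVneq j l) => [el|jl]; first subst.
    by rewrite (coords_adj_same cw) //= /group_adj; ring.
  rewrite (coords_flip cw _ ji) (coords_adj_chain cw) //=; first by ring.
  by neq.
case: (eqVneq i l) => [el|il]; first subst.
  have [jk jl] : j != k /\ j != l.
    by split=> //; apply: contraTneq hq => <-; rewrite -leqNgt ltnW.
  rewrite (negPf jk) (negPf jl) (coords_flip cw _ ji) (coords_flip cw _ lk).
  by rewrite (coords_adj_chain cw) //=; [ring | neq].
case: (eqVneq j k) => [ek|jk]; first subst.
  by rewrite (negPf kl) (coords_adj_chain cw) //=; [ring | neq].
case: (eqVneq j l) => [el|jl]; first subst.
  by rewrite (coords_flip cw _ lk) (coords_adj_chain cw) //=; [ring | neq].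
by rewrite (coords_adj_disjoint cw) //=; [ring | neq].
Qed.

Lemma form_coords v :
  \sum_(x in D) \sum_(y in D) v x * (v y)^* * (adj x y)%:R =
  \sum_r (\sum_(p : 'I_m * 'I_m | ltp p) (inp r p)%:R * \sum_a v (w p.1 p.2 a))
       * (\sum_(p : 'I_m * 'I_m | ltp p) (inp r p)%:R * \sum_a v (w p.1 p.2 a))^*
  + \sum_(p : 'I_m * 'I_m | ltp p) group_form (fun a => v (w p.1 p.2 a)).
Proof.
pose V p a := v (w p.1 p.2 a); pose U p := \sum_a V p a.
rewrite coords_sum.
transitivity (\sum_(p : 'I_m * 'I_m | ltp p) \sum_(q : 'I_m * 'I_m | ltp q) (\sum_r ((inp r p)%:R * U p) * ((inp r q)%:R * U q)^*
    + (p == q)%:R * group_form (V p))).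
  apply: eq_bigr => p hp.
  transitivity (\sum_a \sum_(q : 'I_m * 'I_m | ltp q) \sum_b V p a * (V q b)^* * (adj (w p.1 p.2 a) (w q.1 q.2 b))%:R).
    by apply: eq_bigr => a _; rewrite coords_sum.
  rewrite exchange_big /=; apply: eq_bigr => q hq.
  transitivity (\sum_a \sum_b V p a * (V q b)^* * \sum_r (inp r p)%:R * (inp r q)%:R
      + \sum_a \sum_b (p == q)%:R * (V p a * (V q b)^* * ((group_adj a b)%:R - 2%:R))).
    rewrite -big_split; apply: eq_bigr => a _; rewrite -big_split; apply: eq_bigr => b _ /=.
    by rewrite coords_adjE //; ring.
  congr (_ + _).
    transitivity (U p * (U q)^* * \sum_r (inp r p)%:R * (inp r q)%:R).
      have [C <-] : exists C, C = \sum_r (inp r p)%:R * (inp r q)%:R :> algC by eexists.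
      rewrite /U !mulr_suml; apply: eq_bigr => a _.
      by rewrite rmorph_sum mulr_sumr mulr_suml.
    rewrite mulr_sumr; apply: eq_bigr => r _; rewrite rmorphM rmorph_nat; ring.
  rewrite /group_form mulr_sumr; apply: eq_bigr => a _; rewrite mulr_sumr; apply: eq_bigr => b _.
  by case: eqVneq => [->|_] //; rewrite !mul0r.
transitivity (\sum_(p : 'I_m * 'I_m | ltp p) ((\sum_(q : 'I_m * 'I_m | ltp q) \sum_r ((inp r p)%:R * U p) * ((inp r q)%:R * U q)^*)
    + group_form (V p))).
  apply: eq_bigr => p hp; rewrite big_split; congr (_ + _) => /=.
  rewrite (bigD1 p) //= eqxx mul1r big1 ?addr0 // => q /andP[_ /negPf].
  by rewrite eq_sym => ->; rewrite mul0r.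
rewrite big_split; congr (_ + _) => /=.
transitivity (\sum_(p : 'I_m * 'I_m | ltp p) \sum_r \sum_(q : 'I_m * 'I_m | ltp q) ((inp r p)%:R * U p) * ((inp r q)%:R * U q)^*).
  by apply: eq_bigr => p _; rewrite exchange_big.
by rewrite exchange_big; apply: eq_bigr => r _ /=; rewrite mul_conj_sum.
Qed.

Lemma apsd_cpsd t : apsd A t -> cpsd D t.
Proof.
move=> h v; rewrite form_coords coords_sum mulr_sumr -addrA -big_split /=.
apply: addr_ge0; first by apply: sumr_ge0 => r _; exact: mul_conjC_ge0.
by apply: sumr_ge0 => p _; exact: h.
Qed.

Lemma cpsd_apsd t : (4 <= m)%N -> cpsd D t -> apsd A t.
Proof.
move=> m4 h y.
pose o0 : 'I_m := Ordinal (leq_trans (isT : 0 < 4)%N m4).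
pose o1 : 'I_m := Ordinal (leq_trans (isT : 1 < 4)%N m4).
pose o2 : 'I_m := Ordinal (leq_trans (isT : 2 < 4)%N m4).
pose o3 : 'I_m := Ordinal (leq_trans (isT : 3 < 4)%N m4).
(* Signs alternate around a 4-cycle of pairs, so the signed sum through each index vanishes and so
   do all the squares. What remains is four times the form on [A]; this is where [4 <= m] enters. *)
pose e p : algC := (p == (o0, o1))%:R + (p == (o2, o3))%:R
  - (p == (o0, o2))%:R - (p == (o1, o3))%:R.
pose v x := oapp (fun u : ('I_m * 'I_m) * A => e u.1 * y u.2) 0
  [pick u : ('I_m * 'I_m) * A | ltp u.1 && (w u.1.1 u.1.2 u.2 == x)].
have vE p a : ltp p -> v (w p.1 p.2 a) = e p * y a.
  move=> hp; rewrite /v; case: pickP => [[q b] /= /andP[hq /eqP]|/(_ (p, a))]; last first.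
    by rewrite /= hp eqxx.
  have n p' : ltp p' -> p'.1 != p'.2 by apply: contraTneq => ->; rewrite ltnn.
  case/(coords_eq cw (n _ hq) (n _ hp)) => [[e1 [e2 ->]]|[e1 [e2 _]]].
    by rewrite [q]surjective_pairing e1 e2 -surjective_pairing.
  by move: hq hp; rewrite e1 e2 => h1 /(ltn_trans h1); rewrite ltnn.
have esum (F : 'I_m * 'I_m -> algC) : \sum_(p : 'I_m * 'I_m | ltp p) F p * e p =
    F (o0, o1) + F (o2, o3) - F (o0, o2) - F (o1, o3).
  have one q : ltp q -> \sum_(p : 'I_m * 'I_m | ltp p) F p * (p == q)%:R = F q.
    move=> hq; rewrite (bigD1 q) //= eqxx mulr1 big1 ?addr0 // => p /andP[_ /negPf ->].
    by rewrite mulr0.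
  rewrite -(one (o0, o1)) // -(one (o2, o3)) // -(one (o0, o2)) // -(one (o1, o3)) //.
  by rewrite -big_split -!sumrB; apply: eq_bigr => p _; rewrite /e /=; ring.
have econj p : (e p)^* = e p by rewrite /e !rmorphB rmorphD !rmorph_nat.
have [Q eQ] : exists Q, Q = group_form y + t%:R * \sum_a y a * (y a)^* by eexists.
have := h v; rewrite -eQ form_coords coords_sum big1 ?add0r; last first.
  move=> r _; rewrite (_ : \sum_(p | _) _ = 0) ?mul0r //.
  transitivity (\sum_(p : 'I_m * 'I_m | ltp p) ((inp r p)%:R * \sum_a y a) * e p).
    apply: eq_bigr => p hp; rewrite (eq_bigr (fun a => e p * y a)); last by move=> a _; rewrite vE.
    by rewrite -mulr_sumr; ring.
  by rewrite esum /inp /= !natrD; ring.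
rewrite mulr_sumr -big_split /=.
rewrite (eq_bigr (fun p => (e p * Q) * e p)).
  rewrite esum /e /= ?eqxx ?xpair_eqE /=.
  set R := (X in 0 <= X).
  have -> : R = 4%:R * Q by rewrite /R; ring.
  by rewrite pmulr_rge0 // ltr0n.
move=> p hp; have [c ec] : exists c, c = e p by eexists.
have vc a : v (w p.1 p.2 a) = c * y a by rewrite vE // ec.
rewrite (group_form_scale vc) (eq_bigr (fun a => c * c^* * (y a * (y a)^*))); last first.
  by move=> a _; rewrite vc rmorphM; ring.
by rewrite -mulr_sumr -ec eQ {2 4}ec econj -ec; ring.
Qed.

End CoordsForm.

End ComplexForms.

(** * Recovering the group of coordinates from the diagram *)

Section SameFibre.

Variables (gT A : finGroupType) (D : {set gT}) (m : nat) (w : 'I_m -> 'I_m -> A -> gT).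
Hypotheses (tD : tset D) (cw : coords D w) (m4 : (4 <= m)%N).
Implicit Types (i j k l : 'I_m) (a b : A) (x y z : gT).

Let m3 : (3 <= m)%N. Proof. exact: leq_trans m4. Qed.

(* With n = #|A|, a test for x and y to lie in the same fibre w i j A which does
   not refer to the coordinates. *)
Definition twin n x y := adj x y &&
  (#|[set z in D | [&& adj z x, adj z y & ~~ adj z (x ^ y)]]| < n)%N.

Lemma coords_fibre i j k l a b : i != j -> k != l -> w i j a = w k l b ->
  forall c, exists c', w i j c = w k l c'.
Proof.
move=> ij kl /(coords_eq cw ij kl)[[-> [-> _]] c|[ei [ej _]] c]; first by exists c.
by subst; exists c^-1; rewrite (coords_flip cw).
Qed.

(** The point [x ^ y] lies in the same fibre. A vertex sharing one index with that fibre is adjacent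
    to all of it, and one sharing none is adjacent to nothing in it; so the vertices counted lie in
    the fibre and differ from [x]. *)
Lemma twin_same i j a b : i != j -> adj (w i j a) (w i j b) ->
  twin #|A| (w i j a) (w i j b).
Proof.
move=> ij ad; rewrite /twin ad /=; set S := [set z in D | _].
have sub : S \subset [set w i j c | c in A] :\ w i j a.
  apply/subsetP => z; rewrite !inE => /and4P[zD zx zy nz].
  apply/andP; split; first by apply: contraTneq zx => ->; rewrite adjxx.
  case: (coords_case cw zD (coordsD cw a ij)) => [[i' [j' [c [d [ij' -> e]]]]]|
    [i' [j' [k' [c [d [u ez e]]]]]]|[i' [j' [k' [l' [c [d [u ez e]]]]]]]].
  - have [c' ->] := coords_fibre ij' ij (esym e) c.
    by apply: imset_f.
  - exfalso; have jk : j' != k' by neq.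
    have [c' e'] := coords_fibre ij jk e (b * a^-1 * b).
    by rewrite (coords_same cw m3) // e' ez (coords_adj_chain cw) in nz.
  - by rewrite ez e (coords_adj_disjoint cw) in zx.
apply: leq_ltn_trans (subset_leq_card sub) _.
have xin : w i j a \in [set w i j c | c in A] by apply: imset_f.
have := cardsD1 (w i j a) [set w i j c | c in A]; rewrite xin add1n => <-.
exact: leq_imset_card.
Qed.

(** For a fourth index [l] the whole fibre over [(j l)] is counted: it is adjacent to both vertices,
    and disjoint from [(i k)]. *)
Lemma twin_chain i j k a b : uniq [:: i; j; k] ->
  twin #|A| (w i j a) (w j k b) = false.
Proof.
move=> u; rewrite /twin (coords_adj_chain cw) //=; apply/negbTE; rewrite -leqNgt.
have [l hl] := @exists_fresh m [:: i; j; k] m4.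
have jl : j != l by neq.
rewrite -[X in (X <= _)%N](card_in_imset (f := w j l) (D := A)); last first.
  by move=> c d _ _ /(coords_inj cw jl).
apply/subset_leq_card/subsetP => _ /imsetP[c _ ->]; rewrite !inE (coordsD cw) //=.
rewrite adjC (coords_adj_chain cw) /=; last by neq.
have kj : k != j by neq.
rewrite (coords_flip cw _ kj) adjC (coords_adj_chain cw) /=; last by neq.
by rewrite -(coords_flip cw _ kj) (coords_chain cw) ?(coords_adj_disjoint cw) //; neq.
Qed.

Lemma twin_fibre i j a y : i != j -> y \in D -> twin #|A| (w i j a) y ->
  exists b, y = w i j b.
Proof.
move=> ij yD; case: (coords_case cw (coordsD cw a ij) yD) => [[i' [j' [c [d [ij' e ->]]]]] _|
    [i' [j' [k' [c [d [u -> ->]]]]]]|[i' [j' [k' [l' [c [d [u -> ->]]]]]]]].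
- exact: (coords_fibre ij' ij (esym e)).
- by rewrite twin_chain.
by rewrite /twin (coords_adj_disjoint cw).
Qed.

Lemma coords_card : #|D| = (#|[set p : 'I_m * 'I_m | (p.1 < p.2)%N]| * #|A|)%N.
Proof.
have := @coords_sum _ _ _ _ _ cw (fun=> 1%R).
rewrite sumr_const (eq_bigr (fun=> #|A|%:R%R)); last first.
  by move=> p _; rewrite sumr_const -[#|_|]/#|A|.
rewrite sumr_const -mulrnA => /eqP; rewrite eqr_nat => /eqP ->.
by rewrite mulnC; congr (_ * _)%N; apply: eq_card => p; rewrite !inE.
Qed.

End SameFibre.

(** Inside a fibre, [a] and [b] are adjacent when [a^-1 * b] has order 3. A fibre is therefore
    connected in the diagram exactly when this subgroup is all of [A]. *)
Definition cube_gen (A : finGroupType) := <<[set a : A | a * a * a == 1]>>.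
Canonical cube_gen_group A := Eval hnf in [group of cube_gen A].

Section Isotopy.

Variables (gT hT A B : finGroupType) (D : {set gT}) (D' : {set hT}) (m : nat).
Variables (w : 'I_m -> 'I_m -> A -> gT) (w' : 'I_m -> 'I_m -> B -> hT).
Hypotheses (tD : tset D) (tD' : tset D') (cw : coords D w) (cw' : coords D' w').
Hypothesis m4 : (4 <= m)%N.
Variable phi : gT -> hT.
Hypotheses (inj : {in D &, injective phi}) (im : phi @: D = D')
  (mor : {in D &, {morph phi : x y / x ^ y}}).

Let m3 : (3 <= m)%N. Proof. exact: leq_trans m4. Qed.
Let cD : {in D &, forall x y, x ^ y \in D}. Proof. by case: tD. Qed.
Let phiD x : x \in D -> phi x \in D'. Proof. by move=> xD; rewrite -im imset_f. Qed.
Let phi_adj := qiso_adj cD inj mor.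

Lemma qiso_fibre_card : #|A| = #|B|.
Proof.
have := card_in_imset inj; rewrite im (coords_card cw) (coords_card cw') => /eqP.
rewrite eqn_pmul2l => [/eqP //|]; apply/card_gt0P.
by exists (Ordinal (leq_trans (isT : 0 < 4)%N m4), Ordinal (leq_trans (isT : 1 < 4)%N m4)); rewrite inE.
Qed.

Lemma twin_phi n x y : x \in D -> y \in D -> twin D' n (phi x) (phi y) = twin D n x y.
Proof.
move=> xD yD; rewrite /twin phi_adj //; congr (_ && (_ < _)%N).
rewrite -(card_in_imset (f := phi)); last first.
  by move=> u v; rewrite !inE => /andP[uD _] /andP[vD _]; apply: inj.
apply: eq_card => z; apply/idP/imsetP => [|[u]]; last first.
  by rewrite !inE => /and4P[uD h1 h2 h3] ->; rewrite phiD // -mor // !phi_adj ?cD // h1 h2 h3.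
rewrite inE -im => /andP[/imsetP[u uD ->]]; rewrite -mor // !phi_adj ?cD // => h.
by exists u => //; rewrite inE uD.
Qed.

Hypothesis gA : cube_gen A = [set: A].

(** The test [twin] shows that right multiplication by an element of order 3 does not leave the
    image fibre, and such elements generate [A]. *)
Lemma fibre_phi i j : i != j -> exists k l, k != l /\ forall a, exists b, phi (w i j a) = w' k l b.
Proof.
move=> ij; have [k [l [b0 [kl e0]]]] := coords_pick cw' (phiD (coordsD cw 1 ij)).
exists k, l; split=> //.
pose inF a := [exists b, phi (w i j a) == w' k l b].
pose S := [set q | [forall a, inF a ==> inF (a * q)]].
have gS : group_set S.
  apply/group_setP; split; first by rewrite inE; apply/forallP => a; rewrite mulg1 implybb.
  move=> p q; rewrite !inE => /forallP hp /forallP hq; apply/forallP => a; apply/implyP => h.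
  by rewrite mulgA; apply: (implyP (hq _)); apply: (implyP (hp _)).
have : cube_gen A \subset Group gS.
  rewrite gen_subG; apply/subsetP => q; rewrite !inE => /eqP q3.
  apply/forallP => a; apply/implyP => /existsP[b /eqP eb].
  have [q2|q2] := eqVneq (q * q) 1.
    have q1 : q = 1 by rewrite -q3 q2 mul1g.
    by apply/existsP; exists b; rewrite q1 mulg1 eb.
  have ad : adj (w i j a) (w i j (a * q)).
    rewrite (coords_adj_same cw m3) //; apply: contra_neq q2 => h.
    by apply: (mulgI a); rewrite mulg1 -[RHS]h -!mulgA mulKg.
  have := twin_same cw m4 ij ad; rewrite -twin_phi ?(coordsD cw) // qiso_fibre_card eb.
  case/(twin_fibre cw' m4 kl); first by rewrite phiD ?(coordsD cw).
  by move=> c ec; apply/existsP; exists c; rewrite ec.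
rewrite gA => /subsetP sub a; have := sub a; rewrite !inE => /(_ isT) /forallP/(_ 1).
rewrite mul1g => /implyP h; have /existsP[b /eqP eb] : inF a.
  by apply: h; apply/existsP; exists b0; rewrite e0.
by exists b.
Qed.

(* The products of two fibres give an isotopy f a * g b = h (a * b) from A to B,
   and isotopic groups are isomorphic: a |-> f a * (f 1)^-1 is a morphism. *)
Lemma fibre_isog : [set: A] \isog [set: B].
Proof.
pose o : 'I_m := Ordinal (leq_trans (isT : 0 < 4)%N m4).
pose p : 'I_m := Ordinal (leq_trans (isT : 1 < 4)%N m4).
pose q : 'I_m := Ordinal (leq_trans (isT : 2 < 4)%N m4).
have [op pq oq] : [/\ o != p, p != q & o != q] by [].
have [i [j [ij hf]]] := fibre_phi op; have [k [l [kl hg]]] := fibre_phi pq.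
have wopD a : w o p a \in D by exact: (coordsD cw).
have wpqD a : w p q a \in D by exact: (coordsD cw).
suff [i' [j' [k' [u [hf' hg']]]]] : exists i j k, uniq [:: i; j; k] /\
    (forall a, exists b, phi (w o p a) = w' i j b) /\
    (forall a, exists b, phi (w p q a) = w' j k b).
  have [ij' jk ik] : [/\ i' != j', j' != k' & i' != k'] by split; neq.
  pose f a := odflt 1 [pick b | phi (w o p a) == w' i' j' b].
  have fE a : phi (w o p a) = w' i' j' (f a).
    by rewrite /f; case: pickP => [b /eqP//|n]; have [b e] := hf' a; have := n b; rewrite e eqxx.
  pose g a := odflt 1 [pick b | phi (w p q a) == w' j' k' b].
  have gE a : phi (w p q a) = w' j' k' (g a).
    by rewrite /g; case: pickP => [b /eqP//|n]; have [b e] := hg' a; have := n b; rewrite e eqxx.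
  have fg a b : phi (w o q (a * b)) = w' i' k' (f a * g b).
    rewrite -(coords_chain cw _ _ op pq oq) mor //.
    by rewrite fE gE (coords_chain cw').
  have eq_fg a b c d : a * b = c * d -> f a * g b = f c * g d.
    by move=> e; apply: (coords_inj cw' ik); rewrite -!fg e.
  pose al a := f a * (f 1)^-1.
  have alM : {in [set: A] &, {morph al : a b / a * b}}.
    move=> a b _ _; rewrite /al.
    have e1 : f (a * b) * g 1 = f a * g b by apply: eq_fg; rewrite mulg1.
    have e2 : f b * g 1 = f 1 * g b by apply: eq_fg; rewrite mulg1 mul1g.
    have -> : f (a * b) = f a * (f 1)^-1 * f b.
      by apply: (mulIg (g 1)); rewrite e1 -!mulgA e2 mulKg.
    by rewrite !mulgA.
  have injal : 'injm (Morphism alM).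
    apply/injmP => a b _ _ /= /mulIg e; apply: (coords_inj cw op); apply: inj => //.
    by rewrite !fE e.
  apply/isogP; exists (Morphism alM) => //.
  by apply/eqP; rewrite eqEcard subsetT (card_injm injal (subxx _)) !cardsT -qiso_fibre_card leqnn.
have u : uniq [:: o; p; q] by [].
have := twin_chain cw m4 1 1 u; rewrite -twin_phi // qiso_fibre_card.
have : adj (phi (w o p 1)) (phi (w p q 1)).
  by rewrite phi_adj // (coords_adj_chain cw).
have [b0 ef] := hf 1; have [c0 eg] := hg 1.
have x1 : phi (w o p 1) \in D' by exact: phiD.
have y1 : phi (w p q 1) \in D' by exact: phiD.
case: (coords_case cw' x1 y1) => [[i' [j' [c [d [ij' -> ->]]]]]|
    [i' [j' [k' [c [d [U e1 e2]]]]]]|[i' [j' [k' [l' [c [d [U -> ->]]]]]]]].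
- by move=> ad; rewrite (twin_same cw').
- move=> _ _; exists i', j', k'; split=> //.
  have [ij' jk] : i' != j' /\ j' != k' by split; neq.
  split=> a.
    by have [b ->] := hf a; apply: (coords_fibre cw' ij ij' (etrans (esym ef) e1)).
  by have [b ->] := hg a; apply: (coords_fibre cw' kl jk (etrans (esym eg) e2)).
- by rewrite (coords_adj_disjoint cw').
Qed.

End Isotopy.

Lemma involution_abelem (A : finGroupType) : (forall a : A, a * a = 1) -> 2.-abelem [set: A].
Proof.
move=> h; apply/abelemP => //; split=> [|a _]; last by rewrite expgS expg1.
have inv (x : A) : x^-1 = x by apply/eqP; rewrite eq_invg_mul h.
by apply/centsP => a _ b _; rewrite /commute -[LHS]inv invMg !inv.
Qed.

(* When m = 4 and A is a generalised dihedral group 3^k:2, an isomorphism of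
   diagrams need not preserve the fibres, but A is then determined by its order. *)
Section InvertedCubes.

Variable A : finGroupType.
Hypothesis hA : forall a : A, a * a = 1 \/ a * a * a = 1.
Notation Q := (cube_gen A).
Hypothesis nQ : Q <> [set: A].
Variable q0 : A.
Hypothesis hq0 : q0 * q0 != 1.

Let cubeQ a : a * a * a = 1 -> a \in Q.
Proof. by move=> h; apply: mem_gen; rewrite inE h. Qed.

Let out2 a : a \notin Q -> a * a = 1.
Proof. by move=> aQ; case: (hA a) => // /cubeQ h; rewrite h in aQ. Qed.

Let q0Q : q0 \in Q.
Proof. by apply: (contraNT _ hq0) => /out2 ->. Qed.

Let inverted a q : a \notin Q -> q \in Q -> q ^ a = q^-1.
Proof.
move=> aQ qQ; have aqQ : a * q \notin Q by rewrite groupMr.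
have av : a^-1 = a by apply/eqP; rewrite eq_invg_mul out2.
apply: (mulIg q); rewrite mulVg -(out2 aqQ) conjgE av.
by rewrite !mulgA.
Qed.

Lemma inverted_cubes : exists s : A, [/\ s \notin Q, s * s = 1,
  forall q, q \in Q -> q ^ s = q^-1, forall a, a \notin Q -> a * s \in Q
  & 3.-abelem Q /\ #|A| = (2 * #|Q|)%N].
Proof.
have [s sQ] : exists s, s \notin Q.
  apply/existsP; apply: contraT => /existsPn h; case: nQ; apply/setP => a.
  by rewrite inE; have := h a; rewrite negbK.
have asQ a : a \notin Q -> a * s \in Q.
  move=> aQ; apply: contraT => asQ; case/eqP: hq0; apply: (mulgI q0^-1).
  by rewrite mulKg mulg1 -(inverted asQ q0Q) conjgM (inverted aQ) // conjVg inverted // invgK.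
have s2 := out2 sQ.
exists s; split=> //; first by move=> q; exact: inverted.
have cQ : abelian Q.
  apply/centsP => q qQ r rQ; apply: invg_inj.
  by rewrite -(inverted sQ (groupM qQ rQ)) conjMg !inverted // invMg.
split.
  apply/abelemP => //; split=> // q qQ.
  pose S := [set q in Q | q ^+ 3 == 1].
  have gS : group_set S.
    apply/group_setP; split; first by rewrite inE group1 /= expg1n.
    move=> x y; rewrite !inE => /andP[xQ /eqP x3] /andP[yQ /eqP y3].
    have c : commute x y by exact: (centsP cQ _ xQ _ yQ).
    by rewrite groupM // expgMn // x3 y3 mulg1 /=.
  have : Q \subset Group gS.
    rewrite gen_subG; apply/subsetP => x; rewrite !inE => /eqP x3.
    by rewrite cubeQ //= !expgS expg0 mulg1 mulgA x3.
  by move/subsetP/(_ q qQ); rewrite inE qQ => /eqP.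
have sV : s^-1 = s by apply/eqP; rewrite eq_invg_mul s2.
have : #|~: Q| = #|Q :* s|; last by rewrite card_rcoset -(cardsC Q) mul2n -addnn => ->.
apply: eq_card => x; rewrite mem_rcoset sV inE; apply/esym.
apply/idP/idP => [h|]; last exact: asQ.
by apply/negP => xQ; move: h; rewrite groupMl // (negPf sQ).
Qed.

End InvertedCubes.

Lemma inverted_cubes_isog (A B : finGroupType) (a0 : A) (b0 : B) :
  (forall a : A, a * a = 1 \/ a * a * a = 1) -> (forall b : B, b * b = 1 \/ b * b * b = 1) ->
  cube_gen A <> [set: A] -> cube_gen B <> [set: B] -> a0 * a0 != 1 -> b0 * b0 != 1 ->
  #|A| = #|B| -> [set: A] \isog [set: B].
Proof.
move=> hA hB nA nB ha hb cAB.
have [s [sQ s2 sI sM [aA cA]]] := inverted_cubes hA nA ha.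
have [r [rQ r2 rI rM [aB cB]]] := inverted_cubes hB nB hb.
have : cube_gen A \isog cube_gen B.
  by rewrite (isog_abelem_card _ aA) aB /= -(eqn_pmul2l (isT : (0 < 2)%N)) -cA -cB cAB.
case/isogP => f injf imf.
have fB q : q \in cube_gen A -> f q \in cube_gen B by move=> qQ; rewrite -imf mem_morphim.
pose F a := if a \in cube_gen A then f a else f (a * s) * r.
have F1 q : q \in cube_gen A -> F q = f q by rewrite /F => ->.
have F2 q : q \in cube_gen A -> F (q * s) = f q * r.
  by move=> qQ; rewrite /F groupMl // (negPf sQ) -mulgA s2 mulg1.
have cases a : a \in cube_gen A \/ exists2 q, q \in cube_gen A & a = q * s.
  case: (boolP (a \in cube_gen A)) => aQ; [by left|right].
  by exists (a * s); [exact: sM | rewrite -mulgA s2 mulg1].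
have sq q : q \in cube_gen A -> s * q = q^-1 * s.
  by move=> qQ; rewrite -(sI _ qQ) conjgE -!mulgA s2 mulg1 (_ : s^-1 = s) //;
    apply/eqP; rewrite eq_invg_mul s2.
have rq q : q \in cube_gen B -> r * q = q^-1 * r.
  by move=> qQ; rewrite -(rI _ qQ) conjgE -!mulgA r2 mulg1 (_ : r^-1 = r) //;
    apply/eqP; rewrite eq_invg_mul r2.
have FM : {in [set: A] &, {morph F : a b / a * b}}.
  move=> a b _ _; case: (cases a) => [aQ|[p pQ ->]]; case: (cases b) => [bQ|[q qQ ->]].
  - by rewrite !F1 ?groupM // morphM.
  - by rewrite mulgA !F2 ?groupM // F1 // morphM // mulgA.
  - rewrite -mulgA sq // mulgA !F2 ?groupM ?groupV // F1 // morphM ?groupV // morphV //.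
    by rewrite -mulgA -rq ?fB // mulgA.
  rewrite !F2 // -!mulgA (mulgA s q) sq // -!mulgA s2 mulg1 F1 ?groupM ?groupV //.
  by rewrite morphM ?groupV // morphV // (mulgA r) rq ?fB // -mulgA r2 mulg1.
have nrB q : q \in cube_gen A -> f q * r \notin cube_gen B by move=> qQ; rewrite groupMl ?fB.
have injF : 'injm (Morphism FM).
  apply/injmP => a b _ _ /=; case: (cases a) => [aQ|[p pQ ->]]; case: (cases b) => [bQ|[q qQ ->]].
  - by rewrite !F1 //; apply: (injmP injf).
  - by rewrite F1 // F2 // => e; have := nrB _ qQ; rewrite -e fB.
  - by rewrite F2 // F1 // => e; have := nrB _ pQ; rewrite e fB.
  - by rewrite !F2 // => /mulIg /(injmP injf) ->.
apply/isogP; exists (Morphism FM) => //.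
by apply/eqP; rewrite eqEcard subsetT (card_injm injF (subxx _)) !cardsT cAB leqnn.
Qed.

(** If the square of [b] were not 1, then [1] and [b] would be adjacent twins. Their preimages lie
    in a common fibre over [A] and are adjacent, which is impossible when every element of [A]
    squares to 1. *)
Lemma involution_qiso (gT hT A B : finGroupType) (D : {set gT}) (D' : {set hT}) m
    (w : 'I_m -> 'I_m -> A -> gT) (w' : 'I_m -> 'I_m -> B -> hT) (b : B) :
  tset D -> coords D w -> coords D' w' -> (4 <= m)%N -> qiso D D' ->
  (forall a : A, a * a = 1) -> b * b = 1.
Proof.
move=> tD cw cw' m4 q h; apply/eqP; apply: contraT => b2.
have m3 : (3 <= m)%N by exact: leq_trans m4.
have cD : {in D &, forall x y, x ^ y \in D} by case: tD.
case: q => phi [inj im mor].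
pose o : 'I_m := Ordinal (leq_trans (isT : 0 < 4)%N m4).
pose p : 'I_m := Ordinal (leq_trans (isT : 1 < 4)%N m4).
have op : o != p by [].
have ad : adj (w' o p 1) (w' o p b) by rewrite (coords_adj_same cw' m3) // invg1 mulg1.
have tw := twin_same cw' m4 op ad.
have : w' o p 1 \in D' by exact: (coordsD cw').
have : w' o p b \in D' by exact: (coordsD cw').
rewrite -im => /imsetP[y yD ey] /imsetP[x xD ex].
move: tw; rewrite ex ey (twin_phi tD inj im mor) // -(qiso_fibre_card cw cw' m4 inj im).
have [i [j [a [ij ea]]]] := coords_pick cw xD.
rewrite ea => tw; have [c ec] := twin_fibre cw m4 ij yD tw.
move: tw; rewrite ec /twin (coords_adj_same cw m3) // => /andP[/eqP n _]; case: n.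
have e : (a^-1 * c) * (a^-1 * c) = 1 by exact: h.
by apply: (mulgI a^-1); rewrite mulVg -e !mulgA.
Qed.

(** If one of the groups is generated by its elements of order 3, the fibres are preserved and the
    isotopy applies. Otherwise both groups are of type [3^k:2] with [k > 0], or both are elementary
    abelian 2-groups, and their common order decides. *)
Lemma coords_isog (gT hT A B : finGroupType) (D : {set gT}) (D' : {set hT}) m
    (w : 'I_m -> 'I_m -> A -> gT) (w' : 'I_m -> 'I_m -> B -> hT) :
  tset D -> tset D' -> coords D w -> coords D' w' -> (4 <= m)%N -> qiso D D' ->
  [set: A] \isog [set: B].
Proof.
move=> tD tD' cw cw' m4 q.
have m3 : (3 <= m)%N by exact: leq_trans m4.
have cD : {in D &, forall x y, x ^ y \in D} by case: tD.
have q' := qiso_sym cD q.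
have cAB : #|A| = #|B| by case: q => phi [inj im mor]; exact: (qiso_fibre_card cw cw' m4 inj im).
case: (eqVneq (cube_gen A) [set: A]) => [gA|/eqP nA].
  by case: q => phi [inj im mor]; exact: (fibre_isog tD cw cw' m4 inj im mor gA).
case: (eqVneq (cube_gen B) [set: B]) => [gB|/eqP nB].
  rewrite isog_sym; case: q' => phi [inj im mor].
  exact: (fibre_isog tD' cw' cw m4 inj im mor gB).
have hA := coords_order cw m3 tD; have hB := coords_order cw' m3 tD'.
case: (pickP (fun a : A => a * a != 1)) => [a ha|h].
  case: (pickP (fun b : B => b * b != 1)) => [b hb|h].
    exact: inverted_cubes_isog ha hb cAB.
  case/eqP: ha; apply: (involution_qiso a tD' cw' cw m4 q') => b.
  by apply/eqP; have /negbT := h b; rewrite negbK.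
have hA2 (a : A) : a * a = 1 by apply/eqP; have /negbT := h a; rewrite negbK.
have hB2 (b : B) : b * b = 1 by apply: (involution_qiso b tD cw cw' m4 q).
rewrite (isog_abelem_card _ (involution_abelem hA2)) involution_abelem //=.
by rewrite !cardsT cAB.
Qed.

(** * Enumeration of central types *)

Section Enumeration.

Variables (T : Type) (R : T -> T -> Prop).
Hypotheses (Rxx : forall x, R x x) (Rsym : forall x y, R x y -> R y x)
  (Rtrans : forall x y z, R x y -> R y z -> R x z).

Definition enumerated (P : T -> Prop) n := exists E : 'I_n -> T,
  [/\ forall i, P (E i), forall i j, i != j -> ~ R (E i) (E j)
    & forall x, P x -> exists i, R x (E i)].

Lemma enumerated_le (P P' : T -> Prop) n n' : (forall x, P x -> P' x) ->
  enumerated P n -> enumerated P' n' -> n <= n'.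
Proof.
move=> sub [E [EP En _]] [E' [_ _ Es]].
have [f fE] : exists f : 'I_n -> 'I_n', forall i, R (E i) (E' (f i)).
  by apply: (@fin_all_exists _ (fun=> 'I_n') (fun i k => R (E i) (E' k))) => i; apply/Es/sub.
have fi : injective f.
  move=> i j e; apply/eqP; apply: contraT => ij; case: (En i j ij).
  by apply: Rtrans (fE i) _; rewrite e; apply: Rsym.
by rewrite -[n]card_ord -[n']card_ord; apply: leq_card fi.
Qed.

(** Equal codes force equivalence, but equivalent elements may have different codes; so a code
    contributes a representative only if its class is new. *)
Lemma enumerated_exists (P : T -> Prop) (K : finType) (code : T -> K) :
  (forall x y, P x -> P y -> code x = code y -> R x y) -> exists n, enumerated P n.
Proof.
move=> hc; suff /(_ (enum K)) [n [E [EP En Es]]] : forall s : seq K,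
    exists n, enumerated (fun x => P x /\ code x \in s) n.
  exists n, E; split=> // [i|x Px]; first by case: (EP i).
  by apply: Es; rewrite mem_enum.
elim=> [|k s [n [E [EP En Es]]]].
  exists 0, (fun i : 'I_0 => match (i : 'I_0) with Ordinal _ h => False_rect _ (notF h) end).
  by split=> [[]|[]|x []].
case: (classic (exists x, [/\ P x, code x = k & forall i, ~ R x (E i)])) => [[x [Px xk xn]]|h].
  exists n.+1, (fun i => oapp E x (unlift ord_max i)); split=> [i|i j|y [Py]].
  - case: (unliftP ord_max i) => [j _|_] /=; last by rewrite xk inE eqxx.
    by have [h1 h2] := EP j; rewrite inE h2 orbT.
  - case: (unliftP ord_max i) => [i' ->|->]; case: (unliftP ord_max j) => [j' ->|->] //=.
    + by rewrite (inj_eq (@lift_inj _ _)); apply: En.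
    + by move=> _ /Rsym/xn.
    + by rewrite eqxx.
  rewrite inE => /predU1P[yk|ys].
    by exists ord_max; rewrite unlift_none /=; apply: hc; rewrite ?xk.
  by have [i yi] := Es y (conj Py ys); exists (lift ord_max i); rewrite liftK.
exists n, E; split=> // [i|y [Py]].
  by have [h1 h2] := EP i; rewrite inE h2 orbT.
rewrite inE => /predU1P[yk|ys]; last exact: Es.
by apply: NNPP => n'; apply: h; exists y; split=> // i yi; apply: n'; exists i.
Qed.

End Enumeration.

Section MagmaCode.

Variable N : nat.
Local Open Scope nat_scope.

(** The cardinal and the operation table in the order of [enum]. The code type depends on [N] only,
    and for at most [N] elements [inord] loses nothing on the entries that are read back. *)
Definition magma_code (T : finType) (x0 : T) (op : T -> T -> T) :
    'I_N.+1 * {ffun 'I_N * 'I_N -> 'I_N.+1} :=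
  (inord #|T|, [ffun p : 'I_N * 'I_N => inord (index (op (nth x0 (enum T) p.1) (nth x0 (enum T) p.2)) (enum T))]).

Lemma magma_code_iso (T T' : finType) x0 x0' (op : T -> T -> T) (op' : T' -> T' -> T') :
  (#|T| <= N)%N -> (#|T'| <= N)%N -> magma_code x0 op = magma_code x0' op' ->
  exists f : T -> T', [/\ injective f, forall y, exists x, y = f x
    & {morph f : x y / op x y >-> op' x y}].
Proof.
move=> hT hT' [/(congr1 (@nat_of_ord _))]; rewrite !inordK ?ltnS // => cTT' /ffunP h.
have ix (x : T) : (index x (enum T) < #|T|)%N by rewrite cardE index_mem mem_enum.
have ix' (x : T') : (index x (enum T') < #|T'|)%N by rewrite cardE index_mem mem_enum.
have nx (x : T) : nth x0 (enum T) (index x (enum T)) = x by rewrite nth_index ?mem_enum.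
have nx' (x : T') : nth x0' (enum T') (index x (enum T')) = x by rewrite nth_index ?mem_enum.
exists (fun x => nth x0' (enum T') (index x (enum T))); split.
- move=> x y /eqP; rewrite nth_uniq ?enum_uniq -?cardE -?cTT' ?ix // => /eqP e.
  by rewrite -[x]nx e nx.
- move=> y; exists (nth x0 (enum T) (index y (enum T'))).
  by rewrite index_uniq ?enum_uniq -?cardE ?cTT' ?ix' ?nx'.
move=> x y.
have lt (z : T) : (index z (enum T) < N)%N by apply: leq_trans (ix z) hT.
have := h (Ordinal (lt x), Ordinal (lt y)); rewrite !ffunE /= !nx => /(congr1 (@nat_of_ord _)) /=.
rewrite !inordK; first by move=> ->; rewrite nx'.
  by rewrite ltnS ltnW // (leq_trans (ix' _)).
by rewrite ltnS ltnW.
Qed.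

End MagmaCode.

Lemma group_code_isog N (A B : finGroupType) : (#|A| <= N)%N -> (#|B| <= N)%N ->
  magma_code N (1 : A) mulg = magma_code N (1 : B) mulg -> [set: A] \isog [set: B].
Proof.
move=> hA hB /(magma_code_iso hA hB)[f [fi fs fM]].
have fM' : {in [set: A] &, {morph f : x y / x * y}} by move=> x y _ _; apply: fM.
apply/isogP; exists (Morphism fM'); first by apply/injmP => x y _ _; apply: fi.
apply/setP => y; rewrite inE; apply/morphimP; have [x ->] := fs y.
by exists x; rewrite ?inE.
Qed.

Definition tg_point (X : tgroup) : {x | x \in tg_class X} :=
  exist _ (xchoose (tg_neq0 X)) (xchooseP (tg_neq0 X)).

Definition tg_op (X : tgroup) (x y : {x | x \in tg_class X}) : {x | x \in tg_class X} :=
  insubd x (val x ^ val y).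

Lemma tgroup_code_qiso N (X Y : tgroup) : (#|tg_class X| <= N)%N -> (#|tg_class Y| <= N)%N ->
  magma_code N (tg_point X) (@tg_op X) = magma_code N (tg_point Y) (@tg_op Y) ->
  qiso (tg_class X) (tg_class Y).
Proof.
have cs (Z : tgroup) : #|{: {x | x \in tg_class Z}}| = #|tg_class Z|.
  by rewrite card_sig; apply: eq_card.
rewrite -(cs X) -(cs Y) => hX hY /(magma_code_iso hX hY)[f [fi fs fM]].
have opE (Z : tgroup) (u v : {x | x \in tg_class Z}) : val (tg_op u v) = val u ^ val v.
  by rewrite insubdK // -topredE /= (tsetJ (tg_tset Z)) ?(valP u) ?(valP v).
pose phi x := oapp (fun u => val (f u)) 1 (insub x).
have phiE u : phi (val u) = val (f u) by rewrite /phi valK.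
have S (Z : tgroup) x : x \in tg_class Z -> exists u : {x | x \in tg_class Z}, x = val u.
  by move=> xZ; exists (exist _ x xZ).
exists phi; split.
- by move=> _ _ /S[u ->] /S[v ->]; rewrite !phiE => /val_inj/fi ->.
- apply/setP => y; apply/imsetP/idP => [[_ /S[u ->] ->]|/S[v ->]].
    by rewrite phiE; apply: (valP (f u)).
  by have [u ->] := fs v; exists (val u); [apply: (valP u) | rewrite phiE].
by move=> _ _ /S[u ->] /S[v ->]; rewrite -opE !phiE fM opE.
Qed.

Lemma coords_transport (gT hT A : finGroupType) (D : {set gT}) (D' : {set hT}) m
    (w : 'I_m -> 'I_m -> A -> gT) : qiso D D' -> coords D w ->
  exists w' : 'I_m -> 'I_m -> A -> hT, coords D' w'.
Proof.
case=> phi [inj im mor] cw; exists (fun i j a => phi (w i j a)).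
have wD := coordsD cw.
split; first split.
- by move=> i j a ij; rewrite -im imset_f ?wD.
- move=> e; rewrite -im => /imsetP[x /(coords_pick cw)[i [j [a [ij ->]]]] ->].
  by exists i, j, a.
- by move=> i j a ij; rewrite (coords_flip cw).
- by move=> i j k a b ij jk ik; rewrite -mor ?wD // (coords_chain cw).
- by move=> i j k l a b u; rewrite -mor ?wD ?(coords_disjoint cw) //; neq.
move=> i j k l a b ij kl /inj e; apply: (coords_eq cw ij kl).
by apply: e; apply: wD.
Qed.

Lemma coords_isog_param (gT A B : finGroupType) (D : {set gT}) m
    (w : 'I_m -> 'I_m -> A -> gT) : coords D w -> [set: B] \isog [set: A] ->
  exists w' : 'I_m -> 'I_m -> B -> gT, coords D w'.
Proof.
move=> cw /isogP[f /injmP fi fs].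
have fM a b : f (a * b) = f a * f b by rewrite morphM ?inE.
have fV a : f a^-1 = (f a)^-1 by rewrite morphV ?inE.
exists (fun i j b => w i j (f b)); split; first split.
- by move=> i j a; apply: (coordsD cw).
- move=> e /(coords_pick cw)[i [j [a [ij ->]]]].
  have : a \in f @* [set: B] by rewrite fs inE.
  by case/morphimP => b _ _ ->; exists i, j, b.
- by move=> i j a ij; rewrite (coords_flip cw) // fV.
- by move=> i j k a b ij jk ik; rewrite (coords_chain cw) // fM.
- by move=> i j k l a b u; rewrite (coords_disjoint cw).
move=> i j k l a b ij kl /(coords_eq cw ij kl)[[-> [-> /fi e]]|[-> [-> e]]].
  by left; split=> //; split=> //; apply: e; rewrite inE.
by right; split=> //; split=> //; apply: fi; rewrite ?inE // fV.
Qed.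

Lemma apsd_mono (A : finGroupType) s t : s <= t -> apsd A s -> apsd A t.
Proof.
move=> st h y; rewrite -(subnKC st) natrD mulrDl addrA; apply: addr_ge0; first exact: h.
by apply: mulr_ge0; rewrite ?ler0n // sumr_ge0 // => a _; exact: mul_conjC_ge0.
Qed.

Lemma cpsd_mono (gT : finGroupType) (D : {set gT}) s t : s <= t -> cpsd D s -> cpsd D t.
Proof.
move=> st h v; rewrite -(subnKC st) natrD mulrDl addrA; apply: addr_ge0; first exact: h.
by apply: mulr_ge0; rewrite ?ler0n // sumr_ge0 // => x _; exact: mul_conjC_ge0.
Qed.

(** The second condition is equivalent to the wreath transpositions over [A] being 3-transpositions;
    the first is their positivity, for every [m >= 4] at once. *)
Definition admissible t (A : finGroupType) :=
  apsd A t /\ forall a : A, a * a = 1 \/ a * a * a = 1.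

Definition iso_group (A B : finGroupType) := [set: A] \isog [set: B] : Prop.

(** Coordinates over any [A] with at least four indices are ruled out. Only the first condition
    involves [t], so these classes grow with [t]. *)
Definition sporadic t (X : tgroup) := [/\ cpsd (tg_class X) t, ~ complete (tg_class X)
  & ~ exists (A : finGroupType) m (w : 'I_m -> 'I_m -> A -> tg_sort X),
      4 <= m /\ coords (tg_class X) w].

Lemma admissible_enumerated t : exists n, enumerated iso_group (admissible t) n.
Proof.
pose code (A : finGroupType) := magma_code t (1 : A) mulg.
apply: (@enumerated_exists _ _ _ _ _ code) => [A B|A B [/apsd_card hA _] [/apsd_card hB _]].
  by rewrite /iso_group isog_sym.
by apply: group_code_isog; exact: ltnW.
Qed.

Lemma tgroup_qiso_sym (X Y : tgroup) : qiso (tg_class X) (tg_class Y) -> qiso (tg_class Y) (tg_class X).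
Proof. by apply: qiso_sym; case: (tg_tset X). Qed.

Lemma same_central_sym X Y : same_central_type X Y -> same_central_type Y X.
Proof. by move=> /same_centralP/tgroup_qiso_sym/same_centralP. Qed.

(** A large star would provide coordinates, and an incomplete diagram has a commuting pair;
    [starless_bound] then limits the number of vertices, and finitely many codes remain. *)
Lemma sporadic_enumerated t : 0 < t ->
  exists n, enumerated same_central_type (sporadic t) n.
Proof.
move=> t0; have [N hN] := starless_bound (large_frame t) t0.
have bound X : sporadic t X -> #|tg_class X| <= N.
  case=> cX nX nc; have tD := tg_tset X; have pD := cpsd_psd cX.
  have st : starless (tg_class X) (large_frame t).
    apply: NNPP => /(big_star_coords t0 tD (@tg_joined X) pD)[A [m [w [m4 cw]]]].
    by apply: nc; exists A, m, w.
  have [d [f [dD fD df n]]] : exists d f, [/\ d \in tg_class X, f \in tg_class X, f != d & adj d f = false].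
    apply: NNPP => h; apply: nX => d f dD fD df; apply: (@contraT (adj d f)) => n; case: h.
    by exists d, f; split=> //; [rewrite eq_sym | exact: negbTE].
  apply: (hN _ _ tD (@tg_joined X) pD st (@tg_regular X) d f dD).
  by rewrite !inE fD df n.
pose code X := magma_code N (tg_point X) (@tg_op X).
apply: (@enumerated_exists _ _ _ _ _ code) => [X Y|X Y /bound hX /bound hY]; first exact: same_central_sym.
by move/(tgroup_code_qiso hX hY)/same_centralP.
Qed.

Lemma wr_cpsd t (A : finGroupType) m hA (m3 : 3 <= m) : apsd A t ->
  cpsd (tg_class (@wr_group A m hA m3)) t.
Proof. exact: (apsd_cpsd (wr_coords A m) m3). Qed.

Theorem theorem7p2 :
  exists S I : nat -> nat,
    (forall s t : nat, 2 <= s -> s <= t -> S s <= S t)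
    /\ (forall s t : nat, 2 <= s -> s <= t -> I s <= I t)
    /\ forall t : nat, 2 <= t ->
       (* (a) *)
       infinitely_many_central_types moufang_3u2
       /\ (forall X : tgroup,
             is_rho_min X (-1)%R
             <-> in_central_types moufang_3u2 X /\ 1 < #|tg_class X|)
       (* (b) and (c): the families F and the individual examples E *)
       /\ exists (F : 'I_(S t) -> nat -> tgroup) (E : 'I_(I t) -> tgroup),
          [/\ forall (i : 'I_(S t)) (m : nat), 4 <= m -> split_by_Sym m (F i m),
              forall (i j : 'I_(S t)) (m : nat), 4 <= m -> i != j ->
                ~ same_central_type (F i m) (F j m),
              forall i j : 'I_(I t), i != j -> ~ same_central_type (E i) (E j),
              forall i : 'I_(I t),
                ~ in_central_types moufang_3u2 (E i)
                /\ forall (j : 'I_(S t)) (m : nat), 4 <= m ->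
                     ~ same_central_type (E i) (F j m)
            & forall X : tgroup,
                (exists2 r : algC, is_rho_min X r & (- t%:R <= r)%R)
                <-> [\/ in_central_types moufang_3u2 X,
                        exists (i : 'I_(S t)) (m : nat),
                          4 <= m /\ same_central_type X (F i m)
                      | exists i : 'I_(I t), same_central_type X (E i)]].
Proof.
pose S t := proj1_sig (constructive_indefinite_description _ (admissible_enumerated t)).
have SP t : enumerated iso_group (admissible t) (S t).
  by rewrite /S; case: constructive_indefinite_description.
(* The guard makes [I] total, since the finiteness result asks for [0 < t]. *)
have sporadic_enum t : exists n, 0 < t -> enumerated same_central_type (sporadic t) n.
  case: t => [|t]; first by exists 0.
  by have [n h] := sporadic_enumerated (ltn0Sn t); exists n.
pose I t := proj1_sig (constructive_indefinite_description _ (sporadic_enum t)).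
have IP t : 0 < t -> enumerated same_central_type (sporadic t) (I t).
  by rewrite /I; case: constructive_indefinite_description.
have isoS A B : iso_group A B -> iso_group B A by rewrite /iso_group isog_sym.
have isoT A B C : iso_group A B -> iso_group B C -> iso_group A C by exact: isog_trans.
have scT X Y Z : same_central_type X Y -> same_central_type Y Z -> same_central_type X Z.
  by move=> /same_centralP h /same_centralP h'; apply/same_centralP/(qiso_trans h).
exists S, I; split; last split.
- move=> s t _ st; apply: (enumerated_le isoS isoT _ (SP s) (SP t)) => A [h1 h2].
  by split=> //; apply: apsd_mono h1.
- move=> s t s2 st; have [s0 t0] : 0 < s /\ 0 < t.
    by split; [exact: ltnW | exact: leq_trans (ltnW s2) st].
  apply: (enumerated_le same_central_sym scT _ (IP s s0) (IP t t0)) => X [h1 h2 h3].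
  by split=> //; apply: cpsd_mono h1.
move=> t t2; have t0 : 0 < t by exact: ltnW.
split; first exact: infinitely_many_moufang.
split.
  by move=> X; split=> [/rho_min_N1[/central_moufangE h1 h2]//|[/central_moufangE h1 h2]]; apply/rho_min_N1.
have [EA [EAP EAn EAs]] := SP t; have [E [EP En Es]] := IP t t0.
have hE i : forall a : EA i, a * a = 1 \/ a * a * a = 1 by case: (EAP i).
(* Writing [m] as [k.+4] makes [3 <= m] hold by computation. The families take arbitrary values for
   [m < 4], about which nothing is claimed. *)
pose W i k := @wr_group (EA i) k.+4 (hE i) isT.
have Wc i k : coords (tg_class (W i k)) (@wr (EA i) k.+4) by exact: wr_coords.
have m4E m : 4 <= m -> exists k, m = k.+4 by move=> h; exists (m - 4)%N; rewrite -addn4 subnK.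
have k4 k : (k.+4 - 4)%N = k by rewrite -addn4 addnK.
exists (fun i m => W i (m - 4)%N), E; split.
- by move=> i m /m4E[k ->]; rewrite k4; exact: wr_split.
- move=> i j m /m4E[k ->] ij; rewrite k4 => /same_centralP q; case: (EAn i j ij).
  exact: (coords_isog (tg_tset _) (tg_tset _) (Wc i k) (Wc j k) isT q).
- exact: En.
- move=> i; have [h1 h2 h3] := EP i; split; first by move/central_moufangE.
  move=> j m /m4E[k ->]; rewrite k4 => /same_centralP/tgroup_qiso_sym q; apply: h3.
  by have [w' cw'] := coords_transport q (Wc j k); exists (EA j), k.+4, w'.
move=> X; split=> [/rho_min_cpsd h|h].
  case: (classic (complete (tg_class X))) => [/central_moufangE cX|nX]; first exact: Or31.
  case: (classic (exists (A : finGroupType) m (w : 'I_m -> 'I_m -> A -> tg_sort X),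
      4 <= m /\ coords (tg_class X) w)) => [[A [m [w [m4 cw]]]]|nc]; last first.
    by apply: Or33; apply: Es.
  (* Positivity descends from the diagram to [A] because [m >= 4], so [A] is isomorphic to one of
     the enumerated groups. *)
  have [i iA] : exists i, iso_group A (EA i).
    apply: EAs; split; first exact: (cpsd_apsd cw (ltnW m4) m4 h).
    exact: (coords_order cw (ltnW m4) (tg_tset X)).
  have [w' cw'] := coords_isog_param cw (isoS _ _ iA).
  apply: Or32; exists i, m; split=> //; apply/same_centralP.
  have [k ek] := m4E m m4; subst m; rewrite k4.
  exact: (coords_qiso (ltnW m4) cw' (Wc i k)).
apply/rho_min_cpsd.
have transfer Y : cpsd (tg_class Y) t -> same_central_type X Y -> cpsd (tg_class X) t.
  move=> hY /same_centralP/tgroup_qiso_sym q; apply: cpsd_qiso q hY.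
  by case: (tg_tset Y).
case: h => [/central_moufangE cX|[i [m [m4 sc]]]|[i sc]].
- exact: complete_cpsd.
- apply: transfer sc; have [k ->] := m4E m m4; rewrite k4.
  by apply: wr_cpsd; case: (EAP i).
by apply: transfer sc; case: (EP i).
Qed.
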